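(* For all $z\in\mathbb{C}\setminus[0,\infty)$ with $\mathrm{Im}(z)\ge 0$, $$\gamma\!\left(\frac1z\right)=z^3\gamma(z)-\pi i z+z^2\log(1-z)-z\log\frac{z-1}{z}+z(1-z)\left[\gamma+\log 2\pi+\frac{\pi i}{2}+\psi\!\left(\frac{\log z}{2\pi i}\right)\right],$$ where $\gamma=\gamma(1)$ is Euler's constant and $\psi=\Gamma'/\Gamma$ is the digamma function.
   Context: $\gamma(z)$ is the generalized-Euler-constant function: for $|z|\le1$, $\gamma(z)=\sum_{n=1}^{\infty} z^{n-1}\left(\frac{1}{n}-\log\frac{n+1}{n}\right)$, and for $z\in\mathbb{C}\setminus[1,\infty)$ it denotes the analytic continuation $\gamma(z)=\int_0^1\frac{1-x+\log x}{(1-xz)\log x}\,dx$. For $z\ne0$, $\log z=\ln|z|+i\,\mathrm{Arg}\,z$ with $-\pi<\mathrm{Arg}\,z\le\pi$. *)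

(* Defs.v *)
From Stdlib Require Import Reals ClassicalEpsilon.
From Coquelicot Require Import Coquelicot.
Open Scope R_scope.

Definition Cexp (z : C) : C :=
  (exp (Re z) * cos (Im z), exp (Re z) * sin (Im z))%R.

(* principal argument Arg z in (-pi, pi] (for z <> 0) *)
Definition Carg (z : C) : R :=
  if Rle_dec 0 (Im z) then acos (Re z / Cmod z) else - acos (Re z / Cmod z).

Definition Clog (z : C) : C := (ln (Cmod z), Carg z).

Definition euler_gamma : R :=
  Series (fun n : nat => / INR (S n) - ln (INR (S (S n)) / INR (S n))).

(* generalized-Euler-constant function on C \ [1,oo) (analytic continuation):
   gamma(z) = int_0^1 (1 - x + log x) / ((1 - x z) log x) dx *)
Definition gen_gamma (z : C) : C :=
  RInt (V := C_R_CompleteNormedModule)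
    (fun x : R => ((RtoC (1 - x + ln x)) /
                   ((RtoC 1 - RtoC x * z) * RtoC (ln x)))%C) 0 1.

(* complex Gamma function (Euler integral, Re w > 0):
   Gamma(w) = int_0^oo t^(w-1) e^(-t) dt, with t^(w-1) = exp((w-1) ln t) *)
Definition CGamma (w : C) : C :=
  RInt_gen (V := C_R_CompleteNormedModule)
    (fun t : R => (Cexp ((w - RtoC 1) * RtoC (ln t)) * RtoC (exp (- t)))%C)
    (at_right 0) (Rbar_locally p_infty).

Definition Cderive (f : C -> C) (w : C) : C :=
  epsilon (inhabits (RtoC 0))
    (fun l : C => is_derive (K := C_AbsRing) (V := C_NormedModule) f w l).

Definition digamma (w : C) : C := (Cderive CGamma w / CGamma w)%C.

(* Main.v *)
(** Substituting [x = exp (- t)], the combination gamma(1/z) - z^3 gamma(z) splits into two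
    elementary integrals, which give the logarithms, and z (1 - z) times the integral over
    (0, oo) of (1 - exp (- t) - K(t)) / t, where K(t) = sinh t / (cosh t - cos (2 pi w)) and
    z = exp (2 pi i w).  Let J(w) be the integral of K(t) / t regularized by subtracting ln T.
    The theorem amounts to D(w) = J(w) + (pi / 2) cot (pi w) + psi(w) being constant, equal to
    - ln (2 pi).

    The duplication formulas of the three summands give D(w) = (D(w / 2) + D((w + 1) / 2)) / 2.
    Their poles at 0 and 1 cancel, so iterating this identity towards 0 (or towards 1) expresses
    D near an end of the strip 0 < Re w < 1 by its values in the middle, which improves any
    Lipschitz constant by a factor 3; hence D is constant.  The constant is found by letting
    w = 1/2 + i y with y -> oo.

    The logarithmic derivative of Gamma comes from Euler's integrals of (1 - t / n)^n t^(w - 1):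
    they and their analogues with a factor ln t are computed in closed form, and they converge
    to Gamma(w) and Gamma'(w), so that psi(w) = lim (ln n - sum_{k <= n} 1 / (w + k)). *)
Require Import Defs.
From Stdlib Require Import Reals Lra Lia ClassicalEpsilon.
From Coquelicot Require Import Coquelicot.
Open Scope R_scope.

(** * Complex-valued calculus on the real line *)

(** The cotangent is dictated by the reflection w -> 1 - w: J is unchanged by it, whereas psi(1 - w)
    - psi(w) = pi cot (pi w), so half of this has to be added to psi. In terms of z, z (1 - z) (pi /
    2) cot (pi w) = - (pi i / 2) z (z + 1), which is the sum of the terms - pi i z and z (1 - z) pi
    i / 2 of the theorem.

    The scheme is that of Herglotz for the partial fractions of the cotangent. It avoids analytic
    continuation: a power series in z reaches only |z| < 1, while the theorem asks for every |z|,
    that is, for every value of Im w. Herglotz's maximum argument wants a continuous extension to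
    the closed strip; here only h D(h w) -> 0 (and its mirror image at 1) is shown, which is enough
    for differences of D, and these are contracted by the averaging. The Lipschitz constants depend
    on a bound Y of |Im w|, which w / 2 and (w + 1) / 2 respect. *)

Lemma norm_C_R (x : C) : norm (V := C_R_NormedModule) x = Cmod x.
Proof.
  unfold norm, Cmod; simpl. unfold prod_norm; simpl.
  f_equal. unfold norm; simpl. unfold abs; simpl.
  rewrite !Rmult_1_r.
  rewrite <- !Rabs_mult, !Rabs_pos_eq; try nra.
Qed.

Lemma ball_Rabs (x eps y : R) : ball x eps y -> Rabs (y - x) < eps.
Proof. trivial. Qed.

Lemma RtoC_neq_0 (x : R) : x <> 0 -> RtoC x <> 0%C.
Proof. intros Hx E. now apply RtoC_inj in E. Qed.

Lemma Cmod_Ci : Cmod Ci = 1.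
Proof.
  unfold Cmod, Ci; simpl. replace (0 * (0 * 1) + 1 * (1 * 1)) with 1 by ring. apply sqrt_1.
Qed.

Lemma Cexp_0 : Cexp 0 = 1%C.
Proof. unfold Cexp; simpl. rewrite exp_0, cos_0, sin_0. unfold RtoC. f_equal; ring. Qed.

Lemma Cexp_plus (u v : C) : Cexp (u + v) = (Cexp u * Cexp v)%C.
Proof.
  unfold Cexp, Cmult, Cplus, Re, Im; simpl. rewrite exp_plus, cos_plus, sin_plus.
  f_equal; ring.
Qed.

Lemma Cmod_Cexp (u : C) : Cmod (Cexp u) = exp (Re u).
Proof.
  unfold Cmod, Cexp; simpl.
  replace (_ + _) with (Rsqr (exp (Re u))).
  - apply sqrt_Rsqr. left; apply exp_pos.
  - assert (H := sin2_cos2 (Im u)). unfold Rsqr in *. nra.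
Qed.

Lemma Cexp_neq_0 (u : C) : Cexp u <> 0%C.
Proof.
  intro H. assert (E := Cmod_Cexp u). rewrite H, Cmod_0 in E.
  generalize (exp_pos (Re u)); lra.
Qed.

Lemma Cexp_opp (u : C) : Cexp (- u) = (/ Cexp u)%C.
Proof.
  assert (H : (Cexp (- u) * Cexp u)%C = 1%C).
  { rewrite <- Cexp_plus. replace (- u + u)%C with (RtoC 0) by ring. apply Cexp_0. }
  rewrite <- (Cmult_1_l (/ Cexp u)), <- H. field. apply Cexp_neq_0.
Qed.

Lemma Cexp_RtoC (x : R) : Cexp (RtoC x) = RtoC (exp x).
Proof. unfold Cexp; simpl. rewrite cos_0, sin_0. unfold RtoC. f_equal; ring. Qed.

Notation is_derive_RC := (is_derive (K := R_AbsRing) (V := C_R_NormedModule)).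

Lemma is_derive_C (f : R -> C) (x : R) (l : C) :
  is_derive (fun t => Re (f t)) x (Re l) -> is_derive (fun t => Im (f t)) x (Im l) ->
  is_derive_RC f x l.
Proof.
  intros H1 H2.
  apply (is_derive_ext (V := C_R_NormedModule)
    (fun t => plus (scal (Re (f t)) ((1, 0) : C_R_NormedModule))
                (scal (Im (f t)) ((0, 1) : C_R_NormedModule)))).
  { intro t. destruct (f t) as [a b]. unfold plus, scal, Re, Im; simpl.
    unfold prod_plus, prod_scal, plus, scal; simpl. unfold mult; simpl. f_equal; ring. }
  replace l with (plus (scal (Re l) ((1, 0) : C_R_NormedModule))
                (scal (Im l) ((0, 1) : C_R_NormedModule))).
  - apply (is_derive_plus (V := C_R_NormedModule)); apply (is_derive_scal_l (V := C_R_NormedModule)); assumption.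
  - destruct l as [a b]. unfold plus, scal, Re, Im; simpl.
    unfold prod_plus, prod_scal, plus, scal; simpl. unfold mult; simpl. f_equal; ring.
Qed.

Lemma continuous_C {U : UniformSpace} (f : U -> C) (x : U) :
  continuous (fun t => Re (f t)) x -> continuous (fun t => Im (f t)) x -> continuous f x.
Proof.
  intros H1 H2. apply (continuous_ext (fun t => (Re (f t), Im (f t)))).
  - intro t. now destruct (f t).
  - now apply (continuous_comp_2 (fun t => Re (f t)) (fun t => Im (f t)) (fun a b => (a, b)) x H1 H2), continuous_ext with (fun p : R * R => p); [intros [? ?]|apply continuous_id].
Qed.

Lemma continuous_Re {U : UniformSpace} (f : U -> C) (x : U) :
  continuous f x -> continuous (fun t => Re (f t)) x.
Proof. intros H. apply (continuous_comp f (fun p : R * R => fst p) x H), continuous_fst. Qed.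

Lemma continuous_Im {U : UniformSpace} (f : U -> C) (x : U) :
  continuous f x -> continuous (fun t => Im (f t)) x.
Proof. intros H. apply (continuous_comp f (fun p : R * R => snd p) x H), continuous_snd. Qed.

Lemma continuous_Cmult {U : UniformSpace} (f g : U -> C) (x : U) :
  continuous f x -> continuous g x -> continuous (fun t => (f t * g t)%C) x.
Proof.
  intros Hf Hg.
  assert (H1 := continuous_Re f x Hf). assert (H2 := continuous_Im f x Hf).
  assert (H3 := continuous_Re g x Hg). assert (H4 := continuous_Im g x Hg).
  apply continuous_C; unfold Cmult; simpl.
  - apply (continuous_minus (V := R_NormedModule)); now apply (continuous_mult (K := R_AbsRing)).
  - apply (continuous_plus (V := R_NormedModule)); now apply (continuous_mult (K := R_AbsRing)).
Qed.

Lemma continuous_Cplus {U : UniformSpace} (f g : U -> C) (x : U) :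
  continuous f x -> continuous g x -> continuous (fun t => (f t + g t)%C) x.
Proof. intros Hf Hg. apply (continuous_plus (V := C_R_NormedModule) f g x Hf Hg). Qed.

Lemma continuous_Cminus {U : UniformSpace} (f g : U -> C) (x : U) :
  continuous f x -> continuous g x -> continuous (fun t => (f t - g t)%C) x.
Proof. intros Hf Hg. apply (continuous_minus (V := C_R_NormedModule) f g x Hf Hg). Qed.

Lemma continuous_Cconst {U : UniformSpace} (a : C) (x : U) :
  continuous (fun _ : U => a) x.
Proof. apply continuous_const. Qed.

Lemma continuous_RtoC {U : UniformSpace} (f : U -> R) (x : U) :
  continuous f x -> continuous (fun t => RtoC (f t)) x.
Proof. intros H. apply continuous_C; simpl; [exact H | apply continuous_const]. Qed.

Lemma continuous_Cinv {U : UniformSpace} (f : U -> C) (x : U) :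
  continuous f x -> f x <> 0%C -> continuous (fun t => (/ f t)%C) x.
Proof.
  intros Hf H0.
  assert (H1 := continuous_Re f x Hf). assert (H2 := continuous_Im f x Hf).
  assert (D : Re (f x) ^ 2 + Im (f x) ^ 2 <> 0).
  { intro H. apply H0. destruct (f x) as [a b]; unfold Re, Im in H; simpl in H.
    unfold RtoC. f_equal; nra. }
  assert (H3 : continuous (fun t => / (Re (f t) ^ 2 + Im (f t) ^ 2)) x).
  { apply (continuous_comp (fun t => Re (f t) ^ 2 + Im (f t) ^ 2) Rinv x).
    - apply (continuous_plus (V := R_NormedModule)).
      + apply (continuous_ext (fun t => Re (f t) * Re (f t))). { intro; simpl; ring. }
        now apply (continuous_mult (K := R_AbsRing)).
      + apply (continuous_ext (fun t => Im (f t) * Im (f t))). { intro; simpl; ring. }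
        now apply (continuous_mult (K := R_AbsRing)).
    - now apply continuous_Rinv. }
  apply continuous_C; unfold Cinv; simpl.
  - now apply (continuous_mult (K := R_AbsRing)).
  - apply (continuous_mult (K := R_AbsRing)); [now apply (continuous_opp (V := R_NormedModule))|exact H3].
Qed.

Lemma continuous_Cdiv {U : UniformSpace} (f g : U -> C) (x : U) :
  continuous f x -> continuous g x -> g x <> 0%C -> continuous (fun t => (f t / g t)%C) x.
Proof. intros. apply continuous_Cmult; [|apply continuous_Cinv]; assumption. Qed.

Lemma continuous_Cexp {U : UniformSpace} (f : U -> C) (x : U) :
  continuous f x -> continuous (fun t => Cexp (f t)) x.
Proof.
  intros Hf.
  assert (H1 := continuous_Re f x Hf). assert (H2 := continuous_Im f x Hf).
  assert (E : continuous (fun t => exp (Re (f t))) x) by (apply (continuous_comp _ exp x H1), continuous_exp).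
  apply continuous_C; unfold Cexp; simpl; apply (continuous_mult (K := R_AbsRing)); try exact E.
  - apply (continuous_comp _ cos x H2), continuous_cos.
  - apply (continuous_comp _ sin x H2), continuous_sin.
Qed.

Notation is_CRInt := (is_RInt (V := C_R_NormedModule)).
Notation ex_CRInt := (ex_RInt (V := C_R_NormedModule)).
Notation CRInt := (RInt (V := C_R_CompleteNormedModule)).

Lemma is_CRInt_mult (c : C) (f : R -> C) (a b : R) (l : C) :
  is_CRInt f a b l -> is_CRInt (fun t => (c * f t)%C) a b (c * l)%C.
Proof.
  intros H.
  assert (H1 := is_RInt_fct_extend_fst (U := R_NormedModule) (V := R_NormedModule) f a b l H).
  assert (H2 := is_RInt_fct_extend_snd (U := R_NormedModule) (V := R_NormedModule) f a b l H).
  apply (is_RInt_fct_extend_pair (U := R_NormedModule) (V := R_NormedModule)); simpl.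
  - apply (is_RInt_minus (V := R_NormedModule)); now apply (is_RInt_scal (V := R_NormedModule)).
  - apply (is_RInt_plus (V := R_NormedModule)); now apply (is_RInt_scal (V := R_NormedModule)).
Qed.

Lemma is_CRInt_plus (f g : R -> C) (a b : R) (l m : C) :
  is_CRInt f a b l -> is_CRInt g a b m -> is_CRInt (fun t => (f t + g t)%C) a b (l + m)%C.
Proof. apply (is_RInt_plus (V := C_R_NormedModule)). Qed.

Lemma is_CRInt_minus (f g : R -> C) (a b : R) (l m : C) :
  is_CRInt f a b l -> is_CRInt g a b m -> is_CRInt (fun t => (f t - g t)%C) a b (l - m)%C.
Proof. apply (is_RInt_minus (V := C_R_NormedModule)). Qed.

Lemma is_CRInt_RtoC (f : R -> R) (a b l : R) :
  is_RInt f a b l -> is_CRInt (fun t => RtoC (f t)) a b (RtoC l).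
Proof.
  intros H.
  apply (is_RInt_fct_extend_pair (U := R_NormedModule) (V := R_NormedModule)); simpl.
  - exact H.
  - assert (H0 := is_RInt_const (V := R_NormedModule) a b 0).
    rewrite (scal_zero_r (V := R_ModuleSpace)) in H0. exact H0.
Qed.

Lemma Cmod_is_CRInt_le (f : R -> C) (g : R -> R) (a b : R) (l : C) (lg : R) :
  a <= b -> (forall x, a <= x <= b -> Cmod (f x) <= g x) ->
  is_CRInt f a b l -> is_RInt g a b lg -> Cmod l <= lg.
Proof.
  intros Hab Hfg Hf Hg. rewrite <- norm_C_R.
  apply (norm_RInt_le (V := C_R_NormedModule) f g a b l lg Hab); try assumption.
  intros x Hx. rewrite norm_C_R. now apply Hfg.
Qed.

Lemma ex_CRInt_continuous (f : R -> C) (a b : R) :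
  a <= b -> (forall x, a <= x <= b -> continuous f x) -> ex_CRInt f a b.
Proof.
  intros Hab H. apply (ex_RInt_continuous (V := C_R_CompleteNormedModule)).
  rewrite Rmin_left, Rmax_right by assumption. exact H.
Qed.

Lemma is_CRInt_CRInt (f : R -> C) (a b : R) :
  ex_CRInt f a b -> is_CRInt f a b (CRInt f a b).
Proof. apply (RInt_correct (V := C_R_CompleteNormedModule)). Qed.

Lemma CRInt_unique (f : R -> C) (a b : R) (l : C) :
  is_CRInt f a b l -> CRInt f a b = l.
Proof. apply (is_RInt_unique (V := C_R_CompleteNormedModule)). Qed.

Lemma is_CRInt_derive (f df : R -> C) (a b : R) :
  a <= b ->
  (forall x, a <= x <= b -> is_derive_RC f x (df x)) ->
  (forall x, a <= x <= b -> continuous df x) ->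
  is_CRInt df a b (f b - f a)%C.
Proof.
  intros Hab H1 H2. apply (is_RInt_derive (V := C_R_CompleteNormedModule) f df a b);
  rewrite Rmin_left, Rmax_right by assumption; assumption.
Qed.

Lemma is_derive_Cexp_line (d : C) (s : R) :
  is_derive_RC
    (fun s : R => Cexp (RtoC s * d)) s (d * Cexp (RtoC s * d))%C.
Proof.
  destruct d as [p q].
  apply is_derive_C; unfold Cexp, Cmult, RtoC, Re, Im; simpl; auto_derive; trivial; unfold Rminus; ring.
Qed.

(** The remainders of the exponential series are estimated along the segment from 0 to [d]: each is
    the integral of [d] times the preceding one, so that bounds under a real integral suffice. *)
Lemma is_CRInt_Cexp_line (d : C) :
  is_CRInt (fun s => (d * Cexp (RtoC s * d))%C) 0 1 (Cexp d - 1)%C.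
Proof.
  replace (Cexp d - 1)%C with (Cexp (RtoC 1 * d) - Cexp (RtoC 0 * d))%C.
  2: { rewrite Cmult_1_l, Cmult_0_l, Cexp_0. reflexivity. }
  apply (is_CRInt_derive (fun s : R => Cexp (RtoC s * d))). lra.
  - intros x _. apply is_derive_Cexp_line.
  - intros x _. apply continuous_Cmult; [apply continuous_Cconst|].
    apply continuous_Cexp, continuous_Cmult; [|apply continuous_Cconst].
    apply continuous_RtoC, continuous_id.
Qed.

Lemma Re_le_Cmod (d : C) : Re d <= Cmod d.
Proof. apply Rle_trans with (1 := Rle_abs _). apply Rle_trans with (2 := Rmax_Cmod d). apply Rmax_l. Qed.

Lemma Cmod_Cexp_line_le (d : C) (s : R) : 0 <= s <= 1 -> Cmod (Cexp (RtoC s * d)) <= exp (Cmod d).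
Proof.
  intros Hs. rewrite Cmod_Cexp.
  assert (H : Re (RtoC s * d) <= Cmod d).
  { replace (Re (RtoC s * d)) with (s * Re d) by (unfold Re, Cmult, RtoC; simpl; ring).
    assert (H1 := Re_le_Cmod d). assert (H2 := Cmod_ge_0 d). nra. }
  destruct H as [H|H]; [left; now apply exp_increasing | right; now f_equal].
Qed.

Lemma is_RInt_const_R (a b c : R) : is_RInt (fun _ => c) a b ((b - a) * c).
Proof. apply (is_RInt_const (V := R_NormedModule)). Qed.

Lemma is_CRInt_const (d : C) (a b : R) : is_CRInt (fun _ => d) a b (RtoC (b - a) * d)%C.
Proof.
  assert (H := is_CRInt_mult d _ _ _ _ (is_CRInt_RtoC _ _ _ _ (is_RInt_const_R a b 1))).
  rewrite Rmult_1_r in H. rewrite Cmult_comm. revert H. apply is_RInt_ext. intros x _. apply Cmult_1_r.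
Qed.

Lemma Cexp_minus_1_le (d : C) : Cmod (Cexp d - 1) <= Cmod d * exp (Cmod d).
Proof.
  assert (H := is_RInt_const_R 0 1 (Cmod d * exp (Cmod d))).
  replace ((1 - 0) * (Cmod d * exp (Cmod d))) with (Cmod d * exp (Cmod d)) in H by ring.
  refine (Cmod_is_CRInt_le _ _ 0 1 _ _ Rle_0_1 _ (is_CRInt_Cexp_line d) H).
  intros s Hs. rewrite Cmod_mult. apply Rmult_le_compat_l; [apply Cmod_ge_0|].
  now apply Cmod_Cexp_line_le.
Qed.

Lemma exp_le_compat (x y : R) : x <= y -> exp x <= exp y.
Proof. intros [H|H]; [left; now apply exp_increasing | right; now f_equal]. Qed.

Lemma Cmod_scal_le (d : C) (s : R) : 0 <= s <= 1 -> Cmod (RtoC s * d) <= Cmod d.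
Proof.
  intros Hs. rewrite Cmod_mult, Cmod_R, Rabs_pos_eq by lra.
  assert (H2 := Cmod_ge_0 d). nra.
Qed.

Lemma Cexp_taylor_1 (d : C) : Cmod (Cexp d - 1 - d) <= Cmod d ^ 2 * exp (Cmod d).
Proof.
  assert (H := is_RInt_const_R 0 1 (Cmod d ^ 2 * exp (Cmod d))).
  replace ((1 - 0) * (Cmod d ^ 2 * exp (Cmod d))) with (Cmod d ^ 2 * exp (Cmod d)) in H by ring.
  assert (H0 : is_CRInt (fun _ => d) 0 1 d).
  { assert (E := is_CRInt_const d 0 1).
    replace (RtoC (1 - 0) * d)%C with d in E by (rewrite Rminus_0_r; ring).
    exact E. }
  refine (Cmod_is_CRInt_le _ _ 0 1 _ _ Rle_0_1 _
    (is_CRInt_minus _ _ _ _ _ _ (is_CRInt_Cexp_line d) H0) H).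
  intros s Hs. replace (d * Cexp (RtoC s * d) - d)%C with (d * (Cexp (RtoC s * d) - 1))%C by ring.
  rewrite Cmod_mult. simpl pow. rewrite Rmult_1_r, Rmult_assoc.
  apply Rmult_le_compat_l; [apply Cmod_ge_0|].
  apply Rle_trans with (1 := Cexp_minus_1_le _).
  assert (E := Cmod_scal_le d s Hs).
  apply Rmult_le_compat; [apply Cmod_ge_0|left; apply exp_pos|exact E|now apply exp_le_compat].
Qed.

Lemma Cexp_taylor_2 (d : C) : Cmod (Cexp d - 1 - d - d * d / 2) <= Cmod d ^ 3 * exp (Cmod d).
Proof.
  assert (H := is_RInt_const_R 0 1 (Cmod d ^ 3 * exp (Cmod d))).
  replace ((1 - 0) * (Cmod d ^ 3 * exp (Cmod d))) with (Cmod d ^ 3 * exp (Cmod d)) in H by ring.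
  assert (H0 : is_CRInt (fun s => d + d * (RtoC s * d))%C 0 1 (d + d * d / 2)%C).
  { replace (d + d * d / 2)%C with
     ((RtoC 1 * d + RtoC (1 ^ 2 / 2) * (d * d)) - (RtoC 0 * d + RtoC (0 ^ 2 / 2) * (d * d)))%C.
    2: { destruct d as [p q]. unfold RtoC, Cminus, Cplus, Cmult, Copp, Cdiv, Cinv; simpl. f_equal; field. }
    apply (is_CRInt_derive (fun s => RtoC s * d + RtoC (s ^ 2 / 2) * (d * d))%C). lra.
    - intros s _. destruct d as [p q].
      apply is_derive_C; unfold Re, Im, Cplus, Cmult, RtoC; simpl; auto_derive; trivial; field.
    - intros s _. apply continuous_Cplus; [apply continuous_Cconst|].
      apply continuous_Cmult; [apply continuous_Cconst|].
      apply continuous_Cmult; [|apply continuous_Cconst].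
      apply continuous_RtoC, continuous_id. }
  replace (Cexp d - 1 - d - d * d / 2)%C with (Cexp d - 1 - (d + d * d / 2))%C by ring.
  refine (Cmod_is_CRInt_le _ _ 0 1 _ _ Rle_0_1 _
    (is_CRInt_minus _ _ _ _ _ _ (is_CRInt_Cexp_line d) H0) H).
  intros s Hs. replace (d * Cexp (RtoC s * d) - (d + d * (RtoC s * d)))%C
    with (d * (Cexp (RtoC s * d) - 1 - RtoC s * d))%C by ring.
  rewrite Cmod_mult. replace (Cmod d ^ 3) with (Cmod d * Cmod d ^ 2) by ring. rewrite Rmult_assoc.
  apply Rmult_le_compat_l; [apply Cmod_ge_0|].
  apply Rle_trans with (1 := Cexp_taylor_1 _).
  assert (E := Cmod_scal_le d s Hs).
  apply Rmult_le_compat; [apply pow_le, Cmod_ge_0|left; apply exp_pos| |now apply exp_le_compat].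
  apply pow_incr; split; [apply Cmod_ge_0|exact E].
Qed.

(** The segment from [v] to [u] stays in the half-plane Re <= [M], where [Cexp] and its derivative
    have modulus at most [exp M]. *)
Lemma Cexp_lipschitz (M : R) (u v : C) :
  Re u <= M -> Re v <= M -> Cmod (Cexp u - Cexp v) <= exp M * Cmod (u - v).
Proof.
  intros Hu Hv.
  assert (H := is_RInt_const_R 0 1 (exp M * Cmod (u - v))).
  replace ((1 - 0) * (exp M * Cmod (u - v))) with (exp M * Cmod (u - v)) in H by ring.
  replace (Cexp u - Cexp v)%C with (Cexp v * (Cexp (u - v) - 1))%C.
  2: { replace u with (v + (u - v))%C at 2 by ring. rewrite Cexp_plus. ring. }
  refine (Cmod_is_CRInt_le _ _ 0 1 _ _ Rle_0_1 _
    (is_CRInt_mult (Cexp v) _ _ _ _ (is_CRInt_Cexp_line (u - v))) H).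
  intros s Hs. replace (Cexp v * ((u - v) * Cexp (RtoC s * (u - v))))%C
    with (Cexp (v + RtoC s * (u - v)) * (u - v))%C by (rewrite Cexp_plus; ring).
  rewrite Cmod_mult. apply Rmult_le_compat_r; [apply Cmod_ge_0|].
  rewrite Cmod_Cexp. apply exp_le_compat.
  replace (Re (v + RtoC s * (u - v))) with ((1 - s) * Re v + s * Re u)
    by (destruct u, v; unfold Re, Cplus, Cmult, Cminus, Copp, RtoC; simpl; ring).
  nra.
Qed.

Lemma is_derive_fst_snd (f : R -> C) (x : R) (l : C) :
  is_derive_RC f x l ->
  is_derive (fun t => Re (f t)) x (Re l) /\ is_derive (fun t => Im (f t)) x (Im l).
Proof.
  intros H. split.
  - apply (filterdiff_ext_lin _ (fun y : R => fst (scal y (l : C_R_NormedModule))) _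
      (filterdiff_comp' f (fst : C_R_NormedModule -> R_NormedModule) x _ _ H (filterdiff_linear _ is_linear_fst))).
    reflexivity.
  - apply (filterdiff_ext_lin _ (fun y : R => snd (scal y (l : C_R_NormedModule))) _
      (filterdiff_comp' f (snd : C_R_NormedModule -> R_NormedModule) x _ _ H (filterdiff_linear _ is_linear_snd))).
    reflexivity.
Qed.

Lemma is_derive_Cmult (f g : R -> C) (x : R) (df dg : C) :
  is_derive_RC f x df ->
  is_derive_RC g x dg ->
  is_derive_RC (fun t => f t * g t)%C x (df * g x + f x * dg)%C.
Proof.
  intros Hf Hg. apply is_derive_fst_snd in Hf. apply is_derive_fst_snd in Hg.
  destruct Hf as [F1 F2]. destruct Hg as [G1 G2].
  apply is_derive_C; unfold Cmult, Cplus, Re, Im in *; simpl.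
  - evar_last.
    + apply (is_derive_minus (V := R_NormedModule)); apply (is_derive_mult (K := R_AbsRing));
      [exact F1|exact G1|intros; apply Rmult_comm|exact F2|exact G2|intros; apply Rmult_comm].
    + unfold minus, plus, opp, mult; simpl; ring.
  - evar_last.
    + apply (is_derive_plus (V := R_NormedModule)); apply (is_derive_mult (K := R_AbsRing));
      [exact F1|exact G2|intros; apply Rmult_comm|exact F2|exact G1|intros; apply Rmult_comm].
    + unfold minus, plus, opp, mult; simpl; ring.
Qed.

Lemma is_derive_Cscal (c : C) (f : R -> C) (x : R) (df : C) :
  is_derive_RC f x df ->
  is_derive_RC (fun t => c * f t)%C x (c * df)%C.
Proof.
  intros Hf. replace (c * df)%C with (0 * f x + c * df)%C by ring.
  apply (is_derive_Cmult (fun _ => c) f); [|exact Hf]. apply (is_derive_const (V := C_R_NormedModule)).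
Qed.

(** * Limits of complex-valued functions *)

(** Convergence is measured by [Cmod], the quantity that all estimates bound, and not by the two
    components on which the uniform structure of pairs is built; [Clim_filterlim] and
    [filterlim_Clim] translate. *)
Definition Clim {T} (F : (T -> Prop) -> Prop) (f : T -> C) (l : C) :=
  forall eps, 0 < eps -> F (fun x => Cmod (f x - l) < eps).

Section Limits.
Context {T : Type} {F : (T -> Prop) -> Prop} {FF : ProperFilter F}.

Lemma filter_imp2 (P Q S : T -> Prop) :
  (forall x, P x -> Q x -> S x) -> F P -> F Q -> F S.
Proof.
  intros H HP HQ. apply (filter_imp (F := F) (fun x => P x /\ Q x)).
  - intros x [A B]. now apply H.
  - now apply filter_and.
Qed.

Lemma Clim_ext_loc (f g : T -> C) (l : C) :
  F (fun x => f x = g x) -> Clim F f l -> Clim F g l.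
Proof.
  intros H Hf eps He. generalize (filter_and _ _ H (Hf eps He)). apply filter_imp.
  intros x [E H1]. now rewrite <- E.
Qed.

Lemma Clim_ext (f g : T -> C) (l : C) :
  (forall x, f x = g x) -> Clim F f l -> Clim F g l.
Proof. intros H. apply Clim_ext_loc. now apply filter_forall. Qed.

Lemma Clim_le (f : T -> C) (l : C) (g : T -> R) :
  F (fun x => Cmod (f x - l) <= g x) -> filterlim g F (locally 0) -> Clim F f l.
Proof.
  intros H Hg eps He.
  assert (H1 := proj1 (filterlim_locally g 0) Hg (mkposreal eps He)).
  apply filter_imp2 with (2 := H) (3 := H1). intros x A B.
  apply ball_Rabs in B; simpl in B.
  apply Rle_lt_trans with (1 := A). apply Rle_lt_trans with (2 := B).
  rewrite Rminus_0_r. apply Rle_abs.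
Qed.

Lemma Clim_const (l : C) : Clim F (fun _ => l) l.
Proof.
  intros eps He. apply filter_forall. intros _.
  replace (l - l)%C with (RtoC 0) by ring. now rewrite Cmod_0.
Qed.

Lemma Clim_plus (f g : T -> C) (l m : C) :
  Clim F f l -> Clim F g m -> Clim F (fun x => f x + g x)%C (l + m).
Proof.
  intros Hf Hg eps He.
  apply filter_imp2 with (2 := Hf (eps / 2) ltac:(lra)) (3 := Hg (eps / 2) ltac:(lra)).
  intros x A B.
  replace (f x + g x - (l + m))%C with ((f x - l) + (g x - m))%C by ring.
  apply Rle_lt_trans with (1 := Cmod_triangle _ _). lra.
Qed.

Lemma Clim_bounded (f : T -> C) (l : C) :
  Clim F f l -> F (fun x => Cmod (f x) <= Cmod l + 1).
Proof.
  intros Hf. generalize (Hf 1 Rlt_0_1). apply filter_imp. intros x Hx.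
  replace (f x) with (l + (f x - l))%C by ring.
  apply Rle_trans with (1 := Cmod_triangle _ _). lra.
Qed.

Lemma Clim_mult (f g : T -> C) (l m : C) :
  Clim F f l -> Clim F g m -> Clim F (fun x => f x * g x)%C (l * m).
Proof.
  intros Hf Hg eps He. assert (P1 := Cmod_ge_0 l). assert (P2 := Cmod_ge_0 m).
  set (K := Cmod l + 1 + Cmod m). assert (HK : 0 < K) by (unfold K; lra).
  assert (He' : 0 < eps / (2 * K)) by (apply Rdiv_lt_0_compat; lra).
  apply filter_imp2 with (2 := Clim_bounded f l Hf)
    (Q := fun x => Cmod (f x - l) < eps / (2 * K) /\ Cmod (g x - m) < eps / (2 * K)).
  2: { apply filter_and; [exact (Hf _ He') | exact (Hg _ He')]. }
  intros x A [B D].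
  replace (f x * g x - l * m)%C with (f x * (g x - m) + (f x - l) * m)%C by ring.
  apply Rle_lt_trans with (1 := Cmod_triangle _ _). rewrite !Cmod_mult.
  apply Rle_lt_trans with (K * (eps / (2 * K))).
  2: { replace (K * (eps / (2 * K))) with (eps / 2) by (field; lra). lra. }
  assert (P3 := Cmod_ge_0 (g x - m)). assert (P4 := Cmod_ge_0 (f x - l)).
  unfold K at 1. rewrite Rmult_plus_distr_r. apply Rplus_le_compat.
  - apply Rmult_le_compat; try lra. apply Cmod_ge_0.
  - rewrite Rmult_comm. apply Rmult_le_compat; lra.
Qed.

Lemma Clim_scal (a : C) (f : T -> C) (l : C) :
  Clim F f l -> Clim F (fun x => a * f x)%C (a * l).
Proof. intros Hf. apply Clim_mult; [apply Clim_const | exact Hf]. Qed.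

Lemma Clim_minus (f g : T -> C) (l m : C) :
  Clim F f l -> Clim F g m -> Clim F (fun x => f x - g x)%C (l - m).
Proof.
  intros Hf Hg. replace (l - m)%C with (l + (- RtoC 1) * m)%C by ring.
  apply Clim_ext with (fun x => f x + (- RtoC 1) * g x)%C. { intro; ring. }
  apply Clim_plus; [exact Hf|]. now apply Clim_scal.
Qed.

Lemma Cmod_Clim_le (f : T -> C) (l : C) (M : R) :
  F (fun x => Cmod (f x) <= M) -> Clim F f l -> Cmod l <= M.
Proof.
  intros H Hf. apply le_epsilon. intros eps He.
  destruct (filter_ex (F := F) _ (filter_and _ _ H (Hf eps He))) as [x [A B]].
  replace l with (f x + - (f x - l))%C by ring.
  apply Rle_trans with (1 := Cmod_triangle _ _). rewrite Cmod_opp. lra.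
Qed.

Lemma Clim_unique (f : T -> C) (l m : C) : Clim F f l -> Clim F f m -> l = m.
Proof.
  intros Hl Hm.
  assert (H : Cmod (l - m) <= 0).
  { apply (Cmod_Clim_le (fun x => f x - f x)%C).
    - apply filter_forall. intro x. replace (f x - f x)%C with (RtoC 0) by ring. rewrite Cmod_0; lra.
    - now apply Clim_minus. }
  assert (E : (l - m)%C = RtoC 0).
  { apply Cmod_eq_0. generalize (Cmod_ge_0 (l - m)); lra. }
  replace l with (l - m + m)%C by ring. rewrite E. ring.
Qed.

Lemma Clim_ge (f : T -> C) (l : C) (M : R) :
  F (fun x => M <= Cmod (f x)) -> Clim F f l -> M <= Cmod l.
Proof.
  intros H Hf. apply le_epsilon. intros eps He.
  destruct (filter_ex (F := F) _ (filter_and _ _ H (Hf eps He))) as [x [A B]].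
  apply Rle_trans with (1 := A).
  replace (f x) with (l + (f x - l))%C by ring.
  apply Rle_trans with (1 := Cmod_triangle _ _). lra.
Qed.

Lemma Clim_inv (f : T -> C) (l : C) :
  l <> 0%C -> Clim F f l -> Clim F (fun x => / f x)%C (/ l).
Proof.
  intros H0 Hf eps He. assert (P := Cmod_gt_0 l). apply P in H0 as Pl. clear P.
  assert (He1 : 0 < Rmin (Cmod l / 2) (eps * (Cmod l * Cmod l / 2))).
  { apply Rmin_pos; [lra|]. apply Rmult_lt_0_compat; [lra|]. nra. }
  generalize (Hf _ He1). apply filter_imp. intros x Hx.
  assert (A := Rlt_le_trans _ _ _ Hx (Rmin_l _ _)).
  assert (B := Rlt_le_trans _ _ _ Hx (Rmin_r _ _)).
  assert (D : Cmod l / 2 < Cmod (f x)).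
  { assert (E := Cmod_triangle (f x) (- (f x - l))%C).
    replace (f x + - (f x - l))%C with l in E by ring. rewrite Cmod_opp in E. lra. }
  assert (N : f x <> 0%C). { intro E; rewrite E, Cmod_0 in D; lra. }
  replace (/ f x - / l)%C with (- (f x - l) / (f x * l))%C by (field; now split).
  rewrite Cmod_div by now apply Cmult_neq_0.
  rewrite Cmod_opp, Cmod_mult.
  apply Rlt_div_l. { apply Rmult_lt_0_compat; lra. }
  apply Rlt_le_trans with (1 := B). apply Rmult_le_compat_l; [lra|]. nra.
Qed.

Lemma Clim_RtoC (f : T -> R) (l : R) :
  filterlim f F (locally l) -> Clim F (fun x => RtoC (f x)) (RtoC l).
Proof.
  intros H eps He. assert (H1 := proj1 (filterlim_locally f l) H (mkposreal eps He)).
  revert H1. apply filter_imp. intros x Hx.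
  apply ball_Rabs in Hx; simpl in Hx.
  rewrite <- RtoC_minus, Cmod_R. exact Hx.
Qed.

Lemma Clim_filterlim (f : T -> C) (l : C) :
  Clim F f l -> filterlim f F (locally (T := C_UniformSpace) l).
Proof.
  intros H. apply filterlim_locally. intros [eps He].
  generalize (H eps He). apply filter_imp. intros x Hx.
  assert (E := Rmax_Cmod (f x - l)%C).
  split; simpl; unfold ball; simpl; unfold AbsRing_ball, abs, minus, plus, opp; simpl;
   (apply Rle_lt_trans with (2 := Hx)); apply Rle_trans with (2 := E); [apply Rmax_l|apply Rmax_r].
Qed.

Lemma filterlim_Clim (f : T -> C) (l : C) :
  filterlim f F (locally (T := C_UniformSpace) l) -> Clim F f l.
Proof.
  intros H eps He.
  assert (He' : 0 < eps / 2) by lra.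
  generalize (proj1 (filterlim_locally f l) H (mkposreal _ He')). apply filter_imp.
  intros x [A B].
  unfold ball in A, B; simpl in A, B; unfold AbsRing_ball, abs, minus, plus, opp in A, B; simpl in A, B.
  apply Rle_lt_trans with (1 := Cmod_2Rmax _).
  assert (S : sqrt 2 < 2). { rewrite <- (sqrt_square 2) at 2 by lra. apply sqrt_lt_1; lra. }
  assert (M : Rmax (Rabs (fst (f x - l)%C)) (Rabs (snd (f x - l)%C)) < eps / 2).
  { apply Rmax_lub_lt; assumption. }
  assert (N : 0 <= Rmax (Rabs (fst (f x - l)%C)) (Rabs (snd (f x - l)%C))).
  { apply Rle_trans with (2 := Rmax_l _ _). apply Rabs_pos. }
  assert (S0 := sqrt_pos 2). nra.
Qed.

Lemma Clim_cauchy (f : T -> C) :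
  (forall eps, 0 < eps -> exists P, F P /\ forall u v, P u -> P v -> Cmod (f u - f v) < eps) ->
  exists l, Clim F f l.
Proof.
  intros H.
  destruct (proj1 (filterlim_locally_cauchy (U := C_R_CompleteNormedModule) (F := F) f)) as [l Hl].
  - intros [eps He]. destruct (H eps He) as [P [HP HPP]]. exists P. split; [exact HP|].
    intros u v Hu Hv. specialize (HPP v u Hv Hu).
    assert (E := Rmax_Cmod (f v - f u)%C).
    split; simpl; unfold ball; simpl; unfold AbsRing_ball, abs, minus, plus, opp; simpl;
    (apply Rle_lt_trans with (2 := HPP)); apply Rle_trans with (2 := E); [apply Rmax_l|apply Rmax_r].
  - exists l. now apply filterlim_Clim.
Qed.

End Limits.

Lemma Clim_comp {T U} (F : (T -> Prop) -> Prop) (G : (U -> Prop) -> Prop)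
  (h : T -> U) (f : U -> C) (l : C) :
  filterlim h F G -> Clim G f l -> Clim F (fun x => f (h x)) l.
Proof. intros Hh Hf eps He. apply (Hh _ (Hf eps He)). Qed.

(** * Improper integrals over (0, oo) *)

Notation F0oo := (filter_prod (at_right 0) (Rbar_locally p_infty)).

(** The integrals over the finite intervals are given by a function [I] of the endpoints, so that
    the algebra of [Clim] carries over to improper integrals. *)
Definition is_int_0oo (f : R -> C) (l : C) :=
  exists I : R * R -> C,
    F0oo (fun ab => is_CRInt f (fst ab) (snd ab) (I ab)) /\ Clim F0oo I l.

Lemma F0oo_lt (e B : R) : 0 < e -> F0oo (fun ab => 0 < fst ab < e /\ B < snd ab).
Proof.
  intros He. exists (fun a => 0 < a < e) (fun b => B < b).
  - exists (mkposreal e He). intros y Hy Hy0. split; [exact Hy0|].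
    apply ball_Rabs in Hy; simpl in Hy.
    apply Rabs_def2 in Hy. lra.
  - exists B. auto.
  - simpl. auto.
Qed.

Lemma is_int_0oo_gen (f : R -> C) (l : C) :
  is_int_0oo f l -> RInt_gen (V := C_R_CompleteNormedModule) f (at_right 0) (Rbar_locally p_infty) = l.
Proof.
  intros [I [H1 H2]].
  apply (is_RInt_gen_unique (V := C_R_CompleteNormedModule)).
  apply Clim_filterlim in H2.
  intros P HP. specialize (H2 P HP).
  unfold filtermapi. apply filter_imp2 with (2 := H1) (3 := H2).
  intros ab A B. exists (I ab). split; assumption.
Qed.

Lemma is_int_0oo_ext (f g : R -> C) (l : C) :
  (forall t, 0 < t -> f t = g t) -> is_int_0oo f l -> is_int_0oo g l.
Proof.
  intros E [I [H1 H2]]. exists I. split; [|exact H2].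
  apply filter_imp2 with (2 := H1) (3 := F0oo_lt 1 1 Rlt_0_1).
  intros [a b] A B; simpl in *. revert A. apply is_RInt_ext.
  intros t Ht. apply E. rewrite Rmin_left in Ht; lra.
Qed.

Lemma is_int_0oo_mult (c : C) (f : R -> C) (l : C) :
  is_int_0oo f l -> is_int_0oo (fun t => c * f t)%C (c * l).
Proof.
  intros [I [H1 H2]]. exists (fun ab => c * I ab)%C. split.
  - revert H1. apply filter_imp. intros ab. apply is_CRInt_mult.
  - now apply Clim_scal.
Qed.

Lemma is_int_0oo_minus (f g : R -> C) (l m : C) :
  is_int_0oo f l -> is_int_0oo g m -> is_int_0oo (fun t => f t - g t)%C (l - m).
Proof.
  intros [I [H1 H2]] [J [H3 H4]]. exists (fun ab => I ab - J ab)%C. split.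
  - apply filter_imp2 with (2 := H1) (3 := H3). intros ab A B. now apply is_CRInt_minus.
  - now apply Clim_minus.
Qed.

Lemma filterlim_atan_p : filterlim atan (Rbar_locally p_infty) (locally (PI / 2)).
Proof.
  apply (is_lim_ext_loc (fun x => PI / 2 - atan (/ x)) atan p_infty (PI / 2)).
  - exists 0. intros x Hx. rewrite atan_inv by exact Hx. ring.
  - replace (Finite (PI / 2)) with (Finite (PI / 2 - atan 0)) by (rewrite atan_0; f_equal; ring).
    apply (is_lim_minus' (fun _ => PI / 2) (fun x => atan (/ x)) p_infty (PI / 2) (atan 0)).
    + apply is_lim_const.
    + apply (is_lim_comp atan (fun x => / x) p_infty (atan 0) 0).
      * apply is_lim_continuity, derivable_continuous_pt, derivable_pt_atan.
      * apply (is_lim_inv (fun x => x) p_infty p_infty); [apply is_lim_id|discriminate].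
      * exists 0. intros x Hx H. assert (P := Rinv_0_lt_compat x Hx). injection H. lra.
Qed.

(* Up to a constant, the derivative of [atan (t ^ eta)]: a majorant decaying like a small power
   of [t] at both ends, with a bounded explicit primitive. *)
Definition dom (eta t : R) : R := / (t * (exp (eta * ln t) + exp (- (eta * ln t)))).
Definition Dom (eta t : R) : R := / eta * atan (exp (eta * ln t)).

Lemma is_derive_Dom (eta t : R) : 0 < eta -> 0 < t -> is_derive (Dom eta) t (dom eta t).
Proof.
  intros He Ht. unfold Dom, dom. auto_derive. { exact Ht. }
  rewrite exp_Ropp. assert (P := exp_pos (eta * ln t)). field. repeat split; nra.
Qed.

Lemma continuous_dom (eta t : R) : 0 < t -> continuous (dom eta) t.
Proof.
  intros Ht. apply (ex_derive_continuous (V := R_NormedModule)). unfold dom. auto_derive.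
  repeat split; trivial.
  assert (P := exp_pos (eta * ln t)). assert (P' := exp_pos (- (eta * ln t))).
  apply Rgt_not_eq. nra.
Qed.

Lemma is_RInt_dom (eta a b : R) : 0 < eta -> 0 < a -> a <= b ->
  is_RInt (dom eta) a b (Dom eta b - Dom eta a).
Proof.
  intros He Ha Hab. apply (is_RInt_derive (V := R_CompleteNormedModule) (Dom eta));
  rewrite Rmin_left, Rmax_right by assumption; intros x Hx.
  - apply is_derive_Dom; lra.
  - apply continuous_dom; lra.
Qed.

Lemma Dom_bound (eta t : R) : 0 < eta -> 0 < Dom eta t < PI / 2 / eta.
Proof.
  intros He. unfold Dom. assert (B := atan_bound (exp (eta * ln t))).
  assert (A : 0 < atan (exp (eta * ln t))).
  { rewrite <- atan_0. apply atan_increasing, exp_pos. }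
  assert (0 < / eta) by now apply Rinv_0_lt_compat.
  unfold Rdiv. split; [nra|]. rewrite (Rmult_comm (/ eta)). nra.
Qed.

Lemma CRInt_dom_le (eta M a b : R) (f : R -> C) (l : C) :
  0 < eta -> 0 < a -> a <= b ->
  (forall t, 0 < t -> Cmod (f t) <= M * dom eta t) ->
  is_CRInt f a b l -> Cmod l <= M * (Dom eta b - Dom eta a).
Proof.
  intros He Ha Hab Hf HI.
  apply (Cmod_is_CRInt_le f (fun t => M * dom eta t) a b l _ Hab).
  - intros x Hx. apply Hf. lra.
  - exact HI.
  - apply (is_RInt_scal (V := R_NormedModule)). now apply is_RInt_dom.
Qed.

Lemma dom_pos (eta t : R) : 0 < t -> 0 < dom eta t.
Proof.
  intros Ht. unfold dom. apply Rinv_0_lt_compat, Rmult_lt_0_compat; [exact Ht|].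
  apply Rplus_lt_0_compat; apply exp_pos.
Qed.

(** The factor [PI / 2 / eta] is the total mass of [dom eta] on (0, oo), namely the increment of its
    primitive [Dom eta]. *)
Lemma is_int_0oo_bound (eta M : R) (f : R -> C) (l : C) :
  0 < eta -> (forall t, 0 < t -> Cmod (f t) <= M * dom eta t) ->
  is_int_0oo f l -> Cmod l <= M * (PI / 2 / eta).
Proof.
  intros He Hf [I [H1 H2]].
  assert (HM : 0 <= M).
  { assert (H := Hf 1 Rlt_0_1). assert (P := dom_pos eta 1 Rlt_0_1).
    assert (Q := Cmod_ge_0 (f 1)). nra. }
  apply (Cmod_Clim_le (F := F0oo) I); [|exact H2].
  apply filter_imp2 with (2 := H1) (3 := F0oo_lt 1 1 Rlt_0_1).
  intros [a b] A B; simpl in *.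
  apply Rle_trans with (1 := CRInt_dom_le eta M a b f _ He ltac:(lra) ltac:(lra) Hf A).
  assert (Ba := Dom_bound eta a He). assert (Bb := Dom_bound eta b He).
  apply Rmult_le_compat_l; lra.
Qed.

Lemma CRInt_dom_Rabs (eta M a b : R) (f : R -> C) :
  0 < eta -> 0 < a -> 0 < b ->
  (forall t, 0 < t -> continuous f t) ->
  (forall t, 0 < t -> Cmod (f t) <= M * dom eta t) ->
  Cmod (CRInt f a b) <= M * Rabs (Dom eta b - Dom eta a).
Proof.
  intros He Ha Hb Hc Hf.
  assert (HM : 0 <= M).
  { assert (H := Hf 1 Rlt_0_1). assert (P := dom_pos eta 1 Rlt_0_1).
    assert (Q := Cmod_ge_0 (f 1)). nra. }
  assert (W : forall a b, 0 < a -> a <= b -> Cmod (CRInt f a b) <= M * Rabs (Dom eta b - Dom eta a)).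
  { clear a b Ha Hb. intros a b Ha Hab.
    apply Rle_trans with (M * (Dom eta b - Dom eta a)).
    - apply (CRInt_dom_le eta M a b f); try assumption.
      apply is_CRInt_CRInt, ex_CRInt_continuous; [exact Hab|]. intros x Hx; apply Hc; lra.
    - apply Rmult_le_compat_l; [exact HM|apply Rle_abs]. }
  destruct (Rle_dec a b) as [H|H]; [now apply W|].
  rewrite <- (opp_RInt_swap (V := C_R_CompleteNormedModule)).
  - change (Cmod (- CRInt f b a) <= M * Rabs (Dom eta b - Dom eta a)).
    rewrite Cmod_opp, Rabs_minus_sym. apply W; lra.
  - apply ex_CRInt_continuous; [lra|]. intros x Hx; apply Hc; lra.
Qed.

(** Cauchy's criterion: moving an endpoint changes the integral by at most [M] times the change of
    [Dom eta], which has finite limits at 0 and at infinity. *)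
Lemma ex_int_0oo (eta M : R) (f : R -> C) :
  0 < eta -> (forall t, 0 < t -> continuous f t) ->
  (forall t, 0 < t -> Cmod (f t) <= M * dom eta t) ->
  exists l, is_int_0oo f l.
Proof.
  intros He Hc Hf.
  assert (HM : 0 <= M).
  { assert (H := Hf 1 Rlt_0_1). assert (P := dom_pos eta 1 Rlt_0_1).
    assert (Q := Cmod_ge_0 (f 1)). nra. }
  assert (Hex : forall a b, 0 < a -> 0 < b -> ex_CRInt f a b).
  { intros a b Ha Hb. apply (ex_RInt_continuous (V := C_R_CompleteNormedModule)).
    intros t Ht. apply Hc. apply Rlt_le_trans with (2 := proj1 Ht). now apply Rmin_pos. }
  destruct (Clim_cauchy (F := F0oo) (fun ab => CRInt f (fst ab) (snd ab))) as [l Hl].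
  - intros eps Heps.
    assert (L0 : filterlim (Dom eta) (at_right 0) (locally (/ eta * atan 0))).
    {
      apply (filterlim_comp _ _ _ ln (fun u => / eta * atan (exp (eta * u))) (at_right 0) (Rbar_locally m_infty)).
      - exact is_lim_ln_0.
      - apply (is_lim_scal_l (fun u => atan (exp (eta * u))) (/ eta) m_infty (atan 0)).
        apply (is_lim_comp atan (fun u => exp (eta * u)) m_infty (atan 0) 0).
        + apply is_lim_continuity, derivable_continuous_pt, derivable_pt_atan.
        + apply (is_lim_comp exp (fun u => eta * u) m_infty 0 m_infty).
          * exact is_lim_exp_m.
          * replace m_infty with (Rbar_mult eta m_infty) at 2.
            { apply is_lim_scal_l, is_lim_id. }
            apply is_Rbar_mult_unique. apply is_Rbar_mult_sym. now apply is_Rbar_mult_m_infty_pos.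
          * now exists 0.
        + exists 0. intros u _ H. generalize (exp_pos (eta * u)). injection H. lra. }
    rewrite atan_0, Rmult_0_r in L0.
    assert (L1 : filterlim (Dom eta) (Rbar_locally p_infty) (locally (/ eta * (PI / 2)))).
    { apply (filterlim_comp _ _ _ ln (fun u => / eta * atan (exp (eta * u))) (Rbar_locally p_infty) (Rbar_locally p_infty)).
      - exact is_lim_ln_p.
      - apply (is_lim_scal_l (fun u => atan (exp (eta * u))) (/ eta) p_infty (PI / 2)).
        apply (filterlim_comp _ _ _ (fun u => exp (eta * u)) atan (Rbar_locally p_infty) (Rbar_locally p_infty)).
        2: exact filterlim_atan_p.
        apply (is_lim_comp exp (fun u => eta * u) p_infty p_infty p_infty).
          * exact is_lim_exp_p.
          * replace p_infty with (Rbar_mult eta p_infty) at 2.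
            { apply is_lim_scal_l, is_lim_id. }
            apply is_Rbar_mult_unique. apply is_Rbar_mult_sym. now apply is_Rbar_mult_p_infty_pos.
          * now exists 0. }
    (* Each of the two endpoints moves [Dom eta] by at most [2 * d], hence the integral by at most
       [4 * M * d] in all; [M + 1] replaces [M] because [M] may be 0. *)
    assert (Hd : 0 < eps / (4 * (M + 1))). { apply Rdiv_lt_0_compat; lra. }
    set (d := eps / (4 * (M + 1))) in *.
    assert (Ed : 4 * (M + 1) * d = eps) by (unfold d; field; lra).
    assert (H0 := proj1 (filterlim_locally _ _) L0 (mkposreal d Hd)).
    assert (H1 := proj1 (filterlim_locally _ _) L1 (mkposreal d Hd)).
    exists (fun ab => (0 < fst ab < 1 /\ 1 < snd ab) /\
       Rabs (Dom eta (fst ab) - 0) < d /\ Rabs (Dom eta (snd ab) - / eta * (PI / 2)) < d).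
    split.
    + apply filter_and; [apply F0oo_lt; lra|].
      exists (fun a => Rabs (Dom eta a - 0) < d) (fun b => Rabs (Dom eta b - / eta * (PI / 2)) < d);
      [exact H0|exact H1|]. simpl. auto.
    + intros [a b] [a' b']; simpl. intros [[A1 A2] [A3 A4]] [[B1 B2] [B3 B4]].
      replace (CRInt f a b - CRInt f a' b')%C with (CRInt f a a' + CRInt f b' b)%C.
      2: { assert (C1 := RInt_Chasles (V := C_R_CompleteNormedModule) f a a' b' (Hex a a' ltac:(lra) ltac:(lra)) (Hex a' b' ltac:(lra) ltac:(lra))).
           assert (C2 := RInt_Chasles (V := C_R_CompleteNormedModule) f a b' b (Hex a b' ltac:(lra) ltac:(lra)) (Hex b' b ltac:(lra) ltac:(lra))).
           rewrite <- C2, <- C1. unfold plus; simpl.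
           change (CRInt f a a' + CRInt f b' b = (CRInt f a a' + CRInt f a' b' + CRInt f b' b - CRInt f a' b'))%C. ring. }
      apply Rle_lt_trans with (1 := Cmod_triangle _ _).
      assert (E1 := CRInt_dom_Rabs eta M a a' f He ltac:(lra) ltac:(lra) Hc Hf).
      assert (E2 := CRInt_dom_Rabs eta M b' b f He ltac:(lra) ltac:(lra) Hc Hf).
      assert (E3 : Rabs (Dom eta a' - Dom eta a) <= 2 * d). { revert A3 B3. unfold Rabs.
      repeat destruct Rcase_abs; lra. }
      assert (E4 : Rabs (Dom eta b - Dom eta b') <= 2 * d). { revert A4 B4. unfold Rabs.
      repeat destruct Rcase_abs; lra. }
      nra.
  - exists l. exists (fun ab => CRInt f (fst ab) (snd ab)). split; [|exact Hl].
    generalize (F0oo_lt 1 1 Rlt_0_1). apply filter_imp. intros [a b] H; simpl in *.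
    apply is_CRInt_CRInt, Hex; lra.
Qed.

(** * The derivative of Gamma *)

Definition Cpw (w : C) (t : R) : C := Cexp (w * RtoC (ln t)).

Lemma Cmod_Cpw (w : C) (t : R) : Cmod (Cpw w t) = exp (Re w * ln t).
Proof. unfold Cpw. rewrite Cmod_Cexp. f_equal. unfold Re, Cmult, RtoC; simpl; ring. Qed.

Lemma Cpw_plus (v w : C) (t : R) : Cpw (v + w) t = (Cpw v t * Cpw w t)%C.
Proof. unfold Cpw. rewrite Cmult_plus_distr_r. apply Cexp_plus. Qed.

Lemma Cpw_1 (t : R) : 0 < t -> Cpw 1 t = RtoC t.
Proof. intros Ht. unfold Cpw. rewrite Cmult_1_l, Cexp_RtoC, exp_ln by exact Ht. reflexivity. Qed.

Lemma Cpw_minus_1 (w : C) (t : R) : 0 < t -> Cpw (w - 1) t = (Cpw w t / RtoC t)%C.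
Proof.
  intros Ht. replace (Cpw w t) with (Cpw (w - 1) t * RtoC t)%C.
  - field. intro E; apply RtoC_inj in E; lra.
  - rewrite <- (Cpw_1 t) by exact Ht. rewrite <- Cpw_plus. f_equal. ring.
Qed.

Lemma continuous_ln (t : R) : 0 < t -> continuous ln t.
Proof. intros Ht. apply (ex_derive_continuous (V := R_NormedModule)). auto_derive. exact Ht. Qed.

Lemma continuous_Cpw (w : C) (t : R) : 0 < t -> continuous (Cpw w) t.
Proof.
  intros Ht. apply continuous_Cexp, continuous_Cmult; [apply continuous_Cconst|].
  apply continuous_RtoC, continuous_ln, Ht.
Qed.

Lemma is_derive_Cpw (w : C) (t : R) : 0 < t ->
  is_derive_RC (Cpw w) t (w * Cpw (w - 1) t)%C.
Proof.
  intros Ht. rewrite Cpw_minus_1 by exact Ht. destruct w as [x y].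
  apply is_derive_C; unfold Cpw, Cexp, Cdiv, Cinv, Cmult, RtoC, Re, Im; simpl;
  (auto_derive; [now repeat split|]); unfold Rminus; field; nra.
Qed.

Lemma mul_ln_le (p t : R) : 0 < p -> 0 < t -> p * ln t - t <= p * ln p - p.
Proof.
  intros Hp Ht. assert (H := exp_ineq1_le (ln (t / p))).
  assert (Htp : 0 < t / p) by now apply Rdiv_lt_0_compat.
  rewrite exp_ln, ln_div in H by assumption.
  assert (E : t = p * (t / p)) by (field; lra). nra.
Qed.

Lemma one_sq_le_exp (s : R) : 0 <= s -> 1 + s ^ 2 / 4 <= exp s.
Proof.
  intros Hs. assert (H := exp_ineq1_le (s / 2)).
  replace s with (s / 2 + s / 2) at 2 by field. rewrite exp_plus. nra.
Qed.

(* A common majorant of all the integrands of this section; the exponent [x / 4] leaves room for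
   an increment of [w] of modulus at most [x / 4]. *)
Definition gdom (x t : R) : R :=
  (1 + t ^ 2) * (1 + ln t ^ 2) * exp (x / 4 * Rabs (ln t)) * exp ((x - 1) * ln t) * exp (- t).

(** Put [eta = x / 4]. The logarithmic weight, the factor [exp (x / 4 * Rabs (ln t))] and the
    denominator of [dom] each cost a factor of order [exp (eta * Rabs (ln t))]. Near 0 this leaves
    the power [t ^ (x - 3 * eta)], which is bounded; at infinity [exp (- t)] beats [t ^ p] with
    [p = x + 3 * eta + 2], whose product with it is maximal at [t = p]. *)
Lemma gdom_dom (x : R) : 0 < x ->
  exists M eta, 0 <= M /\ 0 < eta /\ forall t, 0 < t -> gdom x t <= M * dom eta t.
Proof.
  intros Hx. set (eta := x / 4). set (p := x + 3 * eta + 2). set (K := 1 + 4 / eta ^ 2).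
  assert (He : 0 < eta) by (unfold eta; lra).
  assert (He2 : 0 < / eta ^ 2) by (apply Rinv_0_lt_compat; nra).
  assert (HK : 1 <= K) by (unfold K, Rdiv; lra).
  set (E := exp (p * ln p)). assert (HE : 0 < E) by apply exp_pos.
  exists (4 * K * (1 + E)), eta. split; [nra|]. split; [exact He|].
  intros t Ht. unfold gdom, dom. fold eta.
  apply Rmult_le_reg_r with (t * (exp (eta * ln t) + exp (- (eta * ln t)))).
  { apply Rmult_lt_0_compat; [exact Ht|]. apply Rplus_lt_0_compat; apply exp_pos. }
  rewrite Rmult_assoc with (r1 := 4 * K * (1 + E)), Rinv_l, Rmult_1_r.
  2: { apply Rgt_not_eq, Rmult_lt_0_compat; [exact Ht|]. apply Rplus_lt_0_compat; apply exp_pos. }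
  set (u := ln t). assert (Eu : t = exp u) by (unfold u; now rewrite exp_ln).
  set (A := exp (eta * Rabs u)).
  assert (HA : 1 <= A).
  { rewrite <- exp_0. apply exp_le_compat. generalize (Rabs_pos u); nra. }
  assert (H1 : 1 + u ^ 2 <= K * A).
  { assert (H := one_sq_le_exp (eta * Rabs u) ltac:(generalize (Rabs_pos u); nra)). fold A in H.
    replace ((eta * Rabs u) ^ 2) with (eta ^ 2 * u ^ 2) in H.
    2: { rewrite Rpow_mult_distr, pow2_abs; ring. }
    unfold K. replace (u ^ 2) with (4 / eta ^ 2 * (eta ^ 2 * u ^ 2 / 4)) by (field; lra).
    assert (H2 : 0 <= 4 / eta ^ 2) by (unfold Rdiv; lra). nra. }
  assert (H2 : exp (eta * u) + exp (- (eta * u)) <= 2 * A).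
  { assert (exp (eta * u) <= A). { apply exp_le_compat. generalize (Rle_abs u); nra. }
    assert (exp (- (eta * u)) <= A). { apply exp_le_compat.
    generalize (Rle_abs (- u)); rewrite Rabs_Ropp; nra. }
    lra. }
  assert (H3 : (1 + t ^ 2) * (A * A * A * (exp ((x - 1) * u) * t) * exp (- t)) <= 2 * (1 + E)).
  { replace (exp ((x - 1) * u) * t) with (exp (x * u)).
    2: { rewrite Eu at 1. rewrite <- exp_plus. f_equal; ring. }
    unfold A. rewrite <- !exp_plus.
    assert (E0 : 0 <= 1 + E) by lra.
    destruct (Rle_dec u 0) as [Hu|Hu].
    - assert (T1 : t <= 1) by (rewrite Eu, <- exp_0; now apply exp_le_compat).
      assert (T2 : exp (eta * Rabs u + eta * Rabs u + eta * Rabs u + x * u + - t) <= 1).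
      { rewrite <- exp_0. apply exp_le_compat. rewrite Rabs_left1 by exact Hu. unfold eta. nra. }
      assert (T3 := exp_pos (eta * Rabs u + eta * Rabs u + eta * Rabs u + x * u + - t)). nra.
    - assert (T1 : 1 <= t) by (rewrite Eu, <- exp_0; apply exp_le_compat; lra).
      apply Rle_trans with (2 * t ^ 2 * exp (eta * Rabs u + eta * Rabs u + eta * Rabs u + x * u + - t)).
      + apply Rmult_le_compat_r; [left; apply exp_pos|nra].
      + replace (t ^ 2) with (exp (2 * u)) by (rewrite Eu at 1; simpl; rewrite Rmult_1_r, <- exp_plus; f_equal; ring).
        rewrite Rmult_assoc, <- exp_plus. rewrite Rabs_pos_eq by lra.
        apply Rmult_le_compat_l; [lra|]. apply Rle_trans with E; [|lra].
        apply exp_le_compat. assert (Hp : 0 < p) by (unfold p; lra).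
        assert (H := mul_ln_le p t Hp Ht). fold u in H. unfold p in H at 1. lra. }
  set (B := exp ((x - 1) * u) * t * exp (- t)).
  assert (HB : 0 < B) by (unfold B; repeat apply Rmult_lt_0_compat; try exact Ht; apply exp_pos).
  apply Rle_trans with ((1 + t ^ 2) * (K * A) * A * B * (2 * A)).
  - replace ((1 + t ^ 2) * (1 + u ^ 2) * A * exp ((x - 1) * u) * exp (- t) * (t * (exp (eta * u) + exp (- (eta * u)))))
    with ((1 + u ^ 2) * ((1 + t ^ 2) * A * B) * (exp (eta * u) + exp (- (eta * u)))) by (unfold B; ring).
    replace ((1 + t ^ 2) * (K * A) * A * B * (2 * A)) with ((K * A) * ((1 + t ^ 2) * A * B) * (2 * A)) by ring.
    assert (HT : 0 <= (1 + t ^ 2) * A * B) by (apply Rmult_le_pos; [apply Rmult_le_pos; nra|lra]).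
    apply Rmult_le_compat; [|left; apply Rplus_lt_0_compat; apply exp_pos| |exact H2].
    + apply Rmult_le_pos; [nra|exact HT].
    + apply Rmult_le_compat_r; assumption.
  - replace ((1 + t ^ 2) * (K * A) * A * B * (2 * A))
    with (2 * K * ((1 + t ^ 2) * (A * A * A * (exp ((x - 1) * u) * t) * exp (- t)))) by (unfold B; ring).
    replace (4 * K * (1 + E)) with (2 * K * (2 * (1 + E))) by ring.
    apply Rmult_le_compat_l; [lra|exact H3].
Qed.

Lemma gdom_ge (x t g : R) : 0 < t -> g <= (1 + t ^ 2) * (1 + ln t ^ 2) * exp (x / 4 * Rabs (ln t)) ->
  g * (exp ((x - 1) * ln t) * exp (- t)) <= gdom x t.
Proof.
  intros Ht Hg. unfold gdom. rewrite <- !Rmult_assoc.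
  apply Rmult_le_compat_r; [left; apply exp_pos|]. apply Rmult_le_compat_r; [left; apply exp_pos|]. exact Hg.
Qed.

(** In this order, the weights belong to the integrand of Gamma, to that of its derivative, to the
    errors of Euler's truncated integrals without and with [ln t], and to the second-order remainder
    in the increment of [w]. *)
Lemma gdom_weights (x t : R) : 0 < x -> 0 < t ->
  let W := (1 + t ^ 2) * (1 + ln t ^ 2) * exp (x / 4 * Rabs (ln t)) in
  1 <= W /\ Rabs (ln t) <= W /\ t ^ 2 <= W /\ t ^ 2 * Rabs (ln t) <= W /\
  ln t ^ 2 * exp (x / 4 * Rabs (ln t)) <= W.
Proof.
  intros Hx Ht W.
  assert (HE : 1 <= exp (x / 4 * Rabs (ln t))).
  { rewrite <- exp_0. apply exp_le_compat. generalize (Rabs_pos (ln t)); nra. }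
  assert (HL : Rabs (ln t) <= 1 + ln t ^ 2).
  { rewrite <- (pow2_abs (ln t)). generalize (Rabs_pos (ln t)); nra. }
  assert (HLp := Rabs_pos (ln t)).
  set (E := exp _) in *. set (a := 1 + t ^ 2) in *. assert (Ha : 1 <= a /\ t ^ 2 <= a) by (unfold a; nra).
  assert (Hb : 1 <= 1 + ln t ^ 2 /\ ln t ^ 2 <= 1 + ln t ^ 2) by nra.
  set (b := 1 + ln t ^ 2) in *. unfold W.
  assert (Hab : a * b <= a * b * E) by (rewrite <- (Rmult_1_r (a * b)) at 1; apply Rmult_le_compat_l; nra).
  assert (0 <= t ^ 2) by nra. assert (0 <= ln t ^ 2) by nra.
  repeat split.
  - nra.
  - apply Rle_trans with (2 := Hab). nra.
  - apply Rle_trans with (2 := Hab). nra.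
  - apply Rle_trans with (2 := Hab). apply Rmult_le_compat; lra.
  - apply Rmult_le_compat_r; [lra|]. nra.
Qed.

Definition Gint (w : C) (t : R) : C := (Cpw (w - 1) t * RtoC (exp (- t)))%C.

Lemma CGamma_Gint (w : C) : CGamma w = RInt_gen (V := C_R_CompleteNormedModule) (Gint w) (at_right 0) (Rbar_locally p_infty).
Proof. reflexivity. Qed.

Lemma Cmod_Gint (w : C) (t : R) : Cmod (Gint w t) = exp ((Re w - 1) * ln t) * exp (- t).
Proof.
  unfold Gint. rewrite Cmod_mult, Cmod_Cpw, Cmod_R, Rabs_pos_eq by (left; apply exp_pos).
  reflexivity.
Qed.

Lemma continuous_Gint (w : C) (t : R) : 0 < t -> continuous (Gint w) t.
Proof.
  intros Ht. apply continuous_Cmult; [now apply continuous_Cpw|].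
  apply continuous_RtoC. apply (ex_derive_continuous (V := R_NormedModule)). now auto_derive.
Qed.

Lemma is_int_0oo_CGamma (w : C) : 0 < Re w -> is_int_0oo (Gint w) (CGamma w).
Proof.
  intros Hw. destruct (gdom_dom (Re w) Hw) as [M [eta [HM [He Hd]]]].
  destruct (ex_int_0oo eta M (Gint w)) as [l Hl]; [exact He|intros; now apply continuous_Gint| |].
  - intros t Ht. apply Rle_trans with (2 := Hd t Ht). rewrite Cmod_Gint.
    rewrite <- (Rmult_1_l (_ * _)). apply gdom_ge; [exact Ht|]. now apply gdom_weights.
  - assert (E := is_int_0oo_gen _ _ Hl). rewrite CGamma_Gint, E. exact Hl.
Qed.

Lemma ex_int_0oo_CGamma' (w : C) : 0 < Re w -> exists l, is_int_0oo (fun t => Gint w t * RtoC (ln t))%C l.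
Proof.
  intros Hw. destruct (gdom_dom (Re w) Hw) as [M [eta [HM [He Hd]]]].
  apply (ex_int_0oo eta M); [exact He| |].
  - intros t Ht. apply continuous_Cmult; [now apply continuous_Gint|].
    now apply continuous_RtoC, continuous_ln.
  - intros t Ht. apply Rle_trans with (2 := Hd t Ht). rewrite Cmod_mult, Cmod_Gint, Rmult_comm, Cmod_R.
    apply gdom_ge; [exact Ht|]. now apply gdom_weights.
Qed.

(** Under the integral sign the increment is the integrand times [Cexp d - 1 - d] with
    [d = h * ln t]; by [Cexp_taylor_1] this is quadratic in [h], and [Cmod h <= Re w / 4] keeps
    [exp (Cmod d)] below the weight reserved in [gdom]. *)
Lemma CGamma_increment (w l : C) : 0 < Re w -> is_int_0oo (fun t => Gint w t * RtoC (ln t))%C l ->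
  exists K, 0 <= K /\ forall h, Cmod h <= Re w / 4 ->
    Cmod (CGamma (w + h) - CGamma w - h * l) <= K * Cmod h ^ 2.
Proof.
  intros Hw Hl. destruct (gdom_dom (Re w) Hw) as [M [eta [HM [He Hd]]]].
  exists (M * (PI / 2 / eta)). split.
  { apply Rmult_le_pos; [exact HM|]. apply Rlt_le, Rdiv_lt_0_compat; [apply PI2_RGT_0|exact He]. }
  intros h Hh.
  assert (Hwh : 0 < Re (w + h)).
  { assert (A := Re_le_Cmod (- h)%C). rewrite Cmod_opp in A.
    replace (Re (- h)%C) with (- Re h) in A by reflexivity.
    replace (Re (w + h)%C) with (Re w + Re h) by reflexivity. lra. }
  replace (M * (PI / 2 / eta) * Cmod h ^ 2) with (Cmod h ^ 2 * M * (PI / 2 / eta)) by ring.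
  refine (is_int_0oo_bound eta _ _ _ He _ (is_int_0oo_minus _ _ _ _ (is_int_0oo_minus _ _ _ _ (is_int_0oo_CGamma _ Hwh) (is_int_0oo_CGamma _ Hw)) (is_int_0oo_mult h _ _ Hl))).
  intros t Ht. rewrite Rmult_assoc.
  apply Rle_trans with (Cmod h ^ 2 * gdom (Re w) t).
  2: { apply Rmult_le_compat_l; [apply pow_le, Cmod_ge_0|now apply Hd]. }
  replace (Gint (w + h) t - Gint w t - h * (Gint w t * RtoC (ln t)))%C
  with ((Cexp (h * RtoC (ln t)) - 1 - h * RtoC (ln t)) * Gint w t)%C.
  2: { unfold Gint. replace (w + h - 1)%C with ((w - 1) + h)%C by ring. rewrite Cpw_plus.
       unfold Cpw. ring. }
  rewrite Cmod_mult, Cmod_Gint.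
  apply Rle_trans with (Cmod h ^ 2 * (ln t ^ 2 * exp (Re w / 4 * Rabs (ln t))) * (exp ((Re w - 1) * ln t) * exp (- t))).
  - apply Rmult_le_compat_r. { left; apply Rmult_lt_0_compat; apply exp_pos. }
    apply Rle_trans with (1 := Cexp_taylor_1 _). rewrite Cmod_mult, Cmod_R.
    rewrite Rpow_mult_distr, pow2_abs, Rmult_assoc.
    apply Rmult_le_compat_l; [apply pow_le, Cmod_ge_0|].
    apply Rmult_le_compat_l; [nra|]. apply exp_le_compat.
    apply Rmult_le_compat_r; [apply Rabs_pos|exact Hh].
  - rewrite Rmult_assoc. apply Rmult_le_compat_l; [apply pow_le, Cmod_ge_0|].
    apply gdom_ge; [exact Ht|]. now apply gdom_weights.
Qed.

Lemma is_derive_CGamma (w l : C) : 0 < Re w -> is_int_0oo (fun t => Gint w t * RtoC (ln t))%C l ->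
  is_derive (K := C_AbsRing) (V := C_NormedModule) CGamma w l.
Proof.
  intros Hw Hl. destruct (CGamma_increment w l Hw Hl) as [K [HK H]].
  split. { apply is_linear_scal_l. }
  intros x Hx. apply (is_filter_lim_locally_unique (K := C_AbsRing) (V := AbsRing_NormedModule C_AbsRing)) in Hx. rewrite <- Hx. clear x Hx.
  intros [eps Heps].
  assert (Hd : 0 < Rmin (Re w / 4) (eps / (K + 1))).
  { apply Rmin_pos; [lra|]. apply Rdiv_lt_0_compat; lra. }
  exists (mkposreal _ Hd). intros v Hv.
  change (Cmod (v - w) < Rmin (Re w / 4) (eps / (K + 1))) in Hv.
  change (Cmod (CGamma v - CGamma w - (v - w) * l) <= eps * Cmod (v - w)).
  assert (A := Rlt_le_trans _ _ _ Hv (Rmin_l _ _)).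
  assert (B := Rlt_le_trans _ _ _ Hv (Rmin_r _ _)).
  assert (D := H (v - w)%C (Rlt_le _ _ A)).
  replace (w + (v - w))%C with (v : C) in D by (unfold Cminus; rewrite (Cplus_comm v), Cplus_assoc, Cplus_opp_r, Cplus_0_l; reflexivity).
  apply Rle_trans with (1 := D). assert (P := Cmod_ge_0 (v - w)).
  replace (K * Cmod (v - w) ^ 2) with (K * Cmod (v - w) * Cmod (v - w)) by ring.
  apply Rmult_le_compat_r; [exact P|].
  apply Rle_trans with ((K + 1) * (eps / (K + 1))). { apply Rmult_le_compat; lra. }
  right. field. lra.
Qed.

Lemma Cderive_unique (f : C -> C) (w l : C) :
  is_derive (K := C_AbsRing) (V := C_NormedModule) f w l -> Cderive f w = l.
Proof.
  intros H. unfold Cderive.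
  assert (E := epsilon_spec (inhabits (RtoC 0)) (fun l => is_derive (K := C_AbsRing) (V := C_NormedModule) f w l) (ex_intro _ l H)).
  apply is_C_derive_unique in H. apply is_C_derive_unique in E. now rewrite <- H, <- E.
Qed.

(** * Euler's limit for the digamma function *)

(* The cut-off turns Euler's integrals over [(0, a)] into integrals over [(0, oo)]. *)
Definition trunc (k : nat) (a t : R) : R := if Rlt_dec t a then (1 - t / a) ^ k else 0.

Lemma trunc_S (k : nat) (a t : R) : trunc (S k) a t = trunc k a t - t / a * trunc k a t.
Proof. unfold trunc. destruct Rlt_dec; simpl; ring. Qed.

Lemma bernoulli (n : nat) (x : R) : 0 <= x <= 1 -> 1 - INR n * x <= (1 - x) ^ n.
Proof.
  intros Hx. induction n as [|n IH]; [simpl; lra|].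
  rewrite S_INR. simpl.
  assert (0 <= INR n) by apply pos_INR.
  assert (0 <= (1 - x) ^ n) by (apply pow_le; lra).
  destruct (Rle_dec 0 (1 - INR n * x)); nra.
Qed.

Lemma exp_pow (x : R) (n : nat) : exp x ^ n = exp (INR n * x).
Proof.
  induction n as [|n IH]; [simpl; now rewrite Rmult_0_l, exp_0|].
  rewrite S_INR, Rmult_plus_distr_r, exp_plus, <- IH, Rmult_1_l. simpl; ring.
Qed.

(** Let [s = t / n < 1]. The lower bound is [1 - s <= exp (- s)] raised to the power [n]. For the
    upper one, [1 + s <= exp s] and Bernoulli give [(1 - s) ^ n * exp t >= (1 - s ^ 2) ^ n >= 1 - n
    * s ^ 2], and [n * s ^ 2 = t ^ 2 / n]. For [t >= n] the cut-off is 0 and [t ^ 2 / n >= 1]. *)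
Lemma trunc_exp (n : nat) (t : R) : (0 < n)%nat -> 0 <= t ->
  0 <= exp (- t) - trunc n (INR n) t <= t ^ 2 * exp (- t) / INR n.
Proof.
  intros Hn Ht. assert (HN : 0 < INR n) by now apply lt_0_INR.
  assert (H1 : 1 <= INR n) by (apply (le_INR 1); lia).
  assert (P := exp_pos (- t)). unfold trunc. destruct Rlt_dec as [H|H].
  - set (s := t / INR n). assert (Hs : 0 <= s < 1).
    { unfold s. split; [apply Rle_mult_inv_pos; assumption|]. apply Rlt_div_l; lra. }
    assert (Et : t = INR n * s) by (unfold s; field; lra).
    assert (E : exp (- t) = exp (- s) ^ n) by (rewrite exp_pow; f_equal; rewrite Et; ring).
    assert (A := exp_ineq1_le (- s)).
    split.
    + rewrite E. assert (B : (1 - s) ^ n <= exp (- s) ^ n) by (apply pow_incr; lra). lra.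
    + assert (B := exp_ineq1_le s).
      assert (D : 1 - INR n * s ^ 2 <= (1 - s ^ 2) ^ n) by (apply bernoulli; nra).
      assert (F : (1 - s ^ 2) ^ n <= (1 - s) ^ n * exp t).
      { replace (exp t) with (exp s ^ n) by (rewrite exp_pow; f_equal; rewrite Et; ring).
        rewrite <- Rpow_mult_distr. apply pow_incr. split; nra. }
      assert (G : exp t * exp (- t) = 1) by (rewrite <- exp_plus, Rplus_opp_r; apply exp_0).
      replace (t ^ 2 * exp (- t) / INR n) with (INR n * s ^ 2 * exp (- t)) by (rewrite Et at 2; field; lra).
      assert (K : (1 - INR n * s ^ 2) * exp (- t) <= (1 - s) ^ n * exp t * exp (- t)).
      { apply Rmult_le_compat_r; lra. }
      rewrite Rmult_assoc, G in K. lra.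
  - split; [lra|]. apply Rmult_le_reg_r with (INR n); [exact HN|].
    unfold Rdiv. rewrite Rmult_assoc, Rinv_l by lra.
    assert (INR n <= t ^ 2) by nra. nra.
Qed.

(* [n ^ w * euler_prod n w = n! n ^ w / (w (w + 1) ... (w + n))]. *)
Fixpoint euler_prod (k : nat) (w : C) : C :=
  match k with O => (/ w)%C | S j => (euler_prod j w * RtoC (INR (S j)) / (w + RtoC (INR (S j))))%C end.

(** Minus the logarithmic derivative of [euler_prod k]; hence differentiation of
    [a ^ w * euler_prod k w] with respect to [w] brings out the factor
    [ln a - harmonic_shift k w]. *)
Fixpoint harmonic_shift (k : nat) (w : C) : C :=
  match k with O => (/ w)%C | S j => (harmonic_shift j w + / (w + RtoC (INR (S j))))%C end.

Lemma Re_pos_neq_0 (w : C) (x : R) : 0 < Re w -> 0 <= x -> (w + RtoC x)%C <> 0%C.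
Proof.
  intros Hw Hx E. assert (H : Re (w + RtoC x) = 0) by (rewrite E; reflexivity).
  unfold Re, Cplus, RtoC in H; simpl in H. unfold Re in Hw. lra.
Qed.

Lemma Re_pos_neq_0' (w : C) : 0 < Re w -> w <> 0%C.
Proof. intros Hw E. rewrite E in Hw. unfold Re, RtoC in Hw; simpl in Hw. lra. Qed.

Lemma RtoC_INR_S (n : nat) : RtoC (INR (S n)) = (RtoC (INR n) + 1)%C.
Proof. now rewrite S_INR, RtoC_plus. Qed.

Lemma Re_plus_1 (w : C) : 0 < Re w -> 0 < Re (w + 1).
Proof. unfold Re, Cplus, RtoC; simpl. lra. Qed.

Lemma euler_prod_shift (k : nat) (w : C) : 0 < Re w ->
  euler_prod k (w + 1) = (euler_prod k w * w / (w + RtoC (INR (S k))))%C.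
Proof.
  intros Hw. assert (W0 := Re_pos_neq_0' w Hw).
  induction k as [|k IH].
  - simpl. assert (W1 := Re_pos_neq_0 w 1 Hw Rle_0_1). field. now split.
  - cbn [euler_prod]. rewrite IH.
    assert (W1 := Re_pos_neq_0 w _ Hw (pos_INR (S k))).
    assert (W2 := Re_pos_neq_0 w _ Hw (pos_INR (S (S k)))).
    rewrite !RtoC_INR_S in *.
    replace (w + 1 + (RtoC (INR k) + 1))%C with (w + (RtoC (INR k) + 1 + 1))%C by ring.
    field. now split.
Qed.

Lemma harmonic_shift_shift (k : nat) (w : C) : 0 < Re w ->
  harmonic_shift k (w + 1) = (harmonic_shift k w - / w + / (w + RtoC (INR (S k))))%C.
Proof.
  intros Hw. assert (W0 := Re_pos_neq_0' w Hw).
  induction k as [|k IH].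
  - simpl. ring.
  - cbn [harmonic_shift]. rewrite IH.
    replace (w + 1 + RtoC (INR (S k)))%C with (w + RtoC (INR (S (S k))))%C by (rewrite !RtoC_INR_S; ring).
    ring.
Qed.

Lemma filterlim_Rpower_0 (x : R) : 0 < x -> filterlim (fun a => exp (x * ln a)) (at_right 0) (locally 0).
Proof.
  intros Hx.
  apply (filterlim_comp _ _ _ ln (fun u => exp (x * u)) (at_right 0) (Rbar_locally m_infty)).
  - exact is_lim_ln_0.
  - apply (is_lim_comp exp (fun u => x * u) m_infty 0 m_infty).
    + exact is_lim_exp_m.
    + replace m_infty with (Rbar_mult x m_infty) at 2.
      { apply is_lim_scal_l, is_lim_id. }
      apply is_Rbar_mult_unique. apply is_Rbar_mult_sym. now apply is_Rbar_mult_m_infty_pos.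
    + now exists 0.
Qed.

Lemma filterlim_F0oo_fst (f : R -> R) (l : R) : filterlim f (at_right 0) (locally l) ->
  filterlim (fun ab => f (fst ab)) F0oo (locally l).
Proof.
  intros H. apply (filterlim_comp _ _ _ fst f F0oo (at_right 0)); [apply filterlim_fst|exact H].
Qed.

(** As [trunc 0 a] is the indicator of [t < a], the integral is the value at [a] of the primitive
    [g] that vanishes at 0; [r] measures its decay there. *)
Lemma is_int_0oo_trunc_aux (a : R) (f g : R -> C) (l : C) (r : R -> R) : 0 < a ->
  (forall t, 0 < t -> is_derive_RC g t (f t)) ->
  (forall t, 0 < t -> continuous f t) -> g a = l ->
  (forall t, 0 < t < 1 -> Cmod (g t) <= r t) -> filterlim r (at_right 0) (locally 0) ->
  is_int_0oo (fun t => RtoC (trunc 0 a t) * f t)%C l.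
Proof.
  intros Ha Hg Hf El Hr Lr.
  exists (fun ab => l - g (fst ab))%C. split.
  - generalize (F0oo_lt a a Ha). apply filter_imp. intros [e b] [[H1 H2] H3]; simpl in *.
    replace (l - g e)%C with (plus (l - g e)%C (RtoC (b - a) * 0)%C : C_R_NormedModule).
    2: { change ((l - g e) + RtoC (b - a) * 0 = l - g e)%C. ring. }
    apply (is_RInt_Chasles (V := C_R_NormedModule) _ e a b).
    + apply (is_RInt_ext (V := C_R_NormedModule) f).
      * intros t Ht. rewrite Rmin_left, Rmax_right in Ht by lra. unfold trunc.
        destruct Rlt_dec; [|lra]. simpl. symmetry. apply Cmult_1_l.
      * rewrite <- El. apply is_CRInt_derive; [lra| |]; intros t Ht; [apply Hg|apply Hf]; lra.
    + apply (is_RInt_ext (V := C_R_NormedModule) (fun _ => RtoC 0)).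
      * intros t Ht. rewrite Rmin_left, Rmax_right in Ht by lra. unfold trunc.
        destruct Rlt_dec; [lra|]. symmetry. apply Cmult_0_l.
      * apply is_CRInt_const.
  - apply (Clim_le (F := F0oo)) with (fun ab => r (fst ab)).
    + generalize (F0oo_lt 1 a Rlt_0_1). apply filter_imp. intros [e b] [H1 H2]; simpl in *.
      replace (l - g e - l)%C with (- g e)%C by ring. rewrite Cmod_opp. now apply Hr.
    + now apply filterlim_F0oo_fst.
Qed.

Lemma is_int_0oo_trunc_0 (a : R) (w : C) : 0 < a -> 0 < Re w ->
  is_int_0oo (fun t => RtoC (trunc 0 a t) * Cpw (w - 1) t)%C (Cpw w a / w)%C.
Proof.
  intros Ha Hw. assert (W0 := Re_pos_neq_0' w Hw).
  apply (is_int_0oo_trunc_aux a _ (fun t => Cpw w t / w)%C _ (fun t => / Cmod w * exp (Re w * ln t))); try easy.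
  - intros t Ht.
    assert (H := is_derive_Cpw w t Ht).
    apply (is_derive_ext (V := C_R_NormedModule) (fun t => / w * Cpw w t)%C). { intro; apply Cmult_comm. }
    replace (Cpw (w - 1) t) with (/ w * (w * Cpw (w - 1) t))%C by (field; exact W0).
    now apply is_derive_Cscal.
  - intros t Ht. now apply continuous_Cpw.
  - intros t Ht. rewrite Cmod_div by exact W0. rewrite Cmod_Cpw. right; field.
    intro E; apply Cmod_eq_0 in E; contradiction.
  - replace (locally 0) with (locally (/ Cmod w * 0)) by now rewrite Rmult_0_r.
    apply (filterlim_comp _ _ _ (fun t => exp (Re w * ln t)) (fun y => / Cmod w * y) _ (locally 0)).
    + now apply filterlim_Rpower_0.
    + apply (filterlim_scal_r (V := R_NormedModule)).
Qed.

(** Half of the exponent absorbs the logarithm: with [s = - (x / 2) * ln t] this is [s <= exp s]. *)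
Lemma abs_ln_exp_le (x t : R) : 0 < x -> 0 < t < 1 ->
  Rabs (ln t) * exp (x * ln t) <= 2 / x * exp (x / 2 * ln t).
Proof.
  intros Hx Ht. assert (L : ln t < 0) by (rewrite <- ln_1; apply ln_increasing; lra).
  rewrite Rabs_left by exact L. set (u := ln t) in *.
  replace (x * u) with (x / 2 * u + x / 2 * u) by field. rewrite exp_plus, <- Rmult_assoc.
  apply Rmult_le_compat_r; [left; apply exp_pos|].
  assert (H := exp_ineq1_le (- (x / 2 * u))).
  assert (E : exp (- (x / 2 * u)) * exp (x / 2 * u) = 1) by (rewrite <- exp_plus, Rplus_opp_l; apply exp_0).
  assert (P := exp_pos (x / 2 * u)). assert (Hi : 0 < / x) by now apply Rinv_0_lt_compat.
  replace (- u) with (2 / x * (- (x / 2 * u))) by (field; lra). rewrite Rmult_assoc.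
  replace (2 / x) with (2 / x * 1) at 2 by ring. apply Rmult_le_compat_l; [unfold Rdiv; lra|]. nra.
Qed.

Lemma is_int_0oo_trunc_0_ln (a : R) (w : C) : 0 < a -> 0 < Re w ->
  is_int_0oo (fun t => RtoC (trunc 0 a t) * (Cpw (w - 1) t * RtoC (ln t)))%C
   (Cpw w a / w * (RtoC (ln a) - / w))%C.
Proof.
  intros Ha Hw. assert (W0 := Re_pos_neq_0' w Hw).
  assert (Wp : 0 < Cmod w) by now apply Cmod_gt_0.
  set (K := 2 / Re w / Cmod w + / Cmod w ^ 2).
  apply (is_int_0oo_trunc_aux a _ (fun t => Cpw w t * (/ w * RtoC (ln t) - / w * / w))%C _
     (fun t => K * exp (Re w / 2 * ln t))); try easy.
  - intros t Ht. assert (Ht0 : RtoC t <> 0%C) by (apply RtoC_neq_0; lra).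
    replace (Cpw (w - 1) t * RtoC (ln t))%C with (w * Cpw (w - 1) t * (/ w * RtoC (ln t) - / w * / w) + Cpw w t * (/ w * RtoC (/ t)))%C.
    2: { rewrite Cpw_minus_1, RtoC_inv by lra. field. now split. }
    apply is_derive_Cmult; [now apply is_derive_Cpw|].
    apply (is_derive_ext (V := C_R_NormedModule) (fun t => / w * (RtoC (ln t) - / w))%C). { intro; simpl; ring. }
    apply is_derive_Cscal. apply is_derive_C; unfold Re, Im, RtoC; simpl; auto_derive; trivial. field; lra.
  - intros t Ht. apply continuous_Cmult; [now apply continuous_Cpw|].
    now apply continuous_RtoC, continuous_ln.
  - simpl. field. exact W0.
  - intros t Ht. rewrite Cmod_mult, Cmod_Cpw.
    assert (A : Cmod (/ w * RtoC (ln t) - / w * / w) <= / Cmod w * Rabs (ln t) + / Cmod w * / Cmod w).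
    { apply Rle_trans with (1 := Cmod_triangle _ _).
      rewrite Cmod_opp, !Cmod_mult, !Cmod_inv, Cmod_R by exact W0. lra. }
    assert (B := abs_ln_exp_le (Re w) t Hw Ht).
    assert (L : ln t < 0) by (rewrite <- ln_1; apply ln_increasing; lra).
    assert (D : exp (Re w * ln t) <= exp (Re w / 2 * ln t)). { apply exp_le_compat. nra. }
    assert (P := exp_pos (Re w * ln t)). assert (Q : 0 < / Cmod w) by now apply Rinv_0_lt_compat.
    apply Rle_trans with (exp (Re w * ln t) * (/ Cmod w * Rabs (ln t) + / Cmod w * / Cmod w)).
    { apply Rmult_le_compat_l; lra. }
    unfold K. replace (/ Cmod w ^ 2) with (/ Cmod w * / Cmod w) by (field; lra). unfold Rdiv at 1.
    assert (B' : / Cmod w * (Rabs (ln t) * exp (Re w * ln t)) <= / Cmod w * (2 / Re w * exp (Re w / 2 * ln t))).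
    { apply Rmult_le_compat_l; lra. }
    assert (D' : / Cmod w * / Cmod w * exp (Re w * ln t) <= / Cmod w * / Cmod w * exp (Re w / 2 * ln t)).
    { apply Rmult_le_compat_l; nra. }
    lra.
  - replace (locally 0) with (locally (K * 0)) by now rewrite Rmult_0_r.
    apply (filterlim_comp _ _ _ (fun t => exp (Re w / 2 * ln t)) (fun y => K * y) _ (locally 0)).
    + apply filterlim_Rpower_0. lra.
    + apply (filterlim_scal_r (V := R_NormedModule)).
Qed.

(** No integration by parts: [trunc_S] contains a factor [t], which turns the exponent [w - 1] into
    [w]. The integral for [S k] at [w] thus combines those for [k] at [w] and at [w + 1], and this
    is why [w] is quantified inside the induction. *)
Lemma is_int_0oo_trunc (a : R) (k : nat) : 0 < a -> forall w, 0 < Re w ->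
  is_int_0oo (fun t => RtoC (trunc k a t) * Cpw (w - 1) t)%C (Cpw w a * euler_prod k w)%C /\
  is_int_0oo (fun t => RtoC (trunc k a t) * (Cpw (w - 1) t * RtoC (ln t)))%C
    (Cpw w a * euler_prod k w * (RtoC (ln a) - harmonic_shift k w))%C.
Proof.
  intros Ha. assert (Ha0 : RtoC a <> 0%C) by (apply RtoC_neq_0; lra).
  induction k as [|k IH]; intros w Hw.
  - split; [now apply is_int_0oo_trunc_0 | now apply is_int_0oo_trunc_0_ln].
  - destruct (IH w Hw) as [A1 A2]. destruct (IH (w + 1)%C (Re_plus_1 w Hw)) as [B1 B2].
    assert (W0 := Re_pos_neq_0' w Hw). assert (W1 := Re_pos_neq_0 w _ Hw (pos_INR (S k))).
    assert (ES : forall t, 0 < t -> RtoC (trunc (S k) a t) = (RtoC (trunc k a t) - / RtoC a * RtoC (trunc k a t) * RtoC t)%C).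
    { intros t Ht. rewrite trunc_S. unfold Rdiv. rewrite RtoC_minus, !RtoC_mult, RtoC_inv by lra. ring. }
    assert (EC : forall t, 0 < t -> Cpw (w + 1 - 1) t = (RtoC t * Cpw (w - 1) t)%C).
    { intros t Ht. replace (w + 1 - 1)%C with (w - 1 + 1)%C by ring. rewrite Cpw_plus, Cpw_1 by exact Ht.
      ring. }
    assert (EA : Cpw (w + 1) a = (RtoC a * Cpw w a)%C).
    { rewrite Cpw_plus, Cpw_1 by exact Ha. ring. }
    split.
    + replace (Cpw w a * euler_prod (S k) w)%C with (Cpw w a * euler_prod k w - / RtoC a * (Cpw (w + 1) a * euler_prod k (w + 1)))%C.
      2: { rewrite EA, euler_prod_shift by exact Hw. cbn [euler_prod]. rewrite RtoC_INR_S in *. field.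
           now split. }
      refine (is_int_0oo_ext _ _ _ _ (is_int_0oo_minus _ _ _ _ A1 (is_int_0oo_mult (/ RtoC a) _ _ B1))).
      intros t Ht; simpl. rewrite ES, EC by exact Ht. ring.
    + replace (Cpw w a * euler_prod (S k) w * (RtoC (ln a) - harmonic_shift (S k) w))%C
      with (Cpw w a * euler_prod k w * (RtoC (ln a) - harmonic_shift k w) - / RtoC a * (Cpw (w + 1) a * euler_prod k (w + 1) * (RtoC (ln a) - harmonic_shift k (w + 1))))%C.
      2: { rewrite EA, euler_prod_shift, harmonic_shift_shift by exact Hw. cbn [euler_prod harmonic_shift].
           rewrite RtoC_INR_S in *. field. now repeat split. }
      refine (is_int_0oo_ext _ _ _ _ (is_int_0oo_minus _ _ _ _ A2 (is_int_0oo_mult (/ RtoC a) _ _ B2))).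
      intros t Ht; simpl. rewrite ES, EC by exact Ht. ring.
Qed.

Lemma is_lim_seq_div_n (c : R) : is_lim_seq (fun n => c / INR n) 0.
Proof.
  replace (Finite 0) with (Rbar_mult c 0) by (simpl; now rewrite Rmult_0_r).
  apply is_lim_seq_scal_l. replace (Finite 0) with (Rbar_inv p_infty) by reflexivity.
  apply is_lim_seq_inv; [apply is_lim_seq_INR|discriminate].
Qed.

(** By [trunc_exp], replacing [exp (- t)] by the truncated power costs at most
    [t ^ 2 * exp (- t) / n]. The hypothesis on [f] carries [exp t] because [gdom] already contains
    [exp (- t)]; the integrated error is then of order [1 / n]. *)
Lemma Clim_trunc (w l : C) (v : nat -> C) (f : R -> C) : 0 < Re w ->
  (forall t, 0 < t -> t ^ 2 * Cmod (f t) <= gdom (Re w) t * exp t) ->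
  is_int_0oo (fun t => RtoC (exp (- t)) * f t)%C l ->
  (forall n, (0 < n)%nat -> is_int_0oo (fun t => RtoC (trunc n (INR n) t) * f t)%C (v n)) ->
  Clim eventually v l.
Proof.
  intros Hw Hf Hl Hv. destruct (gdom_dom (Re w) Hw) as [M [eta [HM [He Hd]]]].
  apply (Clim_le (F := eventually)) with (fun n => M * (PI / 2 / eta) / INR n).
  2: apply is_lim_seq_div_n.
  exists 1%nat. intros n Hn. assert (HN : 0 < INR n) by (apply lt_0_INR; lia).
  replace (v n - l)%C with (- (l - v n))%C by ring. rewrite Cmod_opp.
  replace (M * (PI / 2 / eta) / INR n) with (M / INR n * (PI / 2 / eta)) by (field; lra).
  refine (is_int_0oo_bound eta _ _ _ He _ (is_int_0oo_minus _ _ _ _ Hl (Hv n Hn))).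
  intros t Ht. replace (RtoC (exp (- t)) * f t - RtoC (trunc n (INR n) t) * f t)%C
   with (RtoC (exp (- t) - trunc n (INR n) t) * f t)%C by (rewrite RtoC_minus; ring).
  destruct (trunc_exp n t Hn (Rlt_le _ _ Ht)) as [T1 T2].
  rewrite Cmod_mult, Cmod_R, Rabs_pos_eq by exact T1.
  apply Rle_trans with (t ^ 2 * exp (- t) / INR n * Cmod (f t)).
  { apply Rmult_le_compat_r; [apply Cmod_ge_0|exact T2]. }
  replace (t ^ 2 * exp (- t) / INR n * Cmod (f t)) with (/ INR n * exp (- t) * (t ^ 2 * Cmod (f t))) by (field; lra).
  replace (M / INR n * dom eta t) with (/ INR n * (M * dom eta t)) by (field; lra).
  rewrite Rmult_assoc. apply Rmult_le_compat_l; [left; now apply Rinv_0_lt_compat|].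
  apply Rle_trans with (2 := Hd t Ht).
  assert (P := exp_pos (- t)).
  replace (gdom (Re w) t) with (exp (- t) * (gdom (Re w) t * exp t)).
  - apply Rmult_le_compat_l; [lra|now apply Hf].
  - rewrite (Rmult_comm (gdom _ _)), <- Rmult_assoc, <- exp_plus, Rplus_opp_l, exp_0. ring.
Qed.

Lemma Clim_Euler (w l : C) : 0 < Re w -> is_int_0oo (fun t => Gint w t * RtoC (ln t))%C l ->
  Clim eventually (fun n => Cpw w (INR n) * euler_prod n w)%C (CGamma w) /\
  Clim eventually (fun n => Cpw w (INR n) * euler_prod n w * (RtoC (ln (INR n)) - harmonic_shift n w))%C l.
Proof.
  intros Hw Hl.
  assert (E1 : forall t, exp (- t) * exp t = 1) by (intro; rewrite <- exp_plus, Rplus_opp_l; apply exp_0).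
  assert (E : forall t, Cmod (Cpw (w - 1) t) = exp ((Re w - 1) * ln t)).
  { intro t. rewrite Cmod_Cpw. reflexivity. }
  assert (G : forall t g, 0 < t -> g <= (1 + t ^ 2) * (1 + ln t ^ 2) * exp (Re w / 4 * Rabs (ln t)) ->
     g * exp ((Re w - 1) * ln t) <= gdom (Re w) t * exp t).
  { intros t g Ht Hg. assert (H := gdom_ge (Re w) t g Ht Hg). specialize (E1 t).
    assert (P := exp_pos t). apply Rmult_le_compat_r with (r := exp t) in H; [|lra].
    replace (g * (exp ((Re w - 1) * ln t) * exp (- t)) * exp t) with (g * exp ((Re w - 1) * ln t) * (exp (- t) * exp t)) in H by ring.
    rewrite E1, Rmult_1_r in H. exact H. }
  split.
  - apply (Clim_trunc w _ _ (Cpw (w - 1))); [exact Hw| | |].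
    + intros t Ht. rewrite E. apply G; [exact Ht|]. now apply gdom_weights.
    + apply is_int_0oo_ext with (2 := is_int_0oo_CGamma w Hw). intros t Ht. apply Cmult_comm.
    + intros n Hn. exact (proj1 (is_int_0oo_trunc (INR n) n (lt_0_INR n Hn) w Hw)).
  - apply (Clim_trunc w _ _ (fun t => Cpw (w - 1) t * RtoC (ln t))%C); [exact Hw| | |].
    + intros t Ht. rewrite Cmod_mult, E, Cmod_R.
      rewrite (Rmult_comm (exp _)), <- Rmult_assoc. apply G; [exact Ht|]. now apply gdom_weights.
    + apply is_int_0oo_ext with (2 := Hl). intros t Ht. unfold Gint. ring.
    + intros n Hn. exact (proj2 (is_int_0oo_trunc (INR n) n (lt_0_INR n Hn) w Hw)).
Qed.

(** The square of the modulus of [1 + w / m] is [(1 + Re w / m) ^ 2 + (Im w / m) ^ 2], and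
    [1 + s <= exp s] is applied to both parts. The imaginary part enters only with [1 / m ^ 2],
    which is summable. *)
Lemma Cmod_plus_nat_le (w : C) (m : R) : 0 < Re w -> 0 < m ->
  Cmod (w + RtoC m) <= m * exp (Re w / m + Im w ^ 2 / m ^ 2).
Proof.
  intros Hw Hm. destruct w as [x y]. unfold Re, Im in *; simpl in Hw |- *.
  unfold Cmod, Cplus, RtoC; simpl.
  assert (A := exp_ineq1_le (x / m)). assert (B := exp_ineq1_le (y ^ 2 / m ^ 2)).
  rewrite exp_plus. set (E := exp (x / m)) in *. simpl in B.
  set (G := exp (y * (y * 1) / (m * (m * 1)))) in *.
  assert (Hi : 0 < / m) by now apply Rinv_0_lt_compat.
  assert (X : 0 < x / m) by (unfold Rdiv; nra).
  rewrite <- (sqrt_Rsqr (m * (E * G))).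
  2: { unfold E, G. apply Rmult_le_pos; [lra|]. left; apply Rmult_lt_0_compat; apply exp_pos. }
  apply sqrt_le_1_alt. unfold Rsqr.
  set (a := x / m) in *. set (b := y * (y * 1) / (m * (m * 1))) in *.
  assert (Hb : 0 <= b). { unfold b. apply Rle_mult_inv_pos; nra. }
  replace x with (a * m) by (unfold a; field; lra).
  replace ((y + 0) * ((y + 0) * 1)) with (b * (m * m)) by (unfold b; field; lra).
  replace ((a * m + m) * ((a * m + m) * 1) + b * (m * m)) with (m * m * ((1 + a) * (1 + a) + b)) by ring.
  replace (m * (E * G) * (m * (E * G))) with (m * m * (E * E * (G * G))) by ring.
  apply Rmult_le_compat_l; [nra|].
  assert (1 <= E * E) by nra. assert (1 + b <= G * G) by nra.
  assert ((1 + a) * (1 + a) <= E * E) by nra.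
  apply Rle_trans with (E * E * (1 + b)); [nra|]. apply Rmult_le_compat_l; lra.
Qed.

(* [|n ^ w * euler_prod n w| * exp (- Im w ^ 2 / n)] is nondecreasing in [n], which keeps the
   limit [Gamma w] away from 0. *)
Lemma Euler_lower_bound (w : C) (n : nat) : 0 < Re w ->
  Cmod (Cpw w (INR 1) * euler_prod 1 w) * exp (- Im w ^ 2)
  <= Cmod (Cpw w (INR (S n)) * euler_prod (S n) w) * exp (- (Im w ^ 2 / INR (S n))).
Proof.
  intros Hw. induction n as [|n IH].
  - right. do 2 f_equal. simpl INR. field.
  - apply Rle_trans with (1 := IH). set (k := S n) in *.
    assert (Hk : 0 < INR k) by (apply lt_0_INR; unfold k; lia).
    assert (Ek : INR (S k) = INR k + 1) by now rewrite S_INR.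
    cbn [euler_prod]. set (m := INR (S k)) in *. set (r := INR k) in *.
    assert (W1 : (w + RtoC m)%C <> 0%C) by (apply Re_pos_neq_0; [exact Hw|lra]).
    unfold Cdiv. rewrite !Cmod_mult, Cmod_inv by exact W1.
    rewrite !Cmod_Cpw, Cmod_R, Rabs_pos_eq by lra.
    assert (A := Cmod_plus_nat_le w m Hw ltac:(lra)).
    assert (P1 : 0 < Cmod (w + RtoC m)) by now apply Cmod_gt_0.
    assert (B : / exp (Re w / m + Im w ^ 2 / m ^ 2) <= m * / Cmod (w + RtoC m)).
    { apply Rmult_le_reg_r with (Cmod (w + RtoC m)); [exact P1|].
      rewrite Rmult_assoc, Rinv_l, Rmult_1_r by lra.
      apply Rmult_le_reg_l with (exp (Re w / m + Im w ^ 2 / m ^ 2)); [apply exp_pos|].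
      rewrite <- Rmult_assoc, Rinv_r, Rmult_1_l by (apply Rgt_not_eq, exp_pos). lra. }
    rewrite <- exp_Ropp in B.
    set (e := Cmod (euler_prod k w)). assert (He : 0 <= e) by apply Cmod_ge_0.
    apply Rle_trans with (exp (Re w * ln m) * (e * exp (- (Re w / m + Im w ^ 2 / m ^ 2))) * exp (- (Im w ^ 2 / m))).
    + rewrite (Rmult_comm (exp (Re w * ln r))), (Rmult_comm (exp (Re w * ln m))), !Rmult_assoc.
      apply Rmult_le_compat_l; [exact He|]. rewrite <- !exp_plus. apply exp_le_compat.
      (* Here [r = m - 1]. The growth of [n ^ Re w] from [r] to [m] pays for the factor
         [exp (- Re w / m)], and by [Q] the decrease of [Im w ^ 2 / n] pays for
         [exp (- Im w ^ 2 / m ^ 2)]. *)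
      assert (L : ln r + / m <= ln m).
      { assert (H := exp_ineq1_le (ln (r / m))).
        assert (Hrm : 0 < r / m) by (apply Rdiv_lt_0_compat; lra).
        rewrite exp_ln, ln_div in H by lra.
        replace (r / m) with (1 - / m) in H by (rewrite Ek; field; lra). lra. }
      assert (Q : / m ^ 2 + / m <= / r).
      { replace (/ m ^ 2 + / m) with ((m + 1) / m ^ 2) by (field; lra).
        apply Rmult_le_reg_r with (r * m ^ 2). { apply Rmult_lt_0_compat; [exact Hk|nra]. }
        replace ((m + 1) / m ^ 2 * (r * m ^ 2)) with ((m + 1) * r) by (field; lra).
        replace (/ r * (r * m ^ 2)) with (m ^ 2) by (field; lra). nra. }
      unfold Rdiv. assert (Y : 0 <= Im w ^ 2) by nra.
      assert (Im w ^ 2 * (/ m ^ 2 + / m) <= Im w ^ 2 * / r) by now apply Rmult_le_compat_l.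
      assert (Re w * (ln r + / m) <= Re w * ln m) by (apply Rmult_le_compat_l; lra). lra.
    + apply Rmult_le_compat_r; [left; apply exp_pos|].
      apply Rmult_le_compat_l; [left; apply exp_pos|]. rewrite Rmult_assoc.
      apply Rmult_le_compat_l; assumption.
Qed.

Lemma euler_prod_neq_0 (k : nat) (w : C) : 0 < Re w -> euler_prod k w <> 0%C.
Proof.
  intros Hw. induction k as [|k IH].
  - simpl. intro E. assert (W0 := Re_pos_neq_0' w Hw). apply (f_equal (fun u => u * w)%C) in E.
    rewrite Cinv_l, Cmult_0_l in E by exact W0. apply RtoC_inj in E; lra.
  - cbn [euler_prod]. assert (W := Re_pos_neq_0 w _ Hw (pos_INR (S k))).
    apply Cmult_neq_0; [apply Cmult_neq_0; [exact IH|]|].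
    + intro E; apply RtoC_inj in E. rewrite S_INR in E. generalize (pos_INR k); lra.
    + intro E. apply (f_equal (fun u => u * (w + RtoC (INR (S k))))%C) in E.
      rewrite Cinv_l, Cmult_0_l in E by exact W. apply RtoC_inj in E; lra.
Qed.

Lemma CGamma_neq_0 (w : C) : 0 < Re w -> CGamma w <> 0%C.
Proof.
  intros Hw. destruct (ex_int_0oo_CGamma' w Hw) as [l Hl].
  destruct (Clim_Euler w l Hw Hl) as [H _].
  set (c := Cmod (Cpw w (INR 1) * euler_prod 1 w) * exp (- Im w ^ 2)).
  assert (Hc : 0 < c).
  { apply Rmult_lt_0_compat; [|apply exp_pos]. apply Cmod_gt_0.
    apply Cmult_neq_0; [apply Cexp_neq_0|now apply euler_prod_neq_0]. }
  assert (B : c <= Cmod (CGamma w)).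
  { refine (Clim_ge (F := eventually) _ _ _ _ H). exists 1%nat. intros [|n] Hn; [lia|].
    apply Rle_trans with (1 := Euler_lower_bound w n Hw).
    rewrite <- (Rmult_1_r (Cmod _)) at 2. apply Rmult_le_compat_l; [apply Cmod_ge_0|].
    rewrite <- exp_0. apply exp_le_compat.
    assert (0 <= Im w ^ 2 / INR (S n)); [|lra]. apply Rle_mult_inv_pos; [nra|apply lt_0_INR; lia]. }
  intro E. rewrite E, Cmod_0 in B. lra.
Qed.

Theorem digamma_lim (w : C) : 0 < Re w ->
  Clim eventually (fun n => RtoC (ln (INR n)) - harmonic_shift n w)%C (digamma w).
Proof.
  intros Hw. destruct (ex_int_0oo_CGamma' w Hw) as [l Hl].
  destruct (Clim_Euler w l Hw Hl) as [H1 H2].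
  assert (G0 := CGamma_neq_0 w Hw).
  unfold digamma. rewrite (Cderive_unique CGamma w l) by now apply is_derive_CGamma.
  refine (Clim_ext_loc _ _ _ _ (Clim_mult _ _ _ _ H2 (Clim_inv _ _ G0 H1))).
  exists 0%nat. intros n _. assert (E := euler_prod_neq_0 n w Hw).
  assert (E' := Cexp_neq_0 (w * RtoC (ln (INR n)))).
  unfold Cpw. field. now split.
Qed.

(** * Properties of the digamma function *)

Lemma Re_plus_le_Cmod (w : C) (x : R) : Re w + x <= Cmod (w + RtoC x).
Proof. apply (Re_le_Cmod (w + RtoC x)). Qed.

(** The term without shift is removed, since it is unbounded near 0. For [m >= 1] both [w + m] and
    [v + m] have modulus at least [m], so the remaining differences are bounded by
    [Cmod (w - v) / m ^ 2]; [2 - 1 / n] is the telescoping bound for the sum of [1 / m ^ 2]. *)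
Lemma harmonic_shift_lipschitz (n : nat) (w v : C) : 0 < Re w -> 0 < Re v ->
  Cmod (harmonic_shift (S n) w - harmonic_shift (S n) v - (/ w - / v)) <= Cmod (w - v) * (2 - / INR (S n)).
Proof.
  intros Hw Hv.
  assert (St : forall m, 0 < m -> Cmod (/ (w + RtoC m) - / (v + RtoC m)) <= Cmod (w - v) * / m ^ 2).
  { intros m Hm.
    assert (W := Re_pos_neq_0 w m Hw (Rlt_le _ _ Hm)). assert (V := Re_pos_neq_0 v m Hv (Rlt_le _ _ Hm)).
    replace (/ (w + RtoC m) - / (v + RtoC m))%C with (- (w - v) / ((w + RtoC m) * (v + RtoC m)))%C by (field; now split).
    unfold Cdiv. rewrite Cmod_mult, Cmod_opp, Cmod_inv, Cmod_mult by now apply Cmult_neq_0.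
    apply Rmult_le_compat_l; [apply Cmod_ge_0|].
    assert (A := Re_plus_le_Cmod w m). assert (B := Re_plus_le_Cmod v m).
    apply Rinv_le_contravar; nra. }
  induction n as [|n IH].
  - cbn [harmonic_shift]. replace (/ w + / (w + RtoC (INR 1)) - (/ v + / (v + RtoC (INR 1))) - (/ w - / v))%C
     with (/ (w + RtoC (INR 1)) - / (v + RtoC (INR 1)))%C by ring.
    apply Rle_trans with (1 := St (INR 1) ltac:(simpl; lra)). simpl.
    apply Rmult_le_compat_l; [apply Cmod_ge_0|lra].
  - set (k := S n) in *. cbn [harmonic_shift].
    replace (harmonic_shift k w + / (w + RtoC (INR (S k))) - (harmonic_shift k v + / (v + RtoC (INR (S k)))) - (/ w - / v))%C
    with ((harmonic_shift k w - harmonic_shift k v - (/ w - / v)) + (/ (w + RtoC (INR (S k))) - / (v + RtoC (INR (S k)))))%C by ring.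
    apply Rle_trans with (1 := Cmod_triangle _ _).
    assert (Hk : 0 < INR k) by (apply lt_0_INR; unfold k; lia).
    assert (A := St (INR (S k)) ltac:(rewrite S_INR; lra)).
    rewrite S_INR in *. set (r := INR k) in *.
    assert (D := Cmod_ge_0 (w - v)).
    assert (Q : / (r + 1) ^ 2 <= / r - / (r + 1)).
    { replace (/ r - / (r + 1)) with (/ (r * (r + 1))) by (field; lra). apply Rinv_le_contravar; nra. }
    assert (Cmod (w - v) * / (r + 1) ^ 2 <= Cmod (w - v) * (/ r - / (r + 1))) by now apply Rmult_le_compat_l.
    lra.
Qed.

(** Adding [/ w] gives psi(w + 1), which has no pole at 0; this is what makes the bound uniform up
    to the edge Re w = 0. *)
Lemma digamma_lipschitz (w v : C) : 0 < Re w -> 0 < Re v ->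
  Cmod (digamma w + / w - (digamma v + / v)) <= 2 * Cmod (w - v).
Proof.
  intros Hw Hv.
  assert (H := Clim_minus _ _ _ _
    (Clim_plus (F := eventually) _ _ _ _ (digamma_lim w Hw) (Clim_const (/ w)))
    (Clim_plus (F := eventually) _ _ _ _ (digamma_lim v Hv) (Clim_const (/ v)))).
  refine (Cmod_Clim_le (F := eventually) _ _ _ _ H).
  exists 1%nat. intros [|n] Hn; [lia|].
  replace (RtoC (ln (INR (S n))) - harmonic_shift (S n) w + / w - (RtoC (ln (INR (S n))) - harmonic_shift (S n) v + / v))%C
  with (- (harmonic_shift (S n) w - harmonic_shift (S n) v - (/ w - / v)))%C by ring. rewrite Cmod_opp.
  apply Rle_trans with (1 := harmonic_shift_lipschitz n w v Hw Hv). rewrite Rmult_comm.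
  apply Rmult_le_compat_r; [apply Cmod_ge_0|].
  assert (0 < / INR (S n)); [|lra]. apply Rinv_0_lt_compat, lt_0_INR; lia.
Qed.

(** Even and odd shifts are separated: [w + 2 m] is twice [w / 2 + m], and [w + 2 m + 1] is twice
    [(w + 1) / 2 + m]. The upper index is [2 * n + 1] so that both kinds occur [n + 1] times. *)
Lemma harmonic_shift_duplication (n : nat) (w : C) : 0 < Re w ->
  harmonic_shift (2 * n + 1) w = ((harmonic_shift n (w / 2) + harmonic_shift n ((w + 1) / 2)) / 2)%C.
Proof.
  intros Hw. assert (W0 := Re_pos_neq_0' w Hw).
  assert (T : RtoC 2 <> 0%C) by (apply RtoC_neq_0; lra).
  assert (S1 : forall m, 0 <= m -> (/ (w / 2 + RtoC m) = 2 / (w + RtoC (2 * m)))%C).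
  { intros m Hm. assert (W := Re_pos_neq_0 w (2 * m) Hw ltac:(lra)). rewrite RtoC_mult in *. field.
    now repeat split. }
  assert (S2 : forall m, 0 <= m -> (/ ((w + 1) / 2 + RtoC m) = 2 / (w + RtoC (2 * m + 1)))%C).
  { intros m Hm. assert (W := Re_pos_neq_0 w (2 * m + 1) Hw ltac:(lra)). rewrite RtoC_plus, RtoC_mult in *.
    field; repeat split; try assumption; intro E; apply W; rewrite <- E; ring. }
  induction n as [|n IH].
  - cbn [harmonic_shift Nat.mul Nat.add]. simpl INR. assert (W := Re_pos_neq_0 w 1 Hw Rle_0_1). field.
    now repeat split.
  - replace (2 * S n + 1)%nat with (S (S (2 * n + 1))) by lia. cbn [harmonic_shift]. rewrite IH.
    rewrite S1, S2 by apply pos_INR.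
    replace (INR (S (2 * n + 1))) with (2 * INR (S n)) by (rewrite !S_INR, plus_INR, mult_INR; simpl; ring).
    replace (INR (S (S (2 * n + 1)))) with (2 * INR (S n) + 1) by (rewrite !S_INR, plus_INR, mult_INR; simpl; ring).
    assert (P := pos_INR (S n)).
    assert (W1 := Re_pos_neq_0 w (2 * INR (S n)) Hw ltac:(lra)).
    assert (W2 := Re_pos_neq_0 w (2 * INR (S n) + 1) Hw ltac:(lra)). field. now repeat split.
Qed.

Lemma Re_half (w : C) : Re (w / 2) = Re w / 2.
Proof. unfold Re, Cdiv, Cmult, Cinv, RtoC; simpl. field. Qed.
Lemma Re_half_1 (w : C) : Re ((w + 1) / 2) = (Re w + 1) / 2.
Proof. unfold Re, Cdiv, Cmult, Cinv, Cplus, RtoC; simpl. field. Qed.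
Lemma Im_half_1 (w : C) : Im ((w + 1) / 2) = Im w / 2.
Proof. unfold Re, Im, Cdiv, Cmult, Cinv, Cplus, RtoC; simpl. field. Qed.

Lemma digamma_duplication (w : C) : 0 < Re w ->
  digamma w = ((digamma (w / 2) + digamma ((w + 1) / 2)) / 2 + RtoC (ln 2))%C.
Proof.
  intros Hw.
  assert (H1 := digamma_lim (w / 2)%C ltac:(rewrite Re_half; lra)).
  assert (H2 := digamma_lim ((w + 1) / 2)%C ltac:(rewrite Re_half_1; lra)).
  assert (H3 := digamma_lim w Hw).
  assert (Hs : filterlim (fun n => (2 * n + 1)%nat) eventually eventually).
  { intros P [N HN]. exists N. intros n Hn. apply HN. lia. }
  apply (Clim_comp _ _ _ _ _ Hs) in H3.
  (* The left side is normalized by [ln (2 n + 1)] and the two sums on the right by [ln n]; this is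
     the origin of [ln 2]. *)
  assert (L : Clim eventually (fun n => RtoC (ln (INR (2 * n + 1)) - ln (INR n))) (RtoC (ln 2))).
  { apply (Clim_le (F := eventually)) with (fun n => 1 / INR n); [|apply is_lim_seq_div_n].
    exists 1%nat. intros n Hn. assert (P : 1 <= INR n) by (apply (le_INR 1); lia).
    rewrite <- RtoC_minus, Cmod_R. rewrite plus_INR, mult_INR. simpl (INR 2). simpl (INR 1).
    assert (E : ln (2 * INR n + 1) - ln (INR n) - ln 2 = ln (1 + / (2 * INR n))).
    { rewrite <- ln_div by lra. rewrite <- ln_div by (try apply Rdiv_lt_0_compat; lra). f_equal. field. lra. }
    change (1 + 1) with 2. rewrite E.
    assert (Q : 0 < / (2 * INR n)) by (apply Rinv_0_lt_compat; lra).
    rewrite Rabs_pos_eq. 2: { rewrite <- ln_1. apply ln_le; lra. }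
    assert (X := exp_ineq1_le (ln (1 + / (2 * INR n)))). rewrite exp_ln in X by lra.
    assert (/ (2 * INR n) <= 1 / INR n); [|lra].
    unfold Rdiv. rewrite Rmult_1_l. apply Rinv_le_contravar; lra. }
  refine (Clim_unique (F := eventually) _ _ _ H3 _).
  refine (Clim_ext _ _ _ _ (Clim_plus (F := eventually) _ _ _ _ (Clim_mult _ _ _ _ (Clim_plus _ _ _ _ H1 H2) (Clim_const (/ 2)%C)) L)).
  intro n. rewrite harmonic_shift_duplication by exact Hw. rewrite RtoC_minus.
  assert (T : RtoC 2 <> 0%C) by (apply RtoC_neq_0; lra). field; exact T.
Qed.

(** * Digamma on the line Re w = 1/2 *)

Lemma Clim_Re {T} {F : (T -> Prop) -> Prop} {FF : ProperFilter F} (f : T -> C) (l : C) :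
  Clim F f l -> filterlim (fun x => Re (f x)) F (locally (Re l)).
Proof.
  intros H. apply Clim_filterlim in H.
  apply (filterlim_comp _ _ _ f (fun u : C => Re u) _ _ _ H). destruct l. apply continuous_fst.
Qed.

Lemma Clim_Im {T} {F : (T -> Prop) -> Prop} {FF : ProperFilter F} (f : T -> C) (l : C) :
  Clim F f l -> filterlim (fun x => Im (f x)) F (locally (Im l)).
Proof.
  intros H. apply Clim_filterlim in H.
  apply (filterlim_comp _ _ _ f (fun u : C => Im u) _ _ _ H). destruct l. apply continuous_snd.
Qed.

(** All terms of the limit are real at a real point. This fixes the imaginary part of the constant
    at the end. *)
Lemma Im_digamma_half : Im (digamma (RtoC (1 / 2))) = 0.
Proof.
  assert (H := digamma_lim (RtoC (1 / 2)) ltac:(simpl; lra)).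
  assert (H1 := Clim_Im _ _ H).
  assert (E : forall n, exists r, harmonic_shift n (RtoC (1 / 2)) = RtoC r).
  { induction n as [|n [r IH]].
    - exists (/ (1 / 2)). simpl. rewrite RtoC_inv; [reflexivity|lra].
    - exists (r + / (1 / 2 + INR (S n))). cbn [harmonic_shift].
      rewrite IH, RtoC_plus, RtoC_inv, RtoC_plus; [reflexivity|].
      generalize (pos_INR (S n)); lra. }
  assert (H2 : is_lim_seq (fun n => 0) (Im (digamma (RtoC (1 / 2))))).
  { apply (is_lim_seq_ext (fun n => Im (RtoC (ln (INR n)) - harmonic_shift n (RtoC (1 / 2))))); [|exact H1].
    intro n. destruct (E n) as [r ->]. unfold Im, RtoC; simpl. ring. }
  assert (H3 := is_lim_seq_unique _ _ H2). rewrite Lim_seq_const in H3. now injection H3.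
Qed.

(** Re (1 / (k + 1/2 + i y)) is the value at the midpoint of [k, k + 1] of x / (x^2 + y^2), whose
    primitive is ln (x^2 + y^2) / 2. The increment of the primitive is a value of the same function
    at some [c] in the interval, so two of its values have to be compared. *)
Lemma midpoint_bound (y k : R) : 0 < y -> 0 <= k ->
  Rabs ((k + 1 / 2) / ((k + 1 / 2) ^ 2 + y ^ 2) - (ln ((k + 1) ^ 2 + y ^ 2) / 2 - ln (k ^ 2 + y ^ 2) / 2)) <= / (k ^ 2 + y ^ 2).
Proof.
  intros Hy Hk.
  destruct (MVT_gen (fun x => ln (x ^ 2 + y ^ 2) / 2) k (k + 1) (fun x => x / (x ^ 2 + y ^ 2))) as [c [Hc Ec]].
  - intros x Hx. auto_derive. { nra. } field. nra.
  - intros x Hx. apply derivable_continuous_pt, ex_derive_Reals_0. auto_derive. nra.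
  - rewrite Rmin_left, Rmax_right in Hc by lra. rewrite Ec.
    replace (c / (c ^ 2 + y ^ 2) * (k + 1 - k)) with (c / (c ^ 2 + y ^ 2)) by (field; nra).
    set (a := k + 1 / 2).
    assert (Y : 0 < y ^ 2) by nra.
    replace (a / (a ^ 2 + y ^ 2) - c / (c ^ 2 + y ^ 2)) with ((a - c) * ((y ^ 2 - a * c) / ((a ^ 2 + y ^ 2) * (c ^ 2 + y ^ 2)))) by (field; nra).
    rewrite Rabs_mult.
    assert (A : Rabs (a - c) <= 1) by (unfold a; apply Rabs_le; lra).
    assert (B : Rabs ((y ^ 2 - a * c) / ((a ^ 2 + y ^ 2) * (c ^ 2 + y ^ 2))) <= / (k ^ 2 + y ^ 2)).
    { assert (P1 : k ^ 2 + y ^ 2 <= a ^ 2 + y ^ 2) by (unfold a; nra).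
      assert (P2 : k ^ 2 + y ^ 2 <= c ^ 2 + y ^ 2) by nra.
      assert (P0 : 0 < k ^ 2 + y ^ 2) by nra.
      unfold Rdiv. rewrite Rabs_mult, (Rabs_pos_eq (/ _)) by (left; apply Rinv_0_lt_compat; nra).
      set (p := a ^ 2 + y ^ 2) in *. set (q := c ^ 2 + y ^ 2) in *. set (s := k ^ 2 + y ^ 2) in *.
      (* The difference is exact: [p * q = (y ^ 2 - a * c) ^ 2 + y ^ 2 * (a + c) ^ 2]. *)
      assert (Q : Rabs (y ^ 2 - a * c) ^ 2 <= p * q).
      { rewrite pow2_abs. unfold p, q.
        assert (0 <= y ^ 2 * (a + c) ^ 2) by (apply Rmult_le_pos; apply pow2_ge_0). nra. }
      assert (R0 : Rabs (y ^ 2 - a * c) * s <= p * q).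
      { apply Rsqr_incr_0_var; [|nra]. unfold Rsqr.
        set (d := Rabs (y ^ 2 - a * c)) in *. assert (s * s <= p * q) by nra.
        replace (d * s * (d * s)) with (d ^ 2 * (s * s)) by ring.
        apply Rmult_le_compat; try assumption; [apply pow2_ge_0|nra]. }
      apply Rmult_le_reg_r with (p * q); [nra|]. rewrite Rmult_assoc, Rinv_l, Rmult_1_r by nra.
      apply Rmult_le_reg_r with s; [exact P0|].
      replace (/ s * (p * q) * s) with (p * q) by (field; lra). exact R0. }
    assert (R1 := Rabs_pos (a - c)).
    assert (R2 := Rabs_pos ((y ^ 2 - a * c) / ((a ^ 2 + y ^ 2) * (c ^ 2 + y ^ 2)))). nra.
Qed.

(** The midpoint errors are summed. Since [(y + k) ^ 2 <= 2 * (k ^ 2 + y ^ 2)], each is at most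
    twice the increment [/ (y + k - 1) - / (y + k)], so the bound telescopes and stays below
    [2 / (y - 1)] for all [n]. *)
Lemma Re_harmonic_shift_half_line (y : R) (n : nat) : 2 <= y ->
  Rabs (Re (harmonic_shift n (1 / 2, y)) - (ln (INR (S n) ^ 2 + y ^ 2) / 2 - ln y)) <= 2 * (/ (y - 1) - / (y + INR n)).
Proof.
  intros Hy.
  assert (Q : forall k, 0 <= k -> / (k ^ 2 + y ^ 2) <= 2 * (/ (y + k - 1) - / (y + k))).
  { intros k Hk. replace (/ (y + k - 1) - / (y + k)) with (/ ((y + k - 1) * (y + k))) by (field; lra).
    apply Rle_trans with (/ ((y + k - 1) * (y + k) / 2)).
    - assert (0 < (y + k - 1) * (y + k)) by (apply Rmult_lt_0_compat; lra).
      apply Rinv_le_contravar; [lra|]. assert (0 <= (y - k) ^ 2) by apply pow2_ge_0. nra.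
    - right. field. lra. }
  assert (RI : forall k, 0 <= k -> Re (/ ((1 / 2, y) + RtoC k)) = (k + 1 / 2) / ((k + 1 / 2) ^ 2 + y ^ 2)).
  { intros k Hk. unfold Re, Cinv, Cplus, RtoC; simpl. field. nra. }
  induction n as [|n IH].
  - assert (E := midpoint_bound y 0 ltac:(lra) (Rle_refl 0)). assert (E2 := Q 0 (Rle_refl 0)).
    specialize (RI 0 (Rle_refl 0)). rewrite Cplus_0_r in RI.
    cbn [harmonic_shift]. rewrite RI.
    replace (INR 1) with (0 + 1) by (simpl; ring).
    replace (ln y) with (ln (0 ^ 2 + y ^ 2) / 2).
    2: { replace (0 ^ 2 + y ^ 2) with (y * y) by ring. rewrite ln_mult by lra. field. }
    apply Rle_trans with (1 := E). replace (y - 1) with (y + 0 - 1) by ring. exact E2.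
  - cbn [harmonic_shift]. set (k := INR (S n)) in *. assert (Hk : 0 <= k) by apply pos_INR.
    assert (E := midpoint_bound y k ltac:(lra) Hk). assert (E2 := Q k Hk).
    replace (Re (harmonic_shift n (1 / 2, y) + / ((1 / 2, y) + RtoC k))) with (Re (harmonic_shift n (1 / 2, y)) + Re (/ ((1 / 2, y) + RtoC k))) by reflexivity.
    rewrite RI by exact Hk. rewrite (S_INR (S n)). fold k.
    replace (y + k - 1) with (y + INR n) in E2 by (unfold k; rewrite S_INR; ring).
    revert IH E. unfold Rabs. repeat destruct Rcase_abs; lra.
Qed.

Lemma Re_digamma_half_line (y : R) : 2 <= y -> Rabs (Re (digamma (1 / 2, y)) - ln y) <= 2 / (y - 1).
Proof.
  intros Hy.
  assert (H := Clim_Re (F := eventually) _ _ (digamma_lim (1 / 2, y) ltac:(simpl; lra))).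
  apply (is_lim_seq_le_loc (fun n => Rabs (Re (RtoC (ln (INR n)) - harmonic_shift n (1 / 2, y)) - ln y))
     (fun n => 2 / (y - 1) + ((3 + y ^ 2) / 2) / INR n)
     (Rabs (Re (digamma (1 / 2, y)) - ln y)) (2 / (y - 1))).
  - exists 1%nat. intros n Hn. assert (HN : 1 <= INR n) by (apply (le_INR 1); lia).
    assert (A := Re_harmonic_shift_half_line y n Hy).
    replace (Re (RtoC (ln (INR n)) - harmonic_shift n (1 / 2, y))) with (ln (INR n) - Re (harmonic_shift n (1 / 2, y))) by reflexivity.
    assert (B : 0 < / (y + INR n)) by (apply Rinv_0_lt_compat; lra).
    rewrite S_INR in A. set (N := INR n) in *.
    (* The two logarithmic normalizations agree in the limit for fixed [y]; the numerator comes from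
       [2 * N + 1 + y ^ 2 <= (3 + y ^ 2) * N] for [N >= 1]. *)
    assert (D : 0 <= ln ((N + 1) ^ 2 + y ^ 2) / 2 - ln N <= (3 + y ^ 2) / 2 / N).
    { replace (ln ((N + 1) ^ 2 + y ^ 2) / 2 - ln N) with (ln (((N + 1) ^ 2 + y ^ 2) / (N * N)) / 2).
      2: { rewrite ln_div, ln_mult by nra. field. }
      assert (R1 : 1 <= ((N + 1) ^ 2 + y ^ 2) / (N * N)). { apply Rle_div_r; nra. }
      split.
      - assert (0 <= ln (((N + 1) ^ 2 + y ^ 2) / (N * N))); [|lra]. rewrite <- ln_1. apply ln_le; lra.
      - assert (X := exp_ineq1_le (ln (((N + 1) ^ 2 + y ^ 2) / (N * N)))). rewrite exp_ln in X by lra.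
        assert (Y : ((N + 1) ^ 2 + y ^ 2) / (N * N) - 1 <= (3 + y ^ 2) / N); [|unfold Rdiv in *; lra].
        replace (((N + 1) ^ 2 + y ^ 2) / (N * N) - 1) with ((2 * N + 1 + y ^ 2) / (N * N)) by (field; lra).
        replace ((3 + y ^ 2) / N) with ((3 + y ^ 2) * N / (N * N)) by (field; lra).
        apply Rmult_le_compat_r; [left; apply Rinv_0_lt_compat; nra|]. nra. }
    unfold Rdiv in *. revert A. unfold Rabs. repeat destruct Rcase_abs; lra.
  - apply (is_lim_seq_abs _ (Finite (Re (digamma (1 / 2, y)) - ln y))).
    apply is_lim_seq_minus'; [exact H|apply is_lim_seq_const].
  - replace (Finite (2 / (y - 1))) with (Finite (2 / (y - 1) + 0)) by now rewrite Rplus_0_r.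
    apply is_lim_seq_plus'; [apply is_lim_seq_const|apply is_lim_seq_div_n].
Qed.

(** * The hyperbolic kernel *)

Definition sinhc (t : R) : R := if Req_EM_T t 0 then 1 else sinh t / t.

Lemma cosh_exp (t : R) : cosh t = (exp t + exp (- t)) / 2.
Proof. reflexivity. Qed.

Lemma cosh_ge_1 (t : R) : 1 <= cosh t.
Proof.
  rewrite cosh_exp. assert (A := exp_ineq1_le t). assert (B := exp_ineq1_le (- t)). lra.
Qed.

Lemma cosh_opp (t : R) : cosh (- t) = cosh t.
Proof. rewrite !cosh_exp, Ropp_involutive. lra. Qed.

Lemma cosh_Rabs (t : R) : cosh (Rabs t) = cosh t.
Proof. unfold Rabs. destruct Rcase_abs; [apply cosh_opp|reflexivity]. Qed.

Lemma cosh_le (s t : R) : 0 <= s <= t -> cosh s <= cosh t.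
Proof.
  intros H. rewrite !cosh_exp.
  assert (A : exp s <= exp t) by (apply exp_le_compat; lra).
  assert (B : 1 <= exp s) by (rewrite <- exp_0; apply exp_le_compat; lra).
  rewrite !exp_Ropp.
  assert (D : / exp s - / exp t = (exp t - exp s) / (exp s * exp t)) by (field; split; apply Rgt_not_eq, exp_pos).
  assert (F : (exp t - exp s) / (exp s * exp t) <= exp t - exp s).
  { apply Rle_div_l; [nra|]. assert (1 <= exp s * exp t) by nra. nra. }
  lra.
Qed.

Lemma cosh_ge_half_exp (t : R) : exp t / 2 <= cosh t.
Proof. rewrite cosh_exp. generalize (exp_pos (- t)); lra. Qed.

Lemma inv_cosh_le (t : R) : / cosh t <= 2 * exp (- t).
Proof.
  rewrite exp_Ropp. apply Rle_trans with (/ (exp t / 2)).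
  - apply Rinv_le_contravar; [generalize (exp_pos t); lra|apply cosh_ge_half_exp].
  - right. field. apply Rgt_not_eq, exp_pos.
Qed.

(** The mean value theorem writes [sinh t / t] as [cosh c] with [Rabs c <= Rabs t]. As [cosh 0 = 1],
    the two bounds also squeeze [sinhc] at 0 and give its continuity there. *)
Lemma sinhc_bounds (t : R) : 1 <= sinhc t <= cosh t.
Proof.
  unfold sinhc. destruct Req_EM_T as [->|H].
  - generalize (cosh_ge_1 0); lra.
  - destruct (MVT_gen sinh 0 t cosh) as [c [Hc Ec]].
    + intros x _. apply is_derive_Reals, derivable_pt_lim_sinh.
    + intros x _. apply derivable_continuous_pt, derivable_pt_sinh.
    + rewrite sinh_0 in Ec. replace (sinh t / t) with (cosh c).
      2: { field_simplify_eq; [lra|exact H]. }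
      split; [apply cosh_ge_1|]. rewrite <- (cosh_Rabs c), <- (cosh_Rabs t). apply cosh_le.
      split; [apply Rabs_pos|]. revert Hc. unfold Rmin, Rmax, Rabs.
      destruct Rle_dec; repeat destruct Rcase_abs; lra.
Qed.

Lemma continuous_cosh (t : R) : continuous cosh t.
Proof.
  apply (ex_derive_continuous (V := R_NormedModule)). exists (sinh t).
  apply is_derive_Reals, derivable_pt_lim_cosh.
Qed.

Lemma continuous_sinhc (t : R) : continuous sinhc t.
Proof.
  destruct (Req_EM_T t 0) as [->|H].
  - assert (E : sinhc 0 = 1) by (unfold sinhc; destruct Req_EM_T; lra).
    unfold continuous. rewrite E.
    apply (filterlim_le_le (F := locally 0) (fun _ => 1) sinhc cosh (Finite 1)).
    + apply filter_forall. apply sinhc_bounds.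
    + apply filterlim_const.
    + assert (X := continuous_cosh 0). unfold continuous in X. rewrite cosh_0 in X. exact X.
  - apply (continuous_ext_loc _ (fun t => sinh t / t)).
    + assert (Hp : 0 < Rabs t) by now apply Rabs_pos_lt.
      exists (mkposreal _ Hp). intros y Hy. unfold sinhc. destruct Req_EM_T as [->|H1]; [|reflexivity].
      exfalso. apply ball_Rabs in Hy; simpl in Hy.
      rewrite Rminus_0_l, Rabs_Ropp in Hy. lra.
    + apply (continuous_mult (K := R_AbsRing)).
      * apply (ex_derive_continuous (V := R_NormedModule)). exists (cosh t).
        apply is_derive_Reals, derivable_pt_lim_sinh.
      * apply continuous_Rinv, H.
Qed.

(** * The exponential and the cosine of 2 pi w, and the kernel built from them *)

Definition cexp2pi (w : C) : C := Cexp (RtoC (2 * PI) * Ci * w).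
(* [ccos2pi w = cos (2 pi w)]. *)
Definition ccos2pi (w : C) : C := ((cexp2pi w + / cexp2pi w) / 2)%C.

Lemma cexp2pi_neq_0 (w : C) : cexp2pi w <> 0%C.
Proof. apply Cexp_neq_0. Qed.

Lemma C2_neq_0 : RtoC 2 <> 0%C.
Proof. intro E; apply RtoC_inj in E; lra. Qed.

Lemma cexp2pi_plus (v w : C) : cexp2pi (v + w) = (cexp2pi v * cexp2pi w)%C.
Proof. unfold cexp2pi. rewrite <- Cexp_plus. f_equal. ring. Qed.

Lemma cexp2pi_1 : cexp2pi 1 = 1%C.
Proof.
  unfold cexp2pi, Cexp, Ci, Cmult, RtoC, Re, Im; simpl.
  replace ((2 * PI * 0 - 0 * 1) * 1 - (2 * PI * 1 + 0 * 0) * 0) with 0 by ring.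
  replace ((2 * PI * 0 - 0 * 1) * 0 + (2 * PI * 1 + 0 * 0) * 1) with (2 * PI) by ring.
  rewrite exp_0, cos_2PI, sin_2PI. f_equal; ring.
Qed.

Lemma cexp2pi_half_1 : cexp2pi (1 / 2) = (- (1))%C.
Proof.
  unfold cexp2pi. replace (RtoC (2 * PI) * Ci * (1 / 2))%C with (RtoC PI * Ci)%C.
  2: { rewrite RtoC_mult. field; exact C2_neq_0. }
  unfold Cexp, Ci, Cmult, RtoC, Copp, Re, Im; simpl.
  replace (PI * 0 - 0 * 1) with 0 by ring. replace (PI * 1 + 0 * 0) with PI by ring.
  rewrite exp_0, cos_PI, sin_PI. f_equal; ring.
Qed.

Lemma cexp2pi_opp (w : C) : cexp2pi (- w) = (/ cexp2pi w)%C.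
Proof. unfold cexp2pi. rewrite <- Cexp_opp. f_equal. ring. Qed.

Lemma cexp2pi_sym (w : C) : cexp2pi (1 - w) = (/ cexp2pi w)%C.
Proof. unfold Cminus. rewrite cexp2pi_plus, cexp2pi_1, cexp2pi_opp. ring. Qed.

Lemma cexp2pi_half_sq (w : C) : cexp2pi w = (cexp2pi (w / 2) * cexp2pi (w / 2))%C.
Proof. rewrite <- cexp2pi_plus. f_equal. field; exact C2_neq_0. Qed.

Lemma cexp2pi_half_shift (w : C) : cexp2pi ((w + 1) / 2) = (- cexp2pi (w / 2))%C.
Proof.
  replace ((w + 1) / 2)%C with (w / 2 + 1 / 2)%C by (field; exact C2_neq_0).
  rewrite cexp2pi_plus, cexp2pi_half_1. ring.
Qed.

Lemma ccos2pi_sym (w : C) : ccos2pi (1 - w) = ccos2pi w.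
Proof. unfold ccos2pi. rewrite cexp2pi_sym. field; try split; first [apply cexp2pi_neq_0|exact C2_neq_0]. Qed.

Lemma ccos2pi_half (w : C) : ccos2pi w = (2 * ccos2pi (w / 2) * ccos2pi (w / 2) - 1)%C.
Proof.
  unfold ccos2pi. rewrite (cexp2pi_half_sq w). field; try split; first [apply cexp2pi_neq_0|exact C2_neq_0].
Qed.

Lemma ccos2pi_half_shift (w : C) : ccos2pi ((w + 1) / 2) = (- ccos2pi (w / 2))%C.
Proof.
  unfold ccos2pi. rewrite cexp2pi_half_shift. field.
  apply cexp2pi_neq_0.
Qed.

Lemma cexp2pi_pair (x y : R) :
  cexp2pi (x, y) = (exp (- (2 * PI * y)) * cos (2 * PI * x), exp (- (2 * PI * y)) * sin (2 * PI * x)).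
Proof.
  unfold cexp2pi, Cexp, Ci, Cmult, RtoC, Re, Im; simpl.
  f_equal; f_equal; f_equal; ring.
Qed.

Lemma ccos2pi_pair (x y : R) :
  ccos2pi (x, y) = (cos (2 * PI * x) * cosh (2 * PI * y), - (sin (2 * PI * x) * sinh (2 * PI * y))).
Proof.
  unfold ccos2pi. rewrite <- cexp2pi_opp. change (- (x, y))%C with (- x, - y). rewrite !cexp2pi_pair.
  replace (2 * PI * - x) with (- (2 * PI * x)) by ring.
  replace (- (2 * PI * - y)) with (2 * PI * y) by ring. rewrite cos_neg, sin_neg.
  unfold Cplus, Cdiv, Cmult, Cinv, RtoC; simpl. unfold cosh, sinh. f_equal; field.
Qed.

(** With T = cosh t, B = cosh (2 pi y) and s = sin^2 (pi x), the squared modulus equals (T - B)^2 +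
    4 s T B - 4 s (1 - s). Since T B >= 1, this is at least (T - B)^2 + 4 s^2 T B >= s^2 (T + B)^2.
    The bound does not depend on Im w. *)
Lemma kernel_den_bound (t : R) (w : C) :
  sin (PI * Re w) ^ 2 * cosh t <= Cmod (RtoC (cosh t) - ccos2pi w).
Proof.
  destruct w as [x y]. rewrite ccos2pi_pair. unfold Re; simpl fst.
  set (T := cosh t). set (B := cosh (2 * PI * y)). set (S := sinh (2 * PI * y)).
  set (s := sin (PI * x) ^ 2).
  assert (HT : 1 <= T) by apply cosh_ge_1. assert (HB : 1 <= B) by apply cosh_ge_1.
  assert (HBS : B * B - S * S = 1).
  { unfold B, S, cosh, sinh. assert (E : exp (2 * PI * y) * exp (- (2 * PI * y)) = 1) by (rewrite <- exp_plus, Rplus_opp_r; apply exp_0). nra. }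
  assert (Ec : cos (2 * PI * x) = 1 - 2 * s).
  { replace (2 * PI * x) with (2 * (PI * x)) by ring. rewrite cos_2a_sin. unfold s; ring. }
  assert (Es := sin2_cos2 (2 * PI * x)). unfold Rsqr in Es.
  assert (Hs : 0 <= s <= 1).
  { unfold s. assert (X := sin2_cos2 (PI * x)). unfold Rsqr in X. nra. }
  unfold Cmod. simpl. rewrite <- (sqrt_Rsqr (s * T)) by nra. apply sqrt_le_1_alt. unfold Rsqr.
  set (c := cos (2 * PI * x)) in *. set (n := sin (2 * PI * x)) in *.
  replace ((T + - (c * B)) * ((T + - (c * B)) * 1) + (0 + - - (n * S)) * ((0 + - - (n * S)) * 1))
   with ((T - c * B) * (T - c * B) + (n * n) * (S * S)) by ring.
  replace (n * n) with (1 - c * c) by lra. replace (S * S) with (B * B - 1) by lra. rewrite Ec.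
  assert (E : (T - (1 - 2 * s) * B) * (T - (1 - 2 * s) * B) + (1 - (1 - 2 * s) * (1 - 2 * s)) * (B * B - 1)
    = (T - B) * (T - B) + 4 * s * (T * B) - 4 * s * (1 - s)) by ring.
  rewrite E. assert (1 <= T * B) by nra.
  assert (4 * s * (1 - s) <= 4 * s * (1 - s) * (T * B)).
  { rewrite <- (Rmult_1_r (4 * s * (1 - s))) at 1.
    apply Rmult_le_compat_l; [apply Rmult_le_pos; lra|assumption]. }
  assert (s * s * ((T - B) * (T - B) + 4 * (T * B)) <= (T - B) * (T - B) + 4 * s * s * (T * B)).
  { assert (0 <= (T - B) * (T - B)) by apply Rle_0_sqr.
    assert (s * s <= 1 * 1) by (apply Rmult_le_compat; lra).
    assert (s * s * ((T - B) * (T - B)) <= 1 * 1 * ((T - B) * (T - B))) by now apply Rmult_le_compat_r. lra. }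
  assert (s * s * (T * T) <= s * s * ((T - B) * (T - B) + 4 * (T * B))).
  { apply Rmult_le_compat_l; [apply Rle_0_sqr|]. assert (0 <= B * B) by apply Rle_0_sqr. lra. }
  lra.
Qed.

(* [K(t) / t], with the removable singularity at [t = 0] filled in by [sinhc]. *)
Definition kernel (w : C) (t : R) : C := (RtoC (sinhc t) / (RtoC (cosh t) - ccos2pi w))%C.

Definition strip (w : C) := 0 < Re w < 1.

Lemma sin_strip (w : C) : strip w -> 0 < sin (PI * Re w) ^ 2.
Proof.
  intros Hw. apply pow_lt, sin_gt_0; generalize PI_RGT_0; unfold strip in Hw; nra.
Qed.

Lemma kernel_den_neq_0 (t : R) (w : C) : strip w -> (RtoC (cosh t) - ccos2pi w)%C <> 0%C.
Proof.
  intros Hw E. assert (H := kernel_den_bound t w). rewrite E, Cmod_0 in H.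
  assert (S := sin_strip w Hw). assert (T := cosh_ge_1 t). nra.
Qed.

Lemma continuous_kernel (w : C) (t : R) : strip w -> continuous (kernel w) t.
Proof.
  intros Hw. apply continuous_Cdiv.
  - apply continuous_RtoC, continuous_sinhc.
  - apply continuous_Cminus; [apply continuous_RtoC, continuous_cosh|apply continuous_Cconst].
  - now apply kernel_den_neq_0.
Qed.

Definition kernel_int (w : C) (T : R) : C := CRInt (kernel w) 0 T.

Lemma ex_CRInt_kernel (w : C) (a b : R) : strip w -> ex_CRInt (kernel w) a b.
Proof.
  intros Hw. apply (ex_RInt_continuous (V := C_R_CompleteNormedModule)).
  intros; now apply continuous_kernel.
Qed.

Lemma is_RInt_exp_opp (a b : R) : is_RInt (fun t => exp (- t)) a b (exp (- a) - exp (- b)).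
Proof.
  replace (exp (- a) - exp (- b)) with (minus (- exp (- b)) (- exp (- a))).
  2: { unfold minus, plus, opp; simpl; ring. }
  apply (is_RInt_derive (V := R_CompleteNormedModule) (fun t => - exp (- t))).
  - intros x _. auto_derive; trivial. ring.
  - intros x _. apply (ex_derive_continuous (V := R_NormedModule)). now auto_derive.
Qed.

(** Because cosh t - sinh t = exp (- t), the difference K(t) / t - 1 / t has numerator cos (2 pi w)
    - exp (- t) over t (cosh t - cos (2 pi w)), and so decays exponentially. The lower bound [s] for
    the denominator is a parameter: the value from [kernel_den_bound] degenerates at the ends of the
    strip, where another one is supplied. *)
Lemma kernel_tail (w : C) (s a b : R) : strip w -> 0 < s -> 0 < a -> a <= b ->
  (forall t, a <= t -> s * cosh t <= Cmod (RtoC (cosh t) - ccos2pi w)) ->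
  Cmod (kernel_int w b - RtoC (ln b) - (kernel_int w a - RtoC (ln a))) <= 2 * (Cmod (ccos2pi w) + 1) / (s * a) * exp (- a).
Proof.
  intros Hw Hs Ha Hab Hden.
  assert (Hi : is_CRInt (fun t => kernel w t - RtoC (/ t))%C a b (kernel_int w b - RtoC (ln b) - (kernel_int w a - RtoC (ln a)))%C).
  { replace (kernel_int w b - RtoC (ln b) - (kernel_int w a - RtoC (ln a)))%C with (CRInt (kernel w) a b - RtoC (ln b - ln a))%C.
    - apply is_CRInt_minus; [apply is_CRInt_CRInt; now apply ex_CRInt_kernel|].
      apply is_CRInt_RtoC. apply (is_RInt_derive (V := R_CompleteNormedModule) ln);
      rewrite Rmin_left, Rmax_right by assumption; intros x Hx.
      + auto_derive; [lra|ring].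
      + apply continuous_Rinv; lra.
    - assert (H := RInt_Chasles (V := C_R_CompleteNormedModule) (kernel w) 0 a b (ex_CRInt_kernel w 0 a Hw) (ex_CRInt_kernel w a b Hw)).
      unfold kernel_int. rewrite <- H. unfold plus; simpl. rewrite RtoC_minus.
      change (CRInt (kernel w) a b - (RtoC (ln b) - RtoC (ln a)) = CRInt (kernel w) 0 a + CRInt (kernel w) a b - RtoC (ln b) - (CRInt (kernel w) 0 a - RtoC (ln a)))%C. ring. }
  set (M := 2 * (Cmod (ccos2pi w) + 1) / (s * a)).
  assert (HM : 0 <= M).
  { unfold M. apply Rlt_le, Rdiv_lt_0_compat; [generalize (Cmod_ge_0 (ccos2pi w)); lra|now apply Rmult_lt_0_compat]. }
  apply Rle_trans with (M * (exp (- a) - exp (- b))).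
  2: { apply Rmult_le_compat_l; [exact HM|]. generalize (exp_pos (- b)); lra. }
  refine (Cmod_is_CRInt_le _ (fun t => M * exp (- t)) a b _ _ Hab _ Hi _).
  2: { apply (is_RInt_scal (V := R_NormedModule)), is_RInt_exp_opp. }
  intros t Ht. assert (Ht0 : RtoC t <> 0%C) by (apply RtoC_neq_0; lra).
  assert (N := kernel_den_neq_0 t w Hw).
  assert (E : (kernel w t - RtoC (/ t))%C = ((ccos2pi w - RtoC (exp (- t))) / (RtoC t * (RtoC (cosh t) - ccos2pi w)))%C).
  { unfold kernel, sinhc. destruct Req_EM_T; [lra|].
    unfold Rdiv. rewrite RtoC_mult, !RtoC_inv by lra.
    replace (RtoC (sinh t)) with (RtoC (cosh t) - RtoC (exp (- t)))%C.
    2: { rewrite <- RtoC_minus. f_equal. unfold cosh, sinh. field. }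
    field. now split. }
  rewrite E, Cmod_div by now apply Cmult_neq_0. rewrite Cmod_mult, Cmod_R, Rabs_pos_eq by lra.
  assert (D := Hden t (proj1 Ht)). assert (C1 := cosh_ge_1 t).
  assert (A : Cmod (ccos2pi w - RtoC (exp (- t))) <= Cmod (ccos2pi w) + 1).
  { apply Rle_trans with (1 := Cmod_triangle _ _).
    rewrite Cmod_opp, Cmod_R, Rabs_pos_eq by (left; apply exp_pos).
    apply Rplus_le_compat_l. rewrite <- exp_0. apply exp_le_compat. lra. }
  assert (I := inv_cosh_le t).
  apply Rle_trans with ((Cmod (ccos2pi w) + 1) * (/ (s * a) * / cosh t)).
  - apply Rmult_le_compat; [apply Cmod_ge_0| |exact A|].
    + left. apply Rinv_0_lt_compat. apply Rmult_lt_0_compat; [lra|]. now apply Cmod_gt_0.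
    + rewrite <- Rinv_mult. apply Rinv_le_contravar.
      * apply Rmult_lt_0_compat; [apply Rmult_lt_0_compat; lra|lra].
      * replace (s * a * cosh t) with (a * (s * cosh t)) by ring.
        assert (0 < s * cosh t) by (apply Rmult_lt_0_compat; lra). apply Rmult_le_compat; lra.
  - unfold M, Rdiv. assert (P : 0 <= (Cmod (ccos2pi w) + 1) * / (s * a)).
    { apply Rmult_le_pos; [generalize (Cmod_ge_0 (ccos2pi w)); lra|].
      left; apply Rinv_0_lt_compat, Rmult_lt_0_compat; lra. }
    nra.
Qed.

Lemma ex_J (w : C) : strip w -> exists l, Clim (Rbar_locally p_infty) (fun T => kernel_int w T - RtoC (ln T))%C l.
Proof.
  intros Hw. apply Clim_cauchy. intros eps He.
  set (s := sin (PI * Re w) ^ 2). assert (Hs : 0 < s) by now apply sin_strip.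
  set (M := 2 * (Cmod (ccos2pi w) + 1) / s).
  assert (HM : 0 < M). { apply Rdiv_lt_0_compat; [generalize (Cmod_ge_0 (ccos2pi w)); lra|exact Hs]. }
  exists (fun T => Rmax 1 (ln (M / eps)) < T). split.
  { exists (Rmax 1 (ln (M / eps))). auto. }
  assert (W : forall a b, Rmax 1 (ln (M / eps)) < a -> a <= b ->
    Cmod (kernel_int w b - RtoC (ln b) - (kernel_int w a - RtoC (ln a))) < eps).
  { intros a b Ha Hab. assert (A1 := Rle_lt_trans _ _ _ (Rmax_l _ _) Ha).
    assert (A2 := Rle_lt_trans _ _ _ (Rmax_r _ _) Ha).
    apply Rle_lt_trans with (1 := kernel_tail w s a b Hw Hs ltac:(lra) Hab (fun t _ => kernel_den_bound t w)).
    apply Rle_lt_trans with (M * exp (- a)).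
    - apply Rmult_le_compat_r; [left; apply exp_pos|]. unfold M, Rdiv.
      apply Rmult_le_compat_l; [generalize (Cmod_ge_0 (ccos2pi w)); lra|]. apply Rinv_le_contravar; nra.
    - assert (E : M / eps < exp a).
      { rewrite <- (exp_ln (M / eps)) by now apply Rdiv_lt_0_compat. now apply exp_increasing. }
      rewrite exp_Ropp. apply Rlt_div_l; [apply exp_pos|]. apply Rlt_div_l in E; lra. }
  intros u v Hu Hv. destruct (Rle_dec u v).
  - replace (kernel_int w u - RtoC (ln u) - (kernel_int w v - RtoC (ln v)))%C with (- (kernel_int w v - RtoC (ln v) - (kernel_int w u - RtoC (ln u))))%C by ring.
    rewrite Cmod_opp. now apply W.
  - apply W; [exact Hv|lra].
Qed.

Definition J (w : C) : C :=
  epsilon (inhabits (RtoC 0)) (fun l => Clim (Rbar_locally p_infty) (fun T => kernel_int w T - RtoC (ln T))%C l).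

Lemma J_lim (w : C) : strip w -> Clim (Rbar_locally p_infty) (fun T => kernel_int w T - RtoC (ln T))%C (J w).
Proof. intros Hw. unfold J. apply epsilon_spec. now apply ex_J. Qed.

(** * Duplication and Lipschitz estimates *)

Lemma strip_half (w : C) : strip w -> strip (w / 2).
Proof. unfold strip. rewrite Re_half. lra. Qed.

Lemma strip_half_1 (w : C) : strip w -> strip ((w + 1) / 2).
Proof. unfold strip. rewrite Re_half_1. lra. Qed.

Lemma strip_sym (w : C) : strip w -> strip (1 - w).
Proof. unfold strip. replace (Re (1 - w)) with (1 - Re w) by reflexivity. lra. Qed.

(** Partial fractions: with C = cosh s and c = cos (pi w), the denominator at [2 * s] is 2 (C - c)
    (C + c), and passing from [w / 2] to [(w + 1) / 2] changes the sign of c. *)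
Lemma kernel_duplication (w : C) (s : R) : strip w -> s <> 0 ->
  (2 * kernel w (2 * s) = (kernel (w / 2) s + kernel ((w + 1) / 2) s) / 2)%C.
Proof.
  intros Hw Hs.
  assert (N1 := kernel_den_neq_0 (2 * s) w Hw).
  assert (N2 := kernel_den_neq_0 s _ (strip_half w Hw)).
  assert (N3 := kernel_den_neq_0 s _ (strip_half_1 w Hw)).
  unfold kernel. rewrite ccos2pi_half_shift in *. rewrite (ccos2pi_half w) in *.
  set (c := ccos2pi (w / 2)) in *.
  assert (E1 : RtoC (cosh (2 * s)) = (2 * (RtoC (cosh s) * RtoC (cosh s)) - 1)%C).
  { rewrite <- !RtoC_mult, <- RtoC_minus. f_equal. unfold cosh.
    replace (2 * s) with (s + s) by ring. replace (- (s + s)) with (- s + - s) by ring. rewrite !exp_plus.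
    assert (E : exp s * exp (- s) = 1) by (rewrite <- exp_plus, Rplus_opp_r; apply exp_0).
    field_simplify. replace (exp s * exp (-s)) with 1 by lra. nra. }
  assert (E2 : RtoC (sinhc (2 * s)) = (RtoC (sinhc s) * RtoC (cosh s))%C).
  { rewrite <- !RtoC_mult. f_equal. unfold sinhc. destruct Req_EM_T; [lra|]. destruct Req_EM_T; [lra|].
    unfold cosh, sinh. replace (2 * s) with (s + s) by ring. replace (- (s + s)) with (- s + - s) by ring.
    rewrite !exp_plus.
    field. split; lra. }
  rewrite E1 in *. rewrite E2. field.
  repeat split; try assumption.
Qed.

Lemma kernel_int_duplication (w : C) (T : R) : strip w -> 0 < T ->
  kernel_int w T = ((kernel_int (w / 2) (T / 2) + kernel_int ((w + 1) / 2) (T / 2)) / 2)%C.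
Proof.
  intros Hw HT.
  assert (H := is_RInt_comp_lin (V := C_R_NormedModule) (kernel w) 2 0 0 (T / 2) (kernel_int w T)).
  replace (2 * 0 + 0) with 0 in H by ring. replace (2 * (T / 2) + 0) with T in H by field.
  specialize (H (is_CRInt_CRInt _ _ _ (ex_CRInt_kernel w 0 T Hw))).
  symmetry.
  assert (H2 : is_CRInt (fun s => scal 2 (kernel w (2 * s + 0) : C_R_NormedModule)) 0 (T / 2)
     ((kernel_int (w / 2) (T / 2) + kernel_int ((w + 1) / 2) (T / 2)) / 2)%C).
  2: { apply CRInt_unique in H. apply CRInt_unique in H2. now rewrite <- H, <- H2. }
  unfold Cdiv. rewrite Cmult_comm.
  assert (H3 := is_CRInt_mult (/ 2) _ _ _ _ (is_CRInt_plus _ _ _ _ _ _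
     (is_CRInt_CRInt _ _ _ (ex_CRInt_kernel (w / 2) 0 (T / 2) (strip_half w Hw)))
     (is_CRInt_CRInt _ _ _ (ex_CRInt_kernel ((w + 1) / 2) 0 (T / 2) (strip_half_1 w Hw))))).
  revert H3. apply is_RInt_ext. intros s Hs. rewrite Rmin_left in Hs by lra.
  assert (E := kernel_duplication w s Hw ltac:(lra)).
  rewrite Rplus_0_r.
  replace (scal 2 (kernel w (2 * s) : C_R_NormedModule)) with (2 * kernel w (2 * s))%C.
  - rewrite E. apply Cmult_comm.
  - destruct (kernel w (2 * s)) as [a b]. unfold scal; simpl. unfold prod_scal, scal; simpl.
    unfold mult, Cmult, RtoC; simpl.
    f_equal; ring.
Qed.

Lemma filterlim_half_p : filterlim (fun T => T / 2) (Rbar_locally p_infty) (Rbar_locally p_infty).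
Proof.
  intros P [M HM]. exists (2 * M). intros x Hx. apply HM. lra.
Qed.

(** The substitution t = 2 s halves the cut-off, and ln T = ln (T / 2) + ln 2. The resulting
    [- ln 2] cancels the [ln 2] of [digamma_duplication]. *)
Lemma J_duplication (w : C) : strip w -> J w = ((J (w / 2) + J ((w + 1) / 2)) / 2 - RtoC (ln 2))%C.
Proof.
  intros Hw.
  assert (H1 := Clim_comp _ _ _ _ _ filterlim_half_p (J_lim _ (strip_half w Hw))).
  assert (H2 := Clim_comp _ _ _ _ _ filterlim_half_p (J_lim _ (strip_half_1 w Hw))).
  refine (Clim_unique (F := Rbar_locally p_infty) _ _ _ (J_lim w Hw) _).
  refine (Clim_ext_loc _ _ _ _ (Clim_minus (F := Rbar_locally p_infty) _ _ _ _ (Clim_mult _ _ _ _ (Clim_plus _ _ _ _ H1 H2) (Clim_const (/ 2)%C)) (Clim_const (RtoC (ln 2))))).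
  exists 0. intros T HT. rewrite (kernel_int_duplication w T Hw HT).
  unfold Rdiv. rewrite (ln_mult T (/ 2)), ln_Rinv, RtoC_plus, RtoC_opp by lra. field.
Qed.

Lemma J_sym (w : C) : J (1 - w) = J w.
Proof. unfold J, kernel_int, kernel. now rewrite ccos2pi_sym. Qed.

Lemma Re_cexp2pi_exponent (w : C) : Re (RtoC (2 * PI) * Ci * w) = - (2 * PI * Im w).
Proof. unfold Re, Im, Ci, Cmult, RtoC; simpl. ring. Qed.

Lemma cexp2pi_lipschitz (Y : R) (w v : C) : Rabs (Im w) <= Y -> Rabs (Im v) <= Y ->
  Cmod (cexp2pi w - cexp2pi v) <= exp (2 * PI * Y) * (2 * PI) * Cmod (w - v).
Proof.
  intros Hw Hv. assert (P := PI_RGT_0).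
  assert (B : forall u, Rabs (Im u) <= Y -> Re (RtoC (2 * PI) * Ci * u) <= 2 * PI * Y).
  { intros u Hu. rewrite Re_cexp2pi_exponent. assert (A := Rle_abs (- Im u)). rewrite Rabs_Ropp in A. nra. }
  unfold cexp2pi. apply Rle_trans with (1 := Cexp_lipschitz _ _ _ (B w Hw) (B v Hv)).
  replace (RtoC (2 * PI) * Ci * w - RtoC (2 * PI) * Ci * v)%C with (RtoC (2 * PI) * Ci * (w - v))%C by ring.
  rewrite !Cmod_mult, Cmod_R, Rabs_pos_eq by lra.
  rewrite Cmod_Ci.
  right. ring.
Qed.

Lemma ccos2pi_lipschitz (Y : R) (w v : C) : Rabs (Im w) <= Y -> Rabs (Im v) <= Y ->
  Cmod (ccos2pi w - ccos2pi v) <= exp (2 * PI * Y) * (2 * PI) * Cmod (w - v).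
Proof.
  intros Hw Hv. unfold ccos2pi. rewrite <- !cexp2pi_opp.
  replace ((cexp2pi w + cexp2pi (- w)) / 2 - (cexp2pi v + cexp2pi (- v)) / 2)%C with ((cexp2pi w - cexp2pi v + (cexp2pi (- w) - cexp2pi (- v))) * RtoC (/ 2))%C by (rewrite RtoC_inv by lra; field).
  rewrite Cmod_mult, Cmod_R, Rabs_pos_eq by lra.
  assert (A := cexp2pi_lipschitz Y w v Hw Hv).
  assert (B := cexp2pi_lipschitz Y (- w) (- v)).
  replace (- w - - v)%C with (- (w - v))%C in B by ring. rewrite Cmod_opp in B.
  specialize (B ltac:(change (Im (- w)) with (- Im w); now rewrite Rabs_Ropp) ltac:(change (Im (- v)) with (- Im v); now rewrite Rabs_Ropp)).
  assert (D := Cmod_triangle (cexp2pi w - cexp2pi v) (cexp2pi (- w) - cexp2pi (- v))). lra.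
Qed.

(** The map w -> (w + 1) / 2 sends 0 < Re w <= 2 / 3 into 1 / 2 < Re w <= 5 / 6, and the region is
    made symmetric under w -> 1 - w. At its edges sin (pi Re w) = 1 / 2. *)
Definition mid (Y : R) (w : C) := 1 / 6 <= Re w <= 5 / 6 /\ Rabs (Im w) <= Y.

Lemma mid_strip (Y : R) (w : C) : mid Y w -> strip w.
Proof. unfold mid, strip. lra. Qed.

Lemma sin_mid (Y : R) (w : C) : mid Y w -> 1 / 4 <= sin (PI * Re w) ^ 2.
Proof.
  intros [H _]. assert (P := PI_RGT_0).
  assert (S : 1 / 2 <= sin (PI * Re w)); [|nra].
  rewrite <- sin_PI6.
  destruct (Rle_dec (Re w) (1 / 2)) as [L|L].
  - apply sin_incr_1; try nra.
  - rewrite <- (sin_PI_x (PI * Re w)). apply sin_incr_1; try nra.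
Qed.

(** The logarithms cancel in the difference. On [mid] both denominators are at least [cosh t / 4],
    so the kernels differ by at most [16 / cosh t <= 32 * exp (- t)] times the difference of the
    cosines. *)
Lemma J_lipschitz (Y : R) (w v : C) : mid Y w -> mid Y v ->
  Cmod (J w - J v) <= 32 * (exp (2 * PI * Y) * (2 * PI)) * Cmod (w - v).
Proof.
  intros Hw Hv. assert (Sw := mid_strip Y w Hw). assert (Sv := mid_strip Y v Hv).
  refine (Cmod_Clim_le (F := Rbar_locally p_infty) _ _ _ _ (Clim_minus _ _ _ _ (J_lim w Sw) (J_lim v Sv))).
  exists 0. intros T HT.
  replace (kernel_int w T - RtoC (ln T) - (kernel_int v T - RtoC (ln T)))%C with (kernel_int w T - kernel_int v T)%C by ring.
  set (L := exp (2 * PI * Y) * (2 * PI)). set (d := Cmod (w - v)).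
  assert (HL : 0 <= L * d).
  { unfold L, d. apply Rmult_le_pos; [|apply Cmod_ge_0].
    apply Rmult_le_pos; [left; apply exp_pos|generalize PI_RGT_0; lra]. }
  apply Rle_trans with (32 * (L * d) * (exp (- 0) - exp (- T))).
  2: { rewrite Ropp_0, exp_0. generalize (exp_pos (- T)); nra. }
  refine (Cmod_is_CRInt_le _ (fun t => 32 * (L * d) * exp (- t)) 0 T _ _ (Rlt_le _ _ HT) _
    (is_CRInt_minus _ _ _ _ _ _ (is_CRInt_CRInt _ _ _ (ex_CRInt_kernel w 0 T Sw)) (is_CRInt_CRInt _ _ _ (ex_CRInt_kernel v 0 T Sv))) _).
  2: { apply (is_RInt_scal (V := R_NormedModule)), is_RInt_exp_opp. }
  intros t Ht.
  assert (Nw := kernel_den_neq_0 t w Sw). assert (Nv := kernel_den_neq_0 t v Sv).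
  unfold kernel.
  replace (RtoC (sinhc t) / (RtoC (cosh t) - ccos2pi w) - RtoC (sinhc t) / (RtoC (cosh t) - ccos2pi v))%C
  with (RtoC (sinhc t) * (ccos2pi w - ccos2pi v) / ((RtoC (cosh t) - ccos2pi w) * (RtoC (cosh t) - ccos2pi v)))%C by (field; now split).
  rewrite Cmod_div by now apply Cmult_neq_0. rewrite !Cmod_mult, Cmod_R.
  assert (B := sinhc_bounds t). rewrite Rabs_pos_eq by lra.
  assert (Dw := kernel_den_bound t w). assert (Dv := kernel_den_bound t v).
  assert (Qw := sin_mid Y w Hw). assert (Qv := sin_mid Y v Hv).
  assert (C1 := cosh_ge_1 t). assert (I := inv_cosh_le t).
  set (p := Cmod (RtoC (cosh t) - ccos2pi w)) in *. set (q := Cmod (RtoC (cosh t) - ccos2pi v)) in *.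
  assert (Hp : cosh t / 4 <= p).
  { apply Rle_trans with (2 := Dw). unfold Rdiv. rewrite Rmult_comm. apply Rmult_le_compat_r; lra. }
  assert (Hq : cosh t / 4 <= q).
  { apply Rle_trans with (2 := Dv). unfold Rdiv. rewrite Rmult_comm. apply Rmult_le_compat_r; lra. }
  assert (A : Cmod (ccos2pi w - ccos2pi v) <= L * d) by (apply ccos2pi_lipschitz; [apply Hw|apply Hv]).
  assert (Hc : 0 < cosh t / 4 * (cosh t / 4)) by (apply Rmult_lt_0_compat; lra).
  assert (Hpq : cosh t / 4 * (cosh t / 4) <= p * q) by (apply Rmult_le_compat; lra).
  apply Rle_trans with (cosh t * (L * d) * / (cosh t / 4 * (cosh t / 4))).
  - unfold Rdiv at 1. apply Rmult_le_compat.
    + apply Rmult_le_pos; [lra|apply Cmod_ge_0].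
    + left; apply Rinv_0_lt_compat; lra.
    + apply Rmult_le_compat; try lra. apply Cmod_ge_0.
    + apply Rinv_le_contravar; lra.
  - replace (cosh t * (L * d) * / (cosh t / 4 * (cosh t / 4))) with (16 * (L * d) * / cosh t) by (field; lra).
    nra.
Qed.

(* [ccot w = (pi / 2) cot (pi w)]. *)
Definition ccot (w : C) : C := (RtoC PI * Ci / 2 * ((cexp2pi w + 1) / (cexp2pi w - 1)))%C.

(** With r = exp (- 2 pi Im w), the right side is exactly (r - 1)^2 + 4 r sin^2 (pi Re w). *)
Lemma Cmod_cexp2pi_minus_1 (w : C) : 4 * exp (- (2 * PI * Im w)) * sin (PI * Re w) ^ 2 <= Cmod (cexp2pi w - 1) ^ 2.
Proof.
  destruct w as [x y]. rewrite cexp2pi_pair. unfold Re, Im; simpl fst; simpl snd.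
  set (r := exp (- (2 * PI * y))). assert (Hr : 0 < r) by apply exp_pos.
  unfold Cmod. simpl fst. simpl snd. rewrite pow2_sqrt by (apply Rplus_le_le_0_compat; apply pow2_ge_0).
  replace (2 * PI * x) with (2 * (PI * x)) by ring.
  assert (E := cos_2a_sin (PI * x)). assert (E2 := sin2_cos2 (2 * (PI * x))). unfold Rsqr in E2.
  set (c := cos (2 * (PI * x))) in *. set (s := sin (2 * (PI * x))) in *.
  replace ((r * c + - (1)) ^ 2 + (r * s + - 0) ^ 2) with (r * r * (s * s + c * c) - 2 * r * c + 1) by ring.
  rewrite E2, E. assert (0 <= (r - 1) ^ 2) by apply pow2_ge_0. nra.
Qed.

Lemma cexp2pi_minus_1_neq_0 (w : C) : strip w -> (cexp2pi w - 1)%C <> 0%C.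
Proof.
  intros Hw E. assert (H := Cmod_cexp2pi_minus_1 w). rewrite E, Cmod_0 in H.
  assert (S := sin_strip w Hw). assert (P := exp_pos (- (2 * PI * Im w))).
  assert (0 < 4 * exp (- (2 * PI * Im w)) * sin (PI * Re w) ^ 2) by (apply Rmult_lt_0_compat; lra). lra.
Qed.

Lemma ccot_sym (w : C) : strip w -> ccot (1 - w) = (- ccot w)%C.
Proof.
  intros Hw. unfold ccot. assert (N := cexp2pi_minus_1_neq_0 w Hw).
  assert (N' := cexp2pi_minus_1_neq_0 _ (strip_sym w Hw)).
  rewrite cexp2pi_sym in *. assert (T0 := cexp2pi_neq_0 w). field.
  repeat split; try assumption. intro E. apply N.
  replace (cexp2pi w - 1)%C with (- (1 - cexp2pi w))%C by ring. rewrite E. ring.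
Qed.

Lemma ccot_duplication (w : C) : strip w -> ccot w = ((ccot (w / 2) + ccot ((w + 1) / 2)) / 2)%C.
Proof.
  intros Hw. unfold ccot. assert (N := cexp2pi_minus_1_neq_0 w Hw).
  assert (N1 := cexp2pi_minus_1_neq_0 _ (strip_half w Hw)).
  assert (N2 := cexp2pi_minus_1_neq_0 _ (strip_half_1 w Hw)).
  rewrite cexp2pi_half_shift in *. rewrite (cexp2pi_half_sq w) in *. field. repeat split; assumption.
Qed.

Lemma ccot_lipschitz (Y : R) (w v : C) : mid Y w -> mid Y v ->
  Cmod (ccot w - ccot v) <= PI * (exp (2 * PI * Y) * (exp (2 * PI * Y) * (2 * PI))) * Cmod (w - v).
Proof.
  intros Hw Hv. assert (Sw := mid_strip Y w Hw). assert (Sv := mid_strip Y v Hv).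
  assert (Nw := cexp2pi_minus_1_neq_0 w Sw). assert (Nv := cexp2pi_minus_1_neq_0 v Sv).
  assert (P := PI_RGT_0).
  (* On [mid] one has [4 * sin (PI * Re u) ^ 2 >= 1], so only the exponential factor of
     [Cmod_cexp2pi_minus_1] remains. *)
  assert (B : forall u, mid Y u -> exp (- (PI * Y)) <= Cmod (cexp2pi u - 1)).
  { intros u Hu. assert (H := Cmod_cexp2pi_minus_1 u). assert (S := sin_mid Y u Hu).
    apply Rsqr_incr_0_var; [|apply Cmod_ge_0]. unfold Rsqr. rewrite <- exp_plus.
    apply Rle_trans with (exp (- (2 * PI * Im u))).
    - apply exp_le_compat. destruct Hu as [_ Hu]. assert (A := Rle_abs (Im u)). nra.
    - assert (X := exp_pos (- (2 * PI * Im u))). nra. }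
  unfold ccot.
  replace (RtoC PI * Ci / 2 * ((cexp2pi w + 1) / (cexp2pi w - 1)) - RtoC PI * Ci / 2 * ((cexp2pi v + 1) / (cexp2pi v - 1)))%C
  with (- (RtoC PI * Ci * (cexp2pi w - cexp2pi v)) / ((cexp2pi w - 1) * (cexp2pi v - 1)))%C by (field; now repeat split).
  rewrite Cmod_div by now apply Cmult_neq_0. rewrite Cmod_opp, !Cmod_mult, Cmod_R, Rabs_pos_eq by lra.
  rewrite Cmod_Ci.
  assert (A := cexp2pi_lipschitz Y w v (proj2 Hw) (proj2 Hv)).
  set (E := exp (2 * PI * Y)) in *. set (d := Cmod (w - v)) in *.
  assert (Bw := B w Hw). assert (Bv := B v Hv).
  assert (X := exp_pos (- (PI * Y))).
  assert (Q : / E <= Cmod (cexp2pi w - 1) * Cmod (cexp2pi v - 1)).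
  { unfold E. rewrite <- exp_Ropp. replace (- (2 * PI * Y)) with (- (PI * Y) + - (PI * Y)) by ring.
    rewrite exp_plus.
    apply Rmult_le_compat; lra. }
  assert (HE : 0 < E) by apply exp_pos. assert (HiE : 0 < / E) by now apply Rinv_0_lt_compat.
  replace (PI * (E * (E * (2 * PI))) * d) with (PI * 1 * (E * (2 * PI) * d) * / / E) by (rewrite Rinv_inv; ring).
  unfold Rdiv. apply Rmult_le_compat.
  - apply Rmult_le_pos; [lra|apply Cmod_ge_0].
  - left. apply Rinv_0_lt_compat. lra.
  - apply Rmult_le_compat_l; lra.
  - apply Rinv_le_contravar; assumption.
Qed.

(** * Averaging functions on the strip *)

Definition averaging (D : C -> C) :=
  forall w, strip w -> D w = ((D (w / 2) + D ((w + 1) / 2)) / 2)%C.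

(* With [averaging], this excludes a pole at 0. *)
Definition subpolar (D : C -> C) :=
  forall w, strip w -> Clim eventually (fun n => RtoC ((/ 2) ^ n) * D (RtoC ((/ 2) ^ n) * w))%C 0.

(** The condition on the real parts ensures that two points of [mid] lie both in Re <= 2 / 3 or both
    in Re >= 1 / 3, so that one end of the strip serves for both. *)
Definition lip_mid (D : C -> C) (Y M : R) :=
  forall w v, mid Y w -> mid Y v -> Rabs (Re w - Re v) <= 1 / 3 -> Cmod (D w - D v) <= M * Cmod (w - v).

Lemma pow_half_bounds (n : nat) : 0 < (/ 2) ^ n <= 1.
Proof.
  split; [apply pow_lt; lra|]. rewrite <- (pow1 n). apply pow_incr; lra.
Qed.

Lemma Re_scal (r : R) (w : C) : Re (RtoC r * w) = r * Re w.
Proof. unfold Re, Cmult, RtoC; simpl; ring. Qed.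
Lemma Im_scal (r : R) (w : C) : Im (RtoC r * w) = r * Im w.
Proof. unfold Re, Im, Cmult, RtoC; simpl; ring. Qed.

(* Iterating [averaging] gives [D w = sum_j 2^(-j-1) D ((2^(-j) w + 1) / 2)], where all the points
   lie in the middle of the strip; the factor is [sum_j 4^(-j-1) = 1 / 3]. *)
Lemma lip_near_0 (D : C -> C) (Y M : R) (w v : C) :
  averaging D -> subpolar D -> 0 <= M -> lip_mid D Y M ->
  0 < Re w <= 2 / 3 -> 0 < Re v <= 2 / 3 -> Rabs (Im w) <= Y -> Rabs (Im v) <= Y ->
  Cmod (D w - D v) <= M / 3 * Cmod (w - v).
Proof.
  intros HA HS HM HL Hw Hv Yw Yv.
  set (h := fun n => (/ 2) ^ n).
  (* The factor [(1 - h n * h n) / 3] is the partial sum of [4 ^ (- j - 1)] over [j < n]; the last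
     term is the remainder of the iteration, which [subpolar] sends to 0. *)
  assert (K : forall n, Cmod (D w - D v) <= M / 3 * (1 - h n * h n) * Cmod (w - v)
     + h n * Cmod (D (RtoC (h n) * w)%C - D (RtoC (h n) * v)%C)).
  { induction n as [|n IH].
    - unfold h. simpl. rewrite !Cmult_1_l. lra.
    - apply Rle_trans with (1 := IH).
      assert (Hh := pow_half_bounds n). fold (h n) in Hh.
      assert (E1 : h (S n) = h n / 2) by (unfold h; simpl; field). rewrite E1.
      set (r := h n) in *. set (a := (RtoC r * w)%C). set (b := (RtoC r * v)%C).
      assert (Sa : strip a) by (unfold strip, a; rewrite Re_scal; nra).
      assert (Sb : strip b) by (unfold strip, b; rewrite Re_scal; nra).
      replace (RtoC (r / 2) * w)%C with (a / 2)%C by (unfold a, Rdiv; rewrite RtoC_mult, RtoC_inv by lra; unfold Cdiv; ring).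
      replace (RtoC (r / 2) * v)%C with (b / 2)%C by (unfold b, Rdiv; rewrite RtoC_mult, RtoC_inv by lra; unfold Cdiv; ring).
      rewrite (HA a Sa), (HA b Sb).
      replace ((D (a / 2)%C + D ((a + 1) / 2)%C) / 2 - (D (b / 2)%C + D ((b + 1) / 2)%C) / 2)%C
       with (RtoC (/ 2) * ((D (a / 2)%C - D (b / 2)%C) + (D ((a + 1) / 2)%C - D ((b + 1) / 2)%C)))%C by (rewrite RtoC_inv by lra; field).
      rewrite Cmod_mult, Cmod_R, Rabs_pos_eq by lra.
      assert (T := Cmod_triangle (D (a / 2)%C - D (b / 2)%C) (D ((a + 1) / 2)%C - D ((b + 1) / 2)%C)).
      assert (IY : forall u, Rabs (Im u) <= Y -> Rabs (Im (RtoC r * u)) <= Y).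
      { intros u Hu. rewrite Im_scal, Rabs_mult, (Rabs_pos_eq r) by lra. assert (X := Rabs_pos (Im u)). nra. }
      assert (Ma : mid Y ((a + 1) / 2)).
      { unfold mid. rewrite Re_half_1, Im_half_1. split; [unfold a; rewrite Re_scal; nra|].
        assert (X := IY w Yw). fold a in X. unfold Rdiv. rewrite Rabs_mult, (Rabs_pos_eq (/ 2)) by lra.
        assert (X2 := Rabs_pos (Im a)). lra. }
      assert (Mb : mid Y ((b + 1) / 2)).
      { unfold mid. rewrite Re_half_1, Im_half_1. split; [unfold b; rewrite Re_scal; nra|].
        assert (X := IY v Yv). fold b in X. unfold Rdiv. rewrite Rabs_mult, (Rabs_pos_eq (/ 2)) by lra.
        assert (X2 := Rabs_pos (Im b)). lra. }
      assert (Q := HL _ _ Ma Mb).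
      assert (Rd : Rabs (Re ((a + 1) / 2) - Re ((b + 1) / 2)) <= 1 / 3).
      { rewrite !Re_half_1. unfold a, b. rewrite !Re_scal. apply Rabs_le. nra. }
      specialize (Q Rd).
      assert (Ed : Cmod ((a + 1) / 2 - (b + 1) / 2) = r / 2 * Cmod (w - v)).
      { replace ((a + 1) / 2 - (b + 1) / 2)%C with (RtoC (r / 2) * (w - v))%C.
        - rewrite Cmod_mult, Cmod_R, Rabs_pos_eq by lra. reflexivity.
        - unfold a, b, Rdiv. rewrite RtoC_mult, RtoC_inv by lra. field. }
      rewrite Ed in Q. set (d := Cmod (w - v)) in *.
      set (P := Cmod (D (a / 2)%C - D (b / 2)%C)) in *. set (P2 := Cmod (D ((a + 1) / 2)%C - D ((b + 1) / 2)%C)) in *.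
      set (P3 := Cmod (_ + _)) in *.
      assert (r * (/ 2 * P3) <= r * (/ 2 * (P + M * (r / 2 * d)))) by (apply Rmult_le_compat_l; lra).
      lra. }
  assert (L := Clim_minus (F := eventually) _ _ _ _ (HS w ltac:(unfold strip; lra)) (HS v ltac:(unfold strip; lra))).
  replace (0 - 0)%C with (RtoC 0) in L by ring.
  apply le_epsilon. intros eps He. destruct (L eps He) as [N HN]. specialize (HN N (le_n N)).
  specialize (K N). unfold h in K. assert (Hh := pow_half_bounds N). set (r := (/ 2) ^ N) in *.
  replace (RtoC r * D (RtoC r * w) - RtoC r * D (RtoC r * v) - 0)%C with (RtoC r * (D (RtoC r * w) - D (RtoC r * v)))%C in HN by ring.
  rewrite Cmod_mult, Cmod_R, Rabs_pos_eq in HN by lra.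
  assert (0 <= M / 3 * Cmod (w - v)) by (apply Rmult_le_pos; [lra|apply Cmod_ge_0]).
  assert (0 <= r * r) by nra. nra.
Qed.

Lemma averaging_sym (D : C -> C) : averaging D -> averaging (fun w => D (1 - w)%C).
Proof.
  intros HA w Hw. rewrite (HA _ (strip_sym w Hw)).
  replace (1 - w / 2)%C with ((1 - w + 1) / 2)%C by field.
  replace (1 - (w + 1) / 2)%C with ((1 - w) / 2)%C by field.
  unfold Cdiv. ring.
Qed.

Lemma mid_sym (Y : R) (w : C) : mid Y w -> mid Y (1 - w).
Proof.
  unfold mid. replace (Re (1 - w)) with (1 - Re w) by reflexivity.
  replace (Im (1 - w)) with (- Im w) by (unfold Im, Cminus, Cplus, Copp, RtoC; simpl; ring).
  rewrite Rabs_Ropp. lra.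
Qed.

Lemma lip_mid_sym (D : C -> C) (Y M : R) : lip_mid D Y M -> lip_mid (fun w => D (1 - w)%C) Y M.
Proof.
  intros HL w v Hw Hv Hd.
  replace (w - v)%C with (- ((1 - w) - (1 - v)))%C by ring. rewrite Cmod_opp.
  apply HL; try now apply mid_sym.
  replace (Re (1 - w)) with (1 - Re w) by reflexivity. replace (Re (1 - v)) with (1 - Re v) by reflexivity.
  rewrite Rabs_minus_sym. replace (1 - Re v - (1 - Re w)) with (Re w - Re v) by ring. exact Hd.
Qed.

Lemma lip_mid_third (D : C -> C) (Y M : R) :
  averaging D -> subpolar D -> subpolar (fun w => D (1 - w)%C) -> 0 <= M -> lip_mid D Y M -> lip_mid D Y (M / 3).
Proof.
  intros HA HS HS' HM HL w v Hw Hv Hd. apply Rabs_le_between in Hd.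
  destruct (Rle_dec (Re w) (2 / 3)) as [Lw|Lw]; [destruct (Rle_dec (Re v) (2 / 3)) as [Lv|Lv]|].
  1: { destruct Hw, Hv. apply (lip_near_0 D Y M); try assumption; lra. }
  (* If one real part exceeds 2 / 3, the other exceeds 1 / 3, and the reflected points satisfy the
     assumptions of [lip_near_0]. *)
  all: assert (X := lip_near_0 _ Y M (1 - w)%C (1 - v)%C (averaging_sym D HA) HS' HM (lip_mid_sym D Y M HL));
    cbv beta in X; replace (1 - (1 - w))%C with w in X by ring; replace (1 - (1 - v))%C with v in X by ring;
    replace (1 - w - (1 - v))%C with (- (w - v))%C in X by ring; rewrite Cmod_opp in X;
    assert (Mw := mid_sym Y w Hw); assert (Mv := mid_sym Y v Hv); unfold mid in Mw, Mv, Hw, Hv;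
    replace (Re (1 - w)) with (1 - Re w) in * by reflexivity; replace (Re (1 - v)) with (1 - Re v) in * by reflexivity;
    apply X; try lra; tauto.
Qed.

(** Repeated contraction makes the Lipschitz constant on [mid] zero. A last use of [lip_near_0]
    extends this from [mid] to points arbitrarily close to the edge Re w = 0. *)
Lemma averaging_constant (D : C -> C) :
  averaging D -> subpolar D -> subpolar (fun w => D (1 - w)%C) ->
  (forall Y, exists M, 0 <= M /\ lip_mid D Y M) ->
  forall w v, 0 < Re w <= 2 / 3 -> 0 < Re v <= 2 / 3 -> D w = D v.
Proof.
  intros HA HS HS' HL w v Hw Hv.
  set (Y := Rmax (Rabs (Im w)) (Rabs (Im v))).
  destruct (HL Y) as [M [HM H]].
  assert (K : forall n, lip_mid D Y (M * (/ 3) ^ n)).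
  { induction n as [|n IH]; [simpl; now rewrite Rmult_1_r|].
    replace (M * (/ 3) ^ S n) with (M * (/ 3) ^ n / 3) by (simpl; field).
    apply lip_mid_third; try assumption. apply Rmult_le_pos; [exact HM|apply pow_le; lra]. }
  assert (Z : lip_mid D Y 0).
  { intros a b Ha Hb Hd. rewrite Rmult_0_l.
    assert (L : is_lim_seq (fun n => M * (/ 3) ^ n * Cmod (a - b)) 0).
    { replace (Finite 0) with (Rbar_mult (Rbar_mult M 0) (Cmod (a - b))) by (simpl; f_equal; ring).
      apply is_lim_seq_scal_r, is_lim_seq_scal_l, is_lim_seq_geom. rewrite Rabs_pos_eq; lra. }
    refine (is_lim_seq_le (fun _ => Cmod (D a - D b)) _ _ _ _ (is_lim_seq_const _) L).
    intro n. now apply K. }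
  assert (F := lip_near_0 D Y 0 w v HA HS (Rle_refl 0) Z Hw Hv (Rmax_l _ _) (Rmax_r _ _)).
  assert (E : (D w - D v)%C = 0%C).
  { apply Cmod_eq_0. generalize (Cmod_ge_0 (D w - D v)). lra. }
  replace (D w) with (D w - D v + D v)%C by ring. rewrite E. ring.
Qed.

(** * Behaviour at the ends of the strip *)

Lemma Cexp_taylor_3 (d : C) :
  Cmod (Cexp d - 1 - d - d * d / 2 - d * d * d / 6) <= Cmod d ^ 4 * exp (Cmod d).
Proof.
  assert (H := is_RInt_const_R 0 1 (Cmod d ^ 4 * exp (Cmod d))).
  replace ((1 - 0) * (Cmod d ^ 4 * exp (Cmod d))) with (Cmod d ^ 4 * exp (Cmod d)) in H by ring.
  assert (H0 : is_CRInt (fun s => d + d * (RtoC s * d) + d * (RtoC (s ^ 2 / 2) * (d * d)))%C 0 1 (d + d * d / 2 + d * d * d / 6)%C).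
  { replace (d + d * d / 2 + d * d * d / 6)%C with
     ((RtoC 1 * d + RtoC (1 ^ 2 / 2) * (d * d) + RtoC (1 ^ 3 / 6) * (d * d * d))
     - (RtoC 0 * d + RtoC (0 ^ 2 / 2) * (d * d) + RtoC (0 ^ 3 / 6) * (d * d * d)))%C.
    2: { destruct d as [p q]. unfold RtoC, Cminus, Cplus, Cmult, Copp, Cdiv, Cinv; simpl. f_equal; field. }
    apply (is_CRInt_derive (fun s => RtoC s * d + RtoC (s ^ 2 / 2) * (d * d) + RtoC (s ^ 3 / 6) * (d * d * d))%C). lra.
    - intros s _. destruct d as [p q].
      apply is_derive_C; unfold Re, Im, Cplus, Cmult, RtoC; simpl; auto_derive; trivial; field.
    - intros s _.
      assert (X1 : continuous (fun s : R => RtoC s) s) by (apply continuous_RtoC, continuous_id).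
      assert (X2 : continuous (fun s : R => RtoC (s ^ 2 / 2)) s).
      { apply continuous_RtoC. apply (ex_derive_continuous (V := R_NormedModule)). now auto_derive. }
      apply continuous_Cplus; [apply continuous_Cplus; [apply continuous_Cconst|]|];
      (apply continuous_Cmult; [apply continuous_Cconst|]); (apply continuous_Cmult; [assumption|apply continuous_Cconst]). }
  replace (Cexp d - 1 - d - d * d / 2 - d * d * d / 6)%C with (Cexp d - 1 - (d + d * d / 2 + d * d * d / 6))%C by ring.
  refine (Cmod_is_CRInt_le _ _ 0 1 _ _ Rle_0_1 _
    (is_CRInt_minus _ _ _ _ _ _ (is_CRInt_Cexp_line d) H0) H).
  intros s Hs. replace (d * Cexp (RtoC s * d) - (d + d * (RtoC s * d) + d * (RtoC (s ^ 2 / 2) * (d * d))))%C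
    with (d * (Cexp (RtoC s * d) - 1 - RtoC s * d - (RtoC s * d) * (RtoC s * d) / 2))%C.
  2: { unfold Rdiv. rewrite RtoC_mult, RtoC_inv, RtoC_pow by lra. field. }
  rewrite Cmod_mult. replace (Cmod d ^ 4) with (Cmod d * Cmod d ^ 3) by ring. rewrite Rmult_assoc.
  apply Rmult_le_compat_l; [apply Cmod_ge_0|].
  apply Rle_trans with (1 := Cexp_taylor_2 _).
  assert (E := Cmod_scal_le d s Hs).
  apply Rmult_le_compat; [apply pow_le, Cmod_ge_0|left; apply exp_pos| |now apply exp_le_compat].
  apply pow_incr; split; [apply Cmod_ge_0|exact E].
Qed.

(** The odd terms cancel, so the error is of fourth order; 3 is a bound for [exp 1]. *)
Lemma Ccosh_taylor (d : C) : Cmod d <= 1 ->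
  Cmod ((Cexp d + Cexp (- d)) / 2 - 1 - d * d / 2) <= 3 * Cmod d ^ 4.
Proof.
  intros Hd. assert (A := Cexp_taylor_3 d). assert (B := Cexp_taylor_3 (- d)). rewrite Cmod_opp in B.
  replace ((Cexp d + Cexp (- d)) / 2 - 1 - d * d / 2)%C
    with (RtoC (/ 2) * ((Cexp d - 1 - d - d * d / 2 - d * d * d / 6) +
     (Cexp (- d) - 1 - - d - - d * - d / 2 - - d * - d * - d / 6)))%C by (rewrite RtoC_inv by lra; field).
  rewrite Cmod_mult, Cmod_R, Rabs_pos_eq by lra.
  assert (T := Cmod_triangle (Cexp d - 1 - d - d * d / 2 - d * d * d / 6) (Cexp (- d) - 1 - - d - - d * - d / 2 - - d * - d * - d / 6)).
  assert (E : exp (Cmod d) <= 3).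
  { apply Rle_trans with (exp 1); [now apply exp_le_compat|apply exp_le_3]. }
  assert (P : 0 <= Cmod d ^ 4) by (apply pow_le, Cmod_ge_0). nra.
Qed.

Lemma cosh_taylor (t : R) : 0 <= t <= 1 -> Rabs (cosh t - 1 - t ^ 2 / 2) <= 3 * t ^ 4.
Proof.
  intros Ht. assert (H := Ccosh_taylor (RtoC t)). rewrite Cmod_R, Rabs_pos_eq in H by lra.
  specialize (H (proj2 Ht)). rewrite <- Cmod_R.
  replace (RtoC (cosh t - 1 - t ^ 2 / 2)) with ((Cexp t + Cexp (- t)) / 2 - 1 - t * t / 2)%C; [exact H|].
  rewrite <- RtoC_opp, !Cexp_RtoC. unfold cosh, Rdiv.
  rewrite !RtoC_minus, !RtoC_mult, RtoC_plus, RtoC_pow, RtoC_inv by lra.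
  field.
Qed.

Lemma cosh_lower (t : R) : 0 <= t -> 1 + t ^ 2 / 2 <= cosh t.
Proof.
  intros Ht. assert (H := sinhc_bounds (t / 2)).
  assert (E : cosh t = 1 + 2 * sinh (t / 2) ^ 2).
  { unfold cosh, sinh. replace t with (t / 2 + t / 2) at 1 2 by field. rewrite Ropp_plus_distr, !exp_plus.
    assert (E : exp (t / 2) * exp (- (t / 2)) = 1) by (rewrite <- exp_plus, Rplus_opp_r; apply exp_0).
    field_simplify. nra. }
  assert (S : t / 2 <= sinh (t / 2)).
  { unfold sinhc in H. destruct Req_EM_T as [e|n]; [rewrite e, sinh_0; lra|].
    destruct H as [H _]. apply Rle_div_r in H; lra. }
  rewrite E. nra.
Qed.

Lemma Cmod_sq (z : C) : Cmod z ^ 2 = Re z ^ 2 + Im z ^ 2.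
Proof. unfold Cmod. rewrite pow2_sqrt; [reflexivity|]. apply Rplus_le_le_0_compat; apply pow2_ge_0. Qed.

(** Factor t^2 + alpha^2 = (t + i alpha) (t - i alpha). With alpha = p + i q the squared moduli of
    the factors are (t - q)^2 + p^2 and (t + q)^2 + p^2, and each is at least rho / 4 times t^2 +
    |alpha|^2. The condition on [rho] keeps alpha in a sector around the real axis, away from the
    directions in which the zeros +- i alpha become real. [F] treats both signs [s] at once. *)
Lemma sum_sq_lower (t : R) (al : C) (rho : R) : 0 < rho <= 1 -> rho * Cmod al ^ 2 <= Re al ^ 2 ->
  rho / 4 * (t ^ 2 + Cmod al ^ 2) <= Cmod (RtoC (t ^ 2) + al * al).
Proof.
  intros Hr Ha. rewrite Cmod_sq in *. set (p := Re al) in *. set (q := Im al) in *.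
  assert (F : forall s, rho / 4 * (t ^ 2 + (p ^ 2 + q ^ 2)) <= (t + s * q) ^ 2 + p ^ 2 \/ s ^ 2 <> 1).
  { intros s. destruct (Req_dec (s ^ 2) 1) as [Es|]; [left|now right].
    assert (t ^ 2 <= 2 * (t + s * q) ^ 2 + 2 * q ^ 2).
    { assert (0 <= (t + 2 * s * q) ^ 2) by apply pow2_ge_0.
      assert ((s * q) ^ 2 = q ^ 2) by (rewrite Rpow_mult_distr, Es; ring). nra. }
    assert (0 <= (t + s * q) ^ 2) by apply pow2_ge_0. assert (0 <= p ^ 2) by apply pow2_ge_0.
    assert (0 <= q ^ 2) by apply pow2_ge_0.
    nra. }
  destruct (F 1) as [F1|F1]; [|exfalso; apply F1; ring].
  destruct (F (-1)) as [F2|F2]; [|exfalso; apply F2; ring].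
  apply Rsqr_incr_0_var; [|apply Cmod_ge_0]. unfold Rsqr at 2.
  replace (Cmod (RtoC (t ^ 2) + al * al) * Cmod (RtoC (t ^ 2) + al * al)) with (Cmod (RtoC (t ^ 2) + al * al) ^ 2) by ring.
  rewrite Cmod_sq.
  replace (Re (RtoC (t ^ 2) + al * al) ^ 2 + Im (RtoC (t ^ 2) + al * al) ^ 2)
    with (((t + 1 * q) ^ 2 + p ^ 2) * ((t + -1 * q) ^ 2 + p ^ 2)).
  2: { destruct al as [x y]. unfold p, q, Re, Im, Cplus, Cmult, RtoC; simpl. ring. }
  unfold Rsqr. apply Rmult_le_compat; try assumption;
  (apply Rmult_le_pos; [lra|]); assert (X1 := pow2_ge_0 t); assert (X2 := pow2_ge_0 p); assert (X3 := pow2_ge_0 q); lra.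
Qed.

Lemma ccos2pi_taylor (al w : C) : (al = RtoC (2 * PI) * w)%C -> Cmod al <= 1 ->
  Cmod (ccos2pi w - 1 + al * al / 2) <= 3 * Cmod al ^ 4.
Proof.
  intros Ea Ha. assert (H := Ccosh_taylor (Ci * al)).
  assert (EC : Cmod (Ci * al) = Cmod al).
  { rewrite Cmod_mult, Cmod_Ci. ring. }
  rewrite EC in H. specialize (H Ha).
  replace (ccos2pi w - 1 + al * al / 2)%C with ((Cexp (Ci * al) + Cexp (- (Ci * al))) / 2 - 1 - Ci * al * (Ci * al) / 2)%C; [exact H|].
  unfold ccos2pi. rewrite <- cexp2pi_opp. unfold cexp2pi. rewrite Ea.
  replace (RtoC (2 * PI) * Ci * w)%C with (Ci * (RtoC (2 * PI) * w))%C by ring.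
  replace (RtoC (2 * PI) * Ci * - w)%C with (- (Ci * (RtoC (2 * PI) * w)))%C by ring.
  assert (I2 : (Ci * Ci)%C = (- RtoC 1)%C) by (unfold Ci, Cmult, Copp, RtoC; simpl; f_equal; ring).
  set (u := (RtoC (2 * PI) * w)%C). replace (Ci * u * (Ci * u))%C with (Ci * Ci * (u * u))%C by ring.
  rewrite I2. field.
Qed.

(* Subtracting the two poles [t = +- 2 pi i w] leaves a kernel bounded uniformly as [w] tends
   to 0 along a ray. *)
Lemma kernel_near_pole (al w : C) (rho delta t : R) : (al = RtoC (2 * PI) * w)%C -> strip w ->
  0 < rho <= 1 -> rho * Cmod al ^ 2 <= Re al ^ 2 -> 0 < Cmod al <= delta -> 0 <= t <= delta ->
  delta ^ 2 <= rho / 96 ->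
  Cmod (kernel w t - 2 / (RtoC (t ^ 2) + al * al)) <= 640 / rho ^ 2.
Proof.
  intros Ea Hw Hr Hra Hal Ht Hd.
  assert (Hd1 : delta <= 1) by nra.
  set (s := t ^ 2 + Cmod al ^ 2).
  assert (Ha2 : 0 < Cmod al ^ 2) by nra. assert (Ht2 : 0 <= t ^ 2) by apply pow2_ge_0.
  assert (Hs : 0 < s) by (unfold s; lra).
  assert (Hs2 : s <= 2 * delta ^ 2) by (unfold s; nra).
  assert (L := sum_sq_lower t al rho Hr Hra). fold s in L.
  assert (U : Cmod (RtoC (t ^ 2) + al * al) <= s).
  { apply Rle_trans with (1 := Cmod_triangle _ _). rewrite Cmod_R, Rabs_pos_eq, Cmod_mult by exact Ht2.
    unfold s; lra. }
  set (V := (RtoC (t ^ 2) + al * al)%C) in *.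
  (* [V / 2] is the second-order part of the denominator of the kernel, and [N] its fourth-order
     remainder. *)
  set (N := (RtoC (cosh t) - ccos2pi w - V / 2)%C).
  assert (HN : Cmod N <= 3 * s ^ 2).
  { assert (A := cosh_taylor t ltac:(lra)). assert (B := ccos2pi_taylor al w Ea ltac:(lra)).
    replace N with (RtoC (cosh t - 1 - t ^ 2 / 2) - (ccos2pi w - 1 + al * al / 2))%C.
    2: { unfold N, V. rewrite !RtoC_minus, RtoC_div by lra. field. }
    apply Rle_trans with (1 := Cmod_triangle _ _). rewrite Cmod_opp, Cmod_R.
    assert (3 * t ^ 4 + 3 * Cmod al ^ 4 <= 3 * s ^ 2); [|lra].
    replace (t ^ 4) with (t ^ 2 * t ^ 2) by ring.
    replace (Cmod al ^ 4) with (Cmod al ^ 2 * Cmod al ^ 2) by ring. unfold s. nra. }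
  (* The constant 96 comes from here: [3 * s ^ 2 <= 6 * delta ^ 2 * s <= rho / 16 * s], half of the
     lower bound [rho / 8 * s] for the modulus of [V / 2]. *)
  assert (HN2 : Cmod N <= rho / 16 * s).
  { assert (s * s <= s * (2 * (rho / 96))) by (apply Rmult_le_compat_l; lra). nra. }
  set (W := (RtoC (cosh t) - ccos2pi w)%C) in *.
  assert (HW : rho / 16 * s <= Cmod W).
  { assert (T := Cmod_triangle W (- N)).
    replace (W + - N)%C with (V * RtoC (/ 2))%C in T by (unfold N; rewrite RtoC_inv by lra; field).
    rewrite Cmod_mult, Cmod_opp, Cmod_R, Rabs_pos_eq in T by lra. lra. }
  assert (W0 : W <> 0%C) by now apply kernel_den_neq_0.
  assert (V0 : V <> 0%C). { intro E. rewrite E, Cmod_0 in L. nra. }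
  replace (kernel w t - 2 / V)%C with ((RtoC (sinhc t - 1) * V - 2 * N) / (W * V))%C.
  2: { unfold kernel, N. fold W. rewrite RtoC_minus. field. now split. }
  rewrite Cmod_div by now apply Cmult_neq_0. rewrite Cmod_mult.
  assert (B := sinhc_bounds t). assert (A := cosh_taylor t ltac:(lra)). apply Rabs_le_between in A.
  assert (S1 : sinhc t - 1 <= 4 * s).
  { assert (t ^ 4 <= t ^ 2). { replace (t ^ 4) with (t ^ 2 * t ^ 2) by ring.
      rewrite <- (Rmult_1_r (t ^ 2)) at 3. apply Rmult_le_compat_l; [exact Ht2|]. rewrite <- (pow1 2).
      apply pow_incr; lra. }
    unfold s. lra. }
  assert (Num : Cmod (RtoC (sinhc t - 1) * V - 2 * N) <= 10 * s ^ 2).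
  { apply Rle_trans with (1 := Cmod_triangle _ _). rewrite Cmod_opp, !Cmod_mult, !Cmod_R, !Rabs_pos_eq by lra.
    assert ((sinhc t - 1) * Cmod V <= 4 * s * s) by (apply Rmult_le_compat; try lra; apply Cmod_ge_0). lra. }
  assert (Den : rho / 16 * s * (rho / 4 * s) <= Cmod W * Cmod V) by (apply Rmult_le_compat; try lra; apply Rmult_le_pos; lra).
  assert (Den0 : 0 < rho / 16 * s * (rho / 4 * s)) by (repeat apply Rmult_lt_0_compat; lra).
  (* [640 = 10 * 16 * 4]: the numerator bound and the two lower bounds in the denominator. *)
  replace (640 / rho ^ 2) with (10 * s ^ 2 * / (rho / 16 * s * (rho / 4 * s))) by (field; lra).
  apply Rmult_le_compat; [apply Cmod_ge_0|left; apply Rinv_0_lt_compat; lra|exact Num|].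
  apply Rinv_le_contravar; assumption.
Qed.

(* Real form of the primitive [i (log (t + i alpha) - log (t - i alpha))] of
   [2 alpha / (t ^ 2 + alpha ^ 2)], for [alpha = p + i q]. *)
Definition pole_prim (p q t : R) : C :=
  (atan ((t - q) / p) + atan ((t + q) / p), (ln ((t - q) ^ 2 + p ^ 2) - ln ((t + q) ^ 2 + p ^ 2)) / 2).

Lemma pole_den_neq_0 (p q t : R) : 0 < p -> (RtoC (t ^ 2) + (p, q) * (p, q))%C <> 0%C.
Proof.
  intros Hp E. injection E. intros E2 E1. simpl in *.
  assert (Hq : q = 0) by nra. subst q. nra.
Qed.

Lemma is_derive_pole_prim (p q t : R) : 0 < p ->
  is_derive_RC (pole_prim p q) t
    ((p, q) * (2 / (RtoC (t ^ 2) + (p, q) * (p, q))))%C.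
Proof.
  intros Hp.
  assert (D1 : 0 < (t - q) ^ 2 + p ^ 2). { assert (0 <= (t - q) ^ 2) by apply pow2_ge_0. nra. }
  assert (D2 : 0 < (t + q) ^ 2 + p ^ 2). { assert (0 <= (t + q) ^ 2) by apply pow2_ge_0. nra. }
  replace ((p, q) * (2 / (RtoC (t ^ 2) + (p, q) * (p, q))))%C
   with ((p / ((t - q) ^ 2 + p ^ 2) + p / ((t + q) ^ 2 + p ^ 2), (t - q) / ((t - q) ^ 2 + p ^ 2) - (t + q) / ((t + q) ^ 2 + p ^ 2)) : C).
  2: { assert (N := pole_den_neq_0 p q t Hp).
       set (V := (RtoC (t ^ 2) + (p, q) * (p, q))%C) in *.
       match goal with |- ?l = _ => assert (E : (l * V = 2 * (p, q))%C) end.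
       { unfold V, Cplus, Cmult, RtoC; simpl. f_equal; field; split; lra. }
       match goal with |- ?l = _ => replace l with (l * V / V)%C by (field; exact N) end.
       rewrite E. field. exact N. }
  apply is_derive_C; unfold pole_prim, Re, Im; simpl fst; simpl snd.
  - auto_derive; [lra|]. field. repeat split; try lra; nra.
  - auto_derive; [repeat split; simpl in *; lra|]. field. split; lra.
Qed.

Lemma is_CRInt_pole (p q d : R) : 0 < p -> 0 <= d ->
  is_CRInt (fun t => 2 / (RtoC (t ^ 2) + (p, q) * (p, q)))%C 0 d (pole_prim p q d / (p, q))%C.
Proof.
  intros Hp Hd.
  assert (N0 : ((p, q) : C) <> 0%C) by (intro E; injection E; lra).
  assert (E0 : pole_prim p q 0 = 0%C).
  { unfold pole_prim, RtoC. f_equal.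
    - replace ((0 - q) / p) with (- ((0 + q) / p)) by (field; lra). rewrite atan_opp. ring.
    - replace ((0 - q) ^ 2) with ((0 + q) ^ 2) by ring. field. }
  assert (H : is_CRInt (fun t => (p, q) * (2 / (RtoC (t ^ 2) + (p, q) * (p, q))))%C 0 d (pole_prim p q d - pole_prim p q 0)%C).
  { apply is_CRInt_derive; [exact Hd| |].
    - intros; now apply is_derive_pole_prim.
    - intros t _. apply continuous_Cmult; [apply continuous_Cconst|].
      apply continuous_Cdiv; [apply continuous_Cconst| |now apply pole_den_neq_0].
      apply continuous_Cplus; [|apply continuous_Cconst]. apply continuous_RtoC.
      apply (ex_derive_continuous (V := R_NormedModule)). now auto_derive. }
  assert (H2 := is_CRInt_mult (/ (p, q)) _ _ _ _ H).
  replace (pole_prim p q d / (p, q))%C with (/ (p, q) * (pole_prim p q d - pole_prim p q 0))%C by (rewrite E0; field; exact N0).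
  revert H2. apply is_RInt_ext. intros t _. assert (N := pole_den_neq_0 p q t Hp).
  match goal with |- ?x = ?y => change (@eq C x y) end. field. now split.
Qed.

Lemma continuous_filterlim_at_right (f : R -> R) : continuous f 0 -> filterlim f (at_right 0) (locally (f 0)).
Proof.
  intros H P HP. specialize (H P HP). unfold filtermap, at_right, within in *.
  apply (filter_imp (F := locally 0) (fun x => P (f x))); [auto|exact H].
Qed.

Lemma at_right_lt (e : R) : 0 < e -> at_right 0 (fun h => 0 < h < e).
Proof.
  intros He. exists (mkposreal e He). intros y Hy Hy0. split; [exact Hy0|].
  apply ball_Rabs in Hy; simpl in Hy.
  apply Rabs_def2 in Hy. lra.
Qed.

Lemma pole_prim_lim (P Q d : R) : 0 < P -> 0 < d ->
  Clim (at_right 0) (fun h => pole_prim (h * P) (h * Q) d) (RtoC PI).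
Proof.
  intros HP Hd.
  (* For [h > 0] the arctangent of [x / (h * P)] is [PI / 2] minus that of the reciprocal; in this
     form the primitive extends continuously to [h = 0], where the arctangents add up to [PI] and
     the logarithms cancel. *)
  set (f := fun h => PI - atan (h * P / (d - h * Q)) - atan (h * P / (d + h * Q))).
  set (g := fun h => (ln ((d - h * Q) ^ 2 + (h * P) ^ 2) - ln ((d + h * Q) ^ 2 + (h * P) ^ 2)) / 2).
  assert (F0 : f 0 = PI) by (unfold f; rewrite !Rmult_0_l, !Rdiv_0_l, atan_0; ring).
  assert (G0 : g 0 = 0).
  { unfold g. rewrite !Rmult_0_l. rewrite Rminus_0_r, Rplus_0_r. field. }
  assert (Cf : continuous f 0).
  { apply (ex_derive_continuous (V := R_NormedModule)). unfold f. auto_derive. repeat split; lra. }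
  assert (Cg : continuous g 0).
  { apply (ex_derive_continuous (V := R_NormedModule)). unfold g. auto_derive.
    rewrite !Rmult_0_l, Ropp_0, Rplus_0_r. repeat split; nra. }
  apply (Clim_ext_loc (F := at_right 0) (fun h => RtoC (f h) + Ci * RtoC (g h))%C).
  - assert (He : 0 < d / (Rabs Q + 1)). { apply Rdiv_lt_0_compat; [exact Hd|]. generalize (Rabs_pos Q); lra. }
    generalize (at_right_lt _ He). apply filter_imp. intros h [H1 H2].
    assert (HQ : h * Rabs Q < d).
    { apply Rlt_div_r in H2; [|generalize (Rabs_pos Q); lra]. nra. }
    assert (A1 := Rle_abs Q). assert (A2 := Rle_abs (- Q)). rewrite Rabs_Ropp in A2.
    assert (B1 : 0 < d - h * Q) by nra. assert (B2 : 0 < d + h * Q) by nra. assert (B3 : 0 < h * P) by nra.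
    unfold pole_prim. replace (RtoC (f h) + Ci * RtoC (g h))%C with ((f h, g h) : C) by (unfold Ci, Cplus, Cmult, RtoC; simpl; f_equal; ring).
    f_equal. unfold f.
    assert (X : forall x, 0 < x -> atan (x / (h * P)) = PI / 2 - atan (h * P / x)).
    { intros x Hx. replace (h * P / x) with (/ (x / (h * P))) by (field; lra). rewrite atan_inv; [ring|].
      now apply Rdiv_lt_0_compat. }
    rewrite !X by assumption. field.
  - replace (RtoC PI) with (RtoC (f 0) + Ci * RtoC (g 0))%C by (rewrite F0, G0; ring).
    apply Clim_plus; [|apply Clim_scal]; apply Clim_RtoC; now apply continuous_filterlim_at_right.
Qed.

(** With alpha = 2 pi h w, the integral of 2 / (t^2 + alpha^2) over (0, d) is asymptotic to pi /
    alpha = 1 / (2 h w). All other contributions to J stay bounded as h -> 0 and disappear after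
    multiplication by h. *)
Lemma J_near_0 (w : C) : strip w -> Clim (at_right 0) (fun h => RtoC h * J (RtoC h * w))%C (/ (2 * w)).
Proof.
  intros Hw. assert (Pp := PI_RGT_0). assert (W0 := Re_pos_neq_0' w (proj1 Hw)).
  set (a := (RtoC (2 * PI) * w)%C).
  assert (HaR : 0 < Re a). { unfold a. rewrite Re_scal. unfold strip in Hw. nra. }
  assert (Ha0 : a <> 0%C) by now apply Re_pos_neq_0'.
  assert (Hac : 0 < Cmod a) by now apply Cmod_gt_0.
  (* The squared cosine of the argument of [a], which is the same for all points [h * a] of the
     ray. *)
  set (rho := Re a ^ 2 / Cmod a ^ 2).
  assert (Hac2 : 0 < Cmod a ^ 2) by (apply pow_lt; exact Hac).
  assert (HR2 : 0 < Re a ^ 2) by (apply pow_lt; exact HaR).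
  assert (Hr : 0 < rho <= 1).
  { unfold rho. split; [now apply Rdiv_lt_0_compat|]. apply Rle_div_l; [exact Hac2|]. rewrite Cmod_sq.
    assert (X := pow2_ge_0 (Im a)). lra. }
  set (d := rho / 96).
  assert (Hd : 0 < d) by (unfold d; lra). assert (Hd1 : d <= 1 / 96) by (unfold d; lra).
  assert (Hd2 : d ^ 2 <= rho / 96) by (fold d; nra).
  (* Chosen so that [(1 - s) * (1 + d ^ 2 / 2) = 1 + d ^ 2 / 4]. For [t >= d] one has
     [cosh t >= 1 + d ^ 2 / 2], while the cosine will be bounded by [1 + d ^ 2 / 4]; the denominator
     then keeps the fraction [s] of [cosh t]. *)
  set (s := (d ^ 2 / 4) / (1 + d ^ 2 / 2)).
  assert (Hs : 0 < s) by (unfold s; apply Rdiv_lt_0_compat; nra).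
  (* The three summands bound the kernel without its poles on (0, d), the logarithm at the cut [d],
     and the tail beyond [d]. *)
  set (K := 640 / rho ^ 2 * d + Rabs (ln d) + 6 / (s * d)).
  apply (Clim_ext_loc (F := at_right 0) (fun h => (pole_prim (h * Re a) (h * Im a) d / a) +
     (RtoC h * J (RtoC h * w) - pole_prim (h * Re a) (h * Im a) d / a))%C).
  { apply filter_forall. intros h. ring. }
  replace (/ (2 * w))%C with (RtoC PI / a + 0)%C.
  2: { unfold a. rewrite RtoC_mult. field. split; [exact W0|]. apply RtoC_neq_0; lra. }
  apply Clim_plus.
  { apply (Clim_mult (F := at_right 0)); [now apply pole_prim_lim|apply Clim_const]. }
  apply (Clim_le (F := at_right 0)) with (fun h => h * K).
  2: { assert (X := continuous_filterlim_at_right (fun h => h * K)). cbv beta in X. rewrite Rmult_0_l in X.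
       apply X.
       apply (ex_derive_continuous (V := R_NormedModule)). now auto_derive. }
  assert (He : 0 < Rmin 1 (d / 4 / Cmod a)). { apply Rmin_pos; [lra|]. apply Rdiv_lt_0_compat; lra. }
  generalize (at_right_lt _ He). apply filter_imp. intros h [H0 H1].
  assert (Hh1 := Rlt_le_trans _ _ _ H1 (Rmin_l _ _)). assert (Hh2 := Rlt_le_trans _ _ _ H1 (Rmin_r _ _)).
  apply Rlt_div_r in Hh2; [|exact Hac].
  set (v := (RtoC h * w)%C). set (al := (RtoC h * a)%C).
  assert (Sv : strip v) by (unfold strip, v in *; rewrite Re_scal; nra).
  assert (Eal : al = (RtoC (2 * PI) * v)%C) by (unfold al, v, a; ring).
  assert (Mal : Cmod al = h * Cmod a) by (unfold al; rewrite Cmod_mult, Cmod_R, Rabs_pos_eq; lra).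
  assert (Pal : al = (h * Re a, h * Im a)).
  { unfold al. destruct a as [x y]. unfold Cmult, RtoC, Re, Im; simpl. f_equal; ring. }
  assert (Ral : rho * Cmod al ^ 2 <= Re al ^ 2).
  { rewrite Mal. unfold al at 1. rewrite Re_scal. right. unfold rho. field. lra. }
  assert (Hpole := is_CRInt_pole (h * Re a) (h * Im a) d ltac:(nra) (Rlt_le _ _ Hd)). rewrite <- Pal in Hpole.
  assert (B1 : Cmod (kernel_int v d - pole_prim (h * Re a) (h * Im a) d / al) <= 640 / rho ^ 2 * d).
  { assert (X := is_RInt_const_R 0 d (640 / rho ^ 2)).
    replace ((d - 0) * (640 / rho ^ 2)) with (640 / rho ^ 2 * d) in X by ring.
    refine (Cmod_is_CRInt_le _ _ 0 d _ _ (Rlt_le _ _ Hd) _ (is_CRInt_minus _ _ _ _ _ _ (is_CRInt_CRInt _ _ _ (ex_CRInt_kernel v 0 d Sv)) Hpole) X).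
    intros t Ht. apply (kernel_near_pole al v rho d t); try assumption. rewrite Mal. nra. }
  assert (Bc : Cmod (ccos2pi v) <= 1 + d ^ 2 / 4).
  { assert (X := ccos2pi_taylor al v Eal ltac:(lra)).
    replace (ccos2pi v) with (1 + ((ccos2pi v - 1 + al * al / 2) + al * al * RtoC (- / 2)))%C.
    2: { rewrite RtoC_opp, RtoC_inv by lra. field. }
    apply Rle_trans with (1 := Cmod_triangle _ _). rewrite Cmod_1. apply Rplus_le_compat_l.
    apply Rle_trans with (1 := Cmod_triangle _ _). rewrite !Cmod_mult, Cmod_R, Rabs_Ropp, Rabs_pos_eq by lra.
    rewrite Mal in *. set (m := h * Cmod a) in *. assert (Hm : 0 < m < d / 4) by (split; [unfold m; apply Rmult_lt_0_compat; lra|exact Hh2]).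
    assert (M2 : m * m <= d / 4 * (d / 4)) by nra.
    assert (M4 : m ^ 4 <= m * m). { replace (m ^ 4) with (m * m * (m * m)) by ring.
    assert (m * m <= 1) by nra. nra. }
    nra. }
  assert (Hden : forall t, d <= t -> s * cosh t <= Cmod (RtoC (cosh t) - ccos2pi v)).
  { intros t Ht. assert (CL := cosh_lower t ltac:(lra)). assert (C1 := cosh_ge_1 t).
    assert (TT := Cmod_triangle (RtoC (cosh t) - ccos2pi v) (ccos2pi v)).
    replace (RtoC (cosh t) - ccos2pi v + ccos2pi v)%C with (RtoC (cosh t)) in TT by ring.
    rewrite Cmod_R, Rabs_pos_eq in TT by lra.
    assert (CL2 : 1 + d ^ 2 / 2 <= cosh t).
    { assert (d ^ 2 <= t ^ 2) by (apply pow_incr; lra). lra. }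
    assert (D2 : 0 < d ^ 2) by (apply pow_lt; lra).
    assert (Es : s * (1 + d ^ 2 / 2) = d ^ 2 / 4) by (unfold s; field; lra).
    assert (s <= 1) by nra.
    assert ((1 - s) * (1 + d ^ 2 / 2) <= (1 - s) * cosh t) by (apply Rmult_le_compat_l; lra). lra. }
  assert (B2 : Cmod (J v - (kernel_int v d - RtoC (ln d))) <= 6 / (s * d)).
  { refine (Cmod_Clim_le (F := Rbar_locally p_infty) _ _ _ _ (Clim_minus _ _ _ _ (J_lim v Sv) (Clim_const (kernel_int v d - RtoC (ln d))%C))).
    exists d. intros T HT.
    apply Rle_trans with (1 := kernel_tail v s d T Sv Hs Hd (Rlt_le _ _ HT) Hden).
    assert (Ex : exp (- d) <= 1) by (rewrite <- exp_0; apply exp_le_compat; lra).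
    assert (Hsd : 0 < / (s * d)) by (apply Rinv_0_lt_compat; nra).
    assert (Q : 2 * (Cmod (ccos2pi v) + 1) <= 6) by nra.
    assert (Q0 := Cmod_ge_0 (ccos2pi v)).
    assert (Q2 : 2 * (Cmod (ccos2pi v) + 1) * / (s * d) <= 6 * / (s * d)) by (apply Rmult_le_compat_r; lra).
    unfold Rdiv. assert (Q3 := exp_pos (- d)). nra. }
  replace (RtoC h * J v - pole_prim (h * Re a) (h * Im a) d / a - 0)%C
   with (RtoC h * ((kernel_int v d - pole_prim (h * Re a) (h * Im a) d / al) + (- RtoC (ln d) + (J v - (kernel_int v d - RtoC (ln d))))))%C.
  2: { unfold al. field. split; [exact Ha0|]. apply RtoC_neq_0; lra. }
  rewrite Cmod_mult, Cmod_R, Rabs_pos_eq by lra. apply Rmult_le_compat_l; [lra|].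
  apply Rle_trans with (1 := Cmod_triangle _ _). unfold K. rewrite Rplus_assoc.
  apply Rplus_le_compat; [exact B1|].
  apply Rle_trans with (1 := Cmod_triangle _ _). rewrite Cmod_opp, Cmod_R. lra.
Qed.

(** * The constant *)

Lemma filterlim_pow_half : filterlim (fun n => (/ 2) ^ n) eventually (at_right 0).
Proof.
  intros P [e He].
  assert (L : is_lim_seq (fun n => (/ 2) ^ n) 0) by (apply is_lim_seq_geom; rewrite Rabs_pos_eq; lra).
  assert (H := proj1 (filterlim_locally _ _) L e).
  unfold filtermap. apply (filter_imp (F := eventually) (fun n => ball 0 e ((/ 2) ^ n))); [|exact H].
  intros n Hn. apply He; [exact Hn|apply pow_half_bounds].
Qed.

Lemma filterlim_mult_at_right (K : R) : filterlim (fun h => h * K) (at_right 0) (locally 0).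
Proof.
  assert (X := continuous_filterlim_at_right (fun h => h * K)). cbv beta in X. rewrite Rmult_0_l in X.
  apply X.
  apply (ex_derive_continuous (V := R_NormedModule)). now auto_derive.
Qed.

Lemma ccot_near_0 (w : C) : strip w -> Clim (at_right 0) (fun h => RtoC h * ccot (RtoC h * w))%C (/ (2 * w)).
Proof.
  intros Hw. assert (Pp := PI_RGT_0). assert (W0 := Re_pos_neq_0' w (proj1 Hw)).
  set (b := (RtoC (2 * PI) * Ci * w)%C).
  assert (P0 : RtoC PI <> 0%C) by (apply RtoC_neq_0; lra).
  assert (I0 : Ci <> 0%C) by (intro E; injection E; lra).
  assert (Hb : b <> 0%C).
  { unfold b. rewrite RtoC_mult. repeat apply Cmult_neq_0; try assumption. apply RtoC_neq_0; lra. }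
  assert (Hsm := at_right_lt 1 Rlt_0_1).
  assert (L1 : Clim (at_right 0) (fun h => ((cexp2pi (RtoC h * w) - 1) / RtoC h))%C b).
  { apply (Clim_le (F := at_right 0)) with (fun h => h * (Cmod b ^ 2 * exp (Cmod b))); [|apply filterlim_mult_at_right].
    revert Hsm. apply filter_imp. intros h [H0 H1].
    assert (Hh : RtoC h <> 0%C) by (apply RtoC_neq_0; lra).
    unfold cexp2pi. replace (RtoC (2 * PI) * Ci * (RtoC h * w))%C with (RtoC h * b)%C by (unfold b; ring).
    replace ((Cexp (RtoC h * b) - 1) / RtoC h - b)%C with ((Cexp (RtoC h * b) - 1 - RtoC h * b) / RtoC h)%C by (field; exact Hh).
    rewrite Cmod_div by exact Hh. rewrite Cmod_R, Rabs_pos_eq by lra. apply Rle_div_l; [exact H0|].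
    apply Rle_trans with (1 := Cexp_taylor_1 _). rewrite Cmod_mult, Cmod_R, Rabs_pos_eq by lra.
    replace (h * (Cmod b ^ 2 * exp (Cmod b)) * h) with ((h * Cmod b) ^ 2 * exp (Cmod b)) by ring.
    apply Rmult_le_compat_l; [apply pow2_ge_0|]. apply exp_le_compat. assert (X := Cmod_ge_0 b). nra. }
  assert (L2 : Clim (at_right 0) (fun h => RtoC h * ((cexp2pi (RtoC h * w) - 1) / RtoC h) + 2)%C (0 * b + 2)%C).
  { apply Clim_plus; [|apply Clim_const]. apply Clim_mult; [|exact L1].
    apply Clim_RtoC. assert (X := filterlim_mult_at_right 1). revert X. apply filterlim_ext. intro; ring. }
  assert (L3 := Clim_scal (RtoC PI * Ci / 2)%C _ _ (Clim_mult _ _ _ _ L2 (Clim_inv _ _ Hb L1))).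
  replace (/ (2 * w))%C with (RtoC PI * Ci / 2 * ((0 * b + 2) * / b))%C.
  2: { unfold b. rewrite RtoC_mult. field. repeat split; assumption. }
  revert L3. apply Clim_ext_loc. revert Hsm. apply filter_imp. intros h [H0 H1].
  assert (Hh : RtoC h <> 0%C) by (apply RtoC_neq_0; lra).
  assert (N : (cexp2pi (RtoC h * w) - 1)%C <> 0%C).
  { apply cexp2pi_minus_1_neq_0. unfold strip in *. rewrite Re_scal. nra. }
  unfold ccot. field. now split.
Qed.

Definition defect (w : C) : C := (J w + ccot w + digamma w)%C.

Lemma digamma_pole_bound (w : C) : 0 < Re w -> Cmod (digamma w + / w) <= Cmod (digamma 1 + / 1) + 2 * Cmod (w - 1).
Proof.
  intros Hw. assert (H := digamma_lipschitz w 1 Hw ltac:(simpl; lra)).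
  replace (digamma w + / w)%C with ((digamma 1 + / 1) + (digamma w + / w - (digamma 1 + / 1)))%C by ring.
  apply Rle_trans with (1 := Cmod_triangle _ _). lra.
Qed.

Lemma digamma_near_0 (w : C) : strip w -> Clim (at_right 0) (fun h => RtoC h * digamma (RtoC h * w))%C (- / w).
Proof.
  intros Hw. assert (W0 := Re_pos_neq_0' w (proj1 Hw)).
  apply (Clim_le (F := at_right 0)) with (fun h => h * (Cmod (digamma 1 + / 1) + 2 * (Cmod w + 1))); [|apply filterlim_mult_at_right].
  generalize (at_right_lt 1 Rlt_0_1). apply filter_imp. intros h [H0 H1].
  assert (Hh : RtoC h <> 0%C) by (apply RtoC_neq_0; lra).
  replace (RtoC h * digamma (RtoC h * w) - - / w)%C with (RtoC h * (digamma (RtoC h * w) + / (RtoC h * w)))%C by (field; now split).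
  rewrite Cmod_mult, Cmod_R, Rabs_pos_eq by lra. apply Rmult_le_compat_l; [lra|].
  apply Rle_trans with (1 := digamma_pole_bound (RtoC h * w) ltac:(unfold strip in Hw; rewrite Re_scal; nra)).
  apply Rplus_le_compat_l, Rmult_le_compat_l; [lra|].
  apply Rle_trans with (1 := Cmod_triangle _ _).
  rewrite Cmod_opp, Cmod_1, Cmod_mult, Cmod_R, Rabs_pos_eq by lra.
  assert (X := Cmod_ge_0 w). nra.
Qed.

Lemma digamma_near_1 (w : C) : strip w -> Clim (at_right 0) (fun h => RtoC h * digamma (1 - RtoC h * w))%C 0.
Proof.
  intros Hw.
  apply (Clim_le (F := at_right 0)) with (fun h => h * (Cmod (digamma 1 + / 1) + 2 * Cmod w + / (1 - Re w))); [|apply filterlim_mult_at_right].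
  generalize (at_right_lt 1 Rlt_0_1). apply filter_imp. intros h [H0 H1].
  replace (RtoC h * digamma (1 - RtoC h * w) - 0)%C with (RtoC h * digamma (1 - RtoC h * w))%C by ring.
  rewrite Cmod_mult, Cmod_R, Rabs_pos_eq by lra. apply Rmult_le_compat_l; [lra|].
  set (u := (1 - RtoC h * w)%C). unfold strip in Hw.
  assert (Ru : 1 - Re w <= Re u). { unfold u.
  replace (Re (1 - RtoC h * w)) with (1 - Re (RtoC h * w)) by reflexivity. rewrite Re_scal. nra. }
  assert (U0 : u <> 0%C) by (apply Re_pos_neq_0'; lra).
  replace (digamma u) with ((digamma u + / u) + - / u)%C by ring.
  apply Rle_trans with (1 := Cmod_triangle _ _). rewrite Cmod_opp, Cmod_inv by exact U0.
  apply Rplus_le_compat.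
  - apply Rle_trans with (1 := digamma_pole_bound u ltac:(lra)).
    apply Rplus_le_compat_l, Rmult_le_compat_l; [lra|].
    replace (u - 1)%C with (- (RtoC h * w))%C by (unfold u; ring).
    rewrite Cmod_opp, Cmod_mult, Cmod_R, Rabs_pos_eq by lra.
    assert (X := Cmod_ge_0 w). nra.
  - apply Rinv_le_contravar; [lra|]. assert (X := Re_le_Cmod u). lra.
Qed.

(** The residues at 0 are 1/2 for J, 1/2 for the cotangent term and -1 for psi. *)
Lemma defect_subpolar : subpolar defect.
Proof.
  intros w Hw. assert (W0 := Re_pos_neq_0' w (proj1 Hw)).
  apply (Clim_comp eventually (at_right 0) (fun n => (/ 2) ^ n) (fun h => RtoC h * defect (RtoC h * w))%C 0 filterlim_pow_half).
  replace (RtoC 0) with (/ (2 * w) + / (2 * w) + - / w)%C by (field; exact W0).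
  apply (Clim_ext (F := at_right 0)) with (2 := Clim_plus (F := at_right 0) _ _ _ _ (Clim_plus _ _ _ _ (J_near_0 w Hw) (ccot_near_0 w Hw)) (digamma_near_0 w Hw)).
  intro h. unfold defect. ring.
Qed.

(** In the reflected variable J still contributes 1/2, the odd cotangent term contributes -1/2, and
    psi is regular at 1. *)
Lemma defect_subpolar_sym : subpolar (fun w => defect (1 - w)).
Proof.
  intros w Hw. assert (W0 := Re_pos_neq_0' w (proj1 Hw)).
  apply (Clim_comp eventually (at_right 0) (fun n => (/ 2) ^ n) (fun h => RtoC h * defect (1 - RtoC h * w))%C 0 filterlim_pow_half).
  replace (RtoC 0) with (/ (2 * w) - / (2 * w) + 0)%C by ring.
  apply (Clim_ext_loc (F := at_right 0)) with (2 := Clim_plus (F := at_right 0) _ _ _ _ (Clim_minus _ _ _ _ (J_near_0 w Hw) (ccot_near_0 w Hw)) (digamma_near_1 w Hw)).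
  generalize (at_right_lt 1 Rlt_0_1). apply filter_imp. intros h [H0 H1].
  unfold defect. rewrite J_sym, ccot_sym; [ring|]. unfold strip in *. rewrite Re_scal. nra.
Qed.

Lemma defect_averaging : averaging defect.
Proof.
  intros w Hw. unfold defect.
  rewrite (J_duplication w Hw), (ccot_duplication w Hw), (digamma_duplication w (proj1 Hw)).
  field.
Qed.

Lemma defect_lip_mid (Y : R) : exists M, 0 <= M /\ lip_mid defect Y M.
Proof.
  set (M1 := 32 * (exp (2 * PI * Y) * (2 * PI))).
  set (M2 := PI * (exp (2 * PI * Y) * (exp (2 * PI * Y) * (2 * PI)))).
  assert (P := PI_RGT_0). assert (E := exp_pos (2 * PI * Y)).
  (* [38 = 2 + 36]: the constant of [digamma_lipschitz] and that of [/ w], as [Cmod w >= 1 / 6] on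
     [mid]. *)
  exists (M1 + M2 + 38). split.
  { assert (0 <= M1) by (unfold M1; apply Rmult_le_pos; [lra|apply Rmult_le_pos; lra]).
    assert (0 <= M2) by (unfold M2; apply Rmult_le_pos; [lra|apply Rmult_le_pos; [lra|apply Rmult_le_pos; lra]]). lra. }
  intros w v Hw Hv _.
  assert (A := J_lipschitz Y w v Hw Hv). assert (B := ccot_lipschitz Y w v Hw Hv). fold M1 in A. fold M2 in B.
  assert (Rw : 1 / 6 <= Re w) by apply Hw. assert (Rv : 1 / 6 <= Re v) by apply Hv.
  assert (D := digamma_lipschitz w v ltac:(lra) ltac:(lra)).
  assert (W0 := Re_pos_neq_0' w ltac:(lra)). assert (V0 := Re_pos_neq_0' v ltac:(lra)).
  assert (F : Cmod (/ v - / w) <= 36 * Cmod (w - v)).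
  { replace (/ v - / w)%C with ((w - v) / (v * w))%C by (field; now split).
    rewrite Cmod_div, Cmod_mult by now apply Cmult_neq_0.
    assert (X1 := Re_le_Cmod w). assert (X2 := Re_le_Cmod v).
    apply Rle_div_l; [nra|]. assert (X3 := Cmod_ge_0 (w - v)).
    assert (1 <= 36 * (Cmod v * Cmod w)) by nra. nra. }
  unfold defect.
  replace (J w + ccot w + digamma w - (J v + ccot v + digamma v))%C
   with ((J w - J v) + ((ccot w - ccot v) + ((digamma w + / w - (digamma v + / v)) + (/ v - / w))))%C by ring.
  apply Rle_trans with (1 := Cmod_triangle _ _).
  assert (T1 := Cmod_triangle (ccot w - ccot v) ((digamma w + / w - (digamma v + / v)) + (/ v - / w))).
  assert (T2 := Cmod_triangle (digamma w + / w - (digamma v + / v)) (/ v - / w)). lra.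
Qed.

Lemma defect_constant (w v : C) : 0 < Re w <= 2 / 3 -> 0 < Re v <= 2 / 3 -> defect w = defect v.
Proof.
  apply averaging_constant; [exact defect_averaging|exact defect_subpolar|exact defect_subpolar_sym|exact defect_lip_mid].
Qed.

(** * The line Re w = 1/2 and the value of the constant *)

Definition half_line (y : R) : C := (1 / 2, y).

Lemma cexp2pi_half_line (y : R) : cexp2pi (half_line y) = RtoC (- exp (- (2 * PI * y))).
Proof.
  unfold half_line. rewrite cexp2pi_pair. replace (2 * PI * (1 / 2)) with PI by field. rewrite cos_PI, sin_PI.
  unfold RtoC; f_equal; ring.
Qed.

(** The cosine is real and negative on this line, so that the kernel is real and its denominator is
    a sum of two positive terms. *)
Lemma ccos2pi_half_line (y : R) : ccos2pi (half_line y) = RtoC (- cosh (2 * PI * y)).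
Proof.
  unfold half_line. rewrite ccos2pi_pair. replace (2 * PI * (1 / 2)) with PI by field. rewrite cos_PI, sin_PI.
  unfold RtoC; f_equal; ring.
Qed.

Lemma kernel_half_line (y t : R) : kernel (half_line y) t = RtoC (sinhc t / (cosh t + cosh (2 * PI * y))).
Proof.
  unfold kernel. rewrite ccos2pi_half_line, <- RtoC_minus, <- RtoC_div.
  - f_equal. f_equal. ring.
  - assert (A := cosh_ge_1 t). assert (B := cosh_ge_1 (2 * PI * y)). lra.
Qed.

Lemma Im_CRInt_RtoC (f : R -> R) (g : R -> C) (a b : R) (l : C) :
  (forall t, g t = RtoC (f t)) -> is_CRInt g a b l -> Im l = 0.
Proof.
  intros E H. assert (H2 := is_RInt_fct_extend_snd (U := R_NormedModule) (V := R_NormedModule) g a b l H).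
  apply (is_RInt_ext (V := R_NormedModule) _ (fun _ => 0)) in H2.
  2: { intros t _. now rewrite E. }
  assert (H3 := is_RInt_const_R a b 0). rewrite Rmult_0_r in H3.
  apply (is_RInt_unique (V := R_CompleteNormedModule)) in H2.
  apply (is_RInt_unique (V := R_CompleteNormedModule)) in H3.
  transitivity (RInt (fun _ : R => 0) a b); [symmetry; exact H2|exact H3].
Qed.

Lemma strip_half_line (y : R) : strip (half_line y).
Proof. unfold strip; simpl; lra. Qed.

Lemma Im_J_half_line (y : R) : Im (J (half_line y)) = 0.
Proof.
  assert (H := Clim_Im (F := Rbar_locally p_infty) _ _ (J_lim _ (strip_half_line y))).
  apply (filterlim_locally_unique (F := Rbar_locally p_infty) (fun T => Im (kernel_int (half_line y) T - RtoC (ln T)))); [exact H|].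
  apply (filterlim_ext (fun _ => 0)); [|apply filterlim_const].
  intro T. replace (Im (kernel_int (half_line y) T - RtoC (ln T))) with (Im (kernel_int (half_line y) T)).
  - symmetry. apply (Im_CRInt_RtoC _ _ _ _ _ (kernel_half_line y) (is_CRInt_CRInt _ _ _ (ex_CRInt_kernel _ 0 T (strip_half_line y)))).
  - unfold Im, Cminus, Cplus, Copp, RtoC; simpl. ring.
Qed.

Lemma ccot_half_line (y : R) : ccot (half_line y) = (RtoC (PI / 2 * ((1 - exp (- (2 * PI * y))) / (- exp (- (2 * PI * y)) - 1))) * Ci)%C.
Proof.
  unfold ccot. rewrite cexp2pi_half_line.
  assert (P := exp_pos (- (2 * PI * y))). set (e := exp (- (2 * PI * y))) in *.
  rewrite RtoC_mult, !RtoC_div, !RtoC_minus, RtoC_opp by lra. field.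
  rewrite <- RtoC_opp, <- RtoC_minus. intro E; apply RtoC_inj in E; lra.
Qed.

Lemma cosh_le_exp (t : R) : 0 <= t -> cosh t <= exp t.
Proof. intros Ht. unfold cosh. assert (exp (- t) <= exp t) by (apply exp_le_compat; lra). lra. Qed.

(** With Y = 2 pi y the kernel is sinh t / (t (cosh t + cosh Y)): it is small before Y and close to
    1 / t after Y, so the regularized integral is close to - ln Y. The constant is [38 = 34 + 4],
    one part for each side of Y. *)
Lemma J_half_line_bound (y : R) : 1 <= y -> Cmod (J (half_line y) + RtoC (ln (2 * PI * y))) <= 38 / (2 * PI * y).
Proof.
  intros Hy. set (Y := 2 * PI * y).
  assert (HY : 2 <= Y) by (unfold Y; generalize PI2_1; unfold PI2; nra).
  assert (Sy := strip_half_line y).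
  assert (HC := cosh_ge_1 Y). assert (IC := inv_cosh_le Y). assert (EY := exp_pos Y).
  assert (EE : exp Y * exp (- Y) = 1) by (rewrite <- exp_plus, Rplus_opp_r; apply exp_0).
  assert (B1 : Cmod (kernel_int (half_line y) Y) <= 34 / Y).
  (* [sinhc t] is at most [exp (Y / 2)] for [t <= Y / 2], and at most [exp t / (2 * t) <= exp t / Y]
     beyond. *)
  { set (g := fun t => 2 * exp (- Y) * (exp (Y / 2) + / Y * exp t)).
    assert (Hg : is_RInt g 0 Y (2 * exp (- Y) * (Y * exp (Y / 2) + / Y * (exp Y - exp 0)))).
    { apply (is_RInt_scal (V := R_NormedModule)). apply (is_RInt_plus (V := R_NormedModule)).
      - replace (Y * exp (Y / 2)) with ((Y - 0) * exp (Y / 2)) by ring. apply is_RInt_const_R.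
      - apply (is_RInt_scal (V := R_NormedModule)). apply (is_RInt_derive (V := R_CompleteNormedModule) exp).
        + intros x _. apply is_derive_exp.
        + intros x _. apply continuous_exp. }
    apply Rle_trans with (2 * exp (- Y) * (Y * exp (Y / 2) + / Y * (exp Y - exp 0))).
    - refine (Cmod_is_CRInt_le _ g 0 Y _ _ ltac:(lra) _ (is_CRInt_CRInt _ _ _ (ex_CRInt_kernel _ 0 Y Sy)) Hg).
      intros t Ht. rewrite kernel_half_line, Cmod_R. fold Y.
      assert (B := sinhc_bounds t). assert (Ct := cosh_ge_1 t).
      rewrite Rabs_pos_eq by (apply Rle_mult_inv_pos; lra).
      assert (S : sinhc t <= exp (Y / 2) + / Y * exp t).
      { assert (Pt := exp_pos t). assert (IY : 0 < / Y) by (apply Rinv_0_lt_compat; lra).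
        destruct (Rle_dec t (Y / 2)).
        - apply Rle_trans with (1 := proj2 B). apply Rle_trans with (1 := cosh_le_exp t (proj1 Ht)).
          assert (exp t <= exp (Y / 2)) by now apply exp_le_compat. nra.
        - unfold sinhc. destruct Req_EM_T; [lra|].
          assert (sinh t / t <= / Y * exp t); [|generalize (exp_pos (Y / 2)); lra].
          apply Rle_div_l; [lra|]. apply Rle_trans with (exp t / 2). { unfold sinh.
          generalize (exp_pos (- t)); lra. }
          apply Rmult_le_reg_l with Y; [lra|].
          replace (Y * (/ Y * exp t * t)) with (t * exp t) by (field; lra). nra. }
      unfold g. rewrite (Rmult_comm (2 * exp (- Y))). unfold Rdiv.
      apply Rmult_le_compat; [lra|left; apply Rinv_0_lt_compat; lra|exact S|].
      apply Rle_trans with (2 := IC). apply Rinv_le_contravar; lra.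
    (* [Q] gives [Y ^ 2 * exp (- (Y / 2)) <= 16]; hence [34 = 2 * 16 + 2]. *)
    - assert (Q := one_sq_le_exp (Y / 2) ltac:(lra)).
      assert (Eh : exp (- Y) * exp (Y / 2) * exp (Y / 2) = 1) by (rewrite <- !exp_plus; replace (- Y + Y / 2 + Y / 2) with 0 by field; apply exp_0).
      set (x := exp (Y / 2)) in *. set (n := exp (- Y)) in *. assert (Hn : 0 < n) by apply exp_pos.
      rewrite exp_0. apply Rmult_le_reg_r with Y; [lra|]. unfold Rdiv at 1.
      rewrite (Rmult_assoc 34), Rinv_l by lra.
      replace (2 * n * (Y * x + / Y * (exp Y - 1)) * Y) with (2 * (Y ^ 2 * (n * x)) + 2 * (exp Y * n) - 2 * n) by (field; lra).
      rewrite EE. assert (Hx : 0 < x) by apply exp_pos.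
      assert (A : n * x * (Y ^ 2) <= n * x * (16 * x)).
      { apply Rmult_le_compat_l; [left; now apply Rmult_lt_0_compat|lra]. }
      nra. }
  assert (B2 : forall T, Y < T -> Cmod (kernel_int (half_line y) T - kernel_int (half_line y) Y - RtoC (ln T - ln Y)) <= 4 / Y).
  { intros T HT.
    assert (Hi : is_CRInt (fun t => kernel (half_line y) t - RtoC (/ t))%C Y T (kernel_int (half_line y) T - kernel_int (half_line y) Y - RtoC (ln T - ln Y))%C).
    { apply is_CRInt_minus.
      - replace (kernel_int (half_line y) T - kernel_int (half_line y) Y)%C with (CRInt (kernel (half_line y)) Y T); [apply is_CRInt_CRInt; now apply ex_CRInt_kernel|].
        assert (H := RInt_Chasles (V := C_R_CompleteNormedModule) (kernel (half_line y)) 0 Y T (ex_CRInt_kernel _ 0 Y Sy) (ex_CRInt_kernel _ Y T Sy)).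
        assert (X : forall a b : C, b = (a + b - a)%C) by (intros; ring).
        unfold kernel_int. rewrite <- H. apply X.
      - apply is_CRInt_RtoC. apply (is_RInt_derive (V := R_CompleteNormedModule) ln);
        rewrite Rmin_left, Rmax_right by lra; intros x Hx.
        + auto_derive; [lra|ring].
        + apply continuous_Rinv; lra. }
    apply Rle_trans with (4 * exp Y / Y * (exp (- Y) - exp (- T))).
    - refine (Cmod_is_CRInt_le _ (fun t => 4 * exp Y / Y * exp (- t)) Y T _ _ (Rlt_le _ _ HT) _ Hi _).
      2: { apply (is_RInt_scal (V := R_NormedModule)), is_RInt_exp_opp. }
      intros t Ht. rewrite kernel_half_line, <- RtoC_minus, Cmod_R. fold Y.
      assert (Ct := cosh_ge_1 t).
      assert (E : sinhc t / (cosh t + cosh Y) - / t = - ((exp (- t) + cosh Y) / (t * (cosh t + cosh Y)))).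
      { unfold sinhc. destruct Req_EM_T; [lra|].
        replace (sinh t) with (cosh t - exp (- t)) by (unfold sinh, cosh; field). field. split; lra. }
      rewrite E, Rabs_Ropp.
      assert (Et : exp (- t) <= 1) by (rewrite <- exp_0; apply exp_le_compat; lra).
      assert (Pt := exp_pos (- t)).
      rewrite Rabs_pos_eq by (apply Rle_mult_inv_pos; [lra|apply Rmult_lt_0_compat; lra]).
      assert (C2 := cosh_le_exp Y ltac:(lra)). assert (It := inv_cosh_le t).
      apply Rle_trans with (2 * exp Y * (/ Y * / cosh t)).
      + unfold Rdiv. apply Rmult_le_compat; [lra|left; apply Rinv_0_lt_compat, Rmult_lt_0_compat; lra|lra|].
        rewrite <- Rinv_mult. apply Rinv_le_contravar; [apply Rmult_lt_0_compat; lra|].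
        apply Rmult_le_compat; lra.
      + replace (4 * exp Y / Y * exp (- t)) with (2 * exp Y * (/ Y * (2 * exp (- t)))) by (field; lra).
        apply Rmult_le_compat_l; [lra|].
        apply Rmult_le_compat_l; [left; apply Rinv_0_lt_compat; lra|exact It].
    - replace (4 * exp Y / Y * (exp (- Y) - exp (- T))) with (4 / Y * (exp Y * exp (- Y)) - 4 / Y * (exp Y * exp (- T))) by (field; lra).
      rewrite EE. assert (0 <= 4 / Y * (exp Y * exp (- T))); [|lra].
      apply Rmult_le_pos; [apply Rle_mult_inv_pos; lra|]. left; apply Rmult_lt_0_compat; apply exp_pos. }
  refine (Cmod_Clim_le (F := Rbar_locally p_infty) _ _ _ _ (Clim_plus _ _ _ _ (J_lim _ Sy) (Clim_const (RtoC (ln Y))))).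
  exists Y. intros T HT.
  replace (kernel_int (half_line y) T - RtoC (ln T) + RtoC (ln Y))%C with (kernel_int (half_line y) Y + (kernel_int (half_line y) T - kernel_int (half_line y) Y - RtoC (ln T - ln Y)))%C by (rewrite RtoC_minus; ring).
  apply Rle_trans with (1 := Cmod_triangle _ _). specialize (B2 T HT).
  replace (38 / Y) with (34 / Y + 4 / Y) by (field; lra). lra.
Qed.

(** The real part of J is near - ln (2 pi y), that of psi is near ln y, and the cotangent is purely
    imaginary on this line. *)
Lemma Re_defect (y : R) : 2 <= y -> Rabs (Re (defect (half_line y)) + ln (2 * PI)) <= 40 / (y - 1).
Proof.
  intros Hy. assert (PP := PI2_1). unfold PI2 in PP. assert (P2 : 2 <= 2 * PI) by lra.
  assert (A := J_half_line_bound y ltac:(lra)). assert (B := Re_digamma_half_line y Hy).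
  fold (half_line y) in B.
  assert (R1 : Rabs (Re (J (half_line y)) + ln (2 * PI * y)) <= 38 / (2 * PI * y)).
  { apply Rle_trans with (2 := A).
    assert (X := Rmax_Cmod (J (half_line y) + RtoC (ln (2 * PI * y)))%C). apply Rle_trans with (2 := X).
    apply Rmax_l. }
  assert (R2 : 38 / (2 * PI * y) <= 38 / (y - 1)).
  { unfold Rdiv. apply Rmult_le_compat_l; [lra|]. apply Rinv_le_contravar; nra. }
  replace (Re (defect (half_line y))) with (Re (J (half_line y)) + Re (digamma (half_line y))).
  2: { unfold defect. rewrite ccot_half_line. unfold Ci, Cplus, Cmult, RtoC, Re; simpl. ring. }
  rewrite ln_mult in R1 by lra.
  replace (40 / (y - 1)) with (38 / (y - 1) + 2 / (y - 1)) by (field; lra).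
  revert R1 B. unfold Rabs. repeat destruct Rcase_abs; lra.
Qed.

(** Letting [y] tend to infinity determines the real part only, since [Re_digamma_half_line] says
    nothing about the argument. The imaginary part is read off at w = 1/2, where J and psi are real
    and cot (pi / 2) = 0. *)
Theorem defect_value (w : C) : 0 < Re w <= 2 / 3 -> defect w = RtoC (- ln (2 * PI)).
Proof.
  intros Hw.
  assert (E : forall y, defect w = defect (half_line y)) by (intro y; apply defect_constant; [exact Hw|simpl; lra]).
  assert (R0 : Re (defect w) + ln (2 * PI) = 0).
  { assert (L : is_lim_seq (fun n => 40 / INR n) 0) by apply is_lim_seq_div_n.
    assert (B : Rabs (Re (defect w) + ln (2 * PI)) <= 0).
    { refine (is_lim_seq_le_loc (fun _ => Rabs (Re (defect w) + ln (2 * PI))) _ _ _ _ (is_lim_seq_const _) L).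
      exists 1%nat. intros n Hn. assert (HN : 1 <= INR n) by (apply (le_INR 1); lia).
      rewrite (E (INR n + 1)). assert (X := Re_defect (INR n + 1) ltac:(lra)).
      replace (INR n + 1 - 1) with (INR n) in X by ring. exact X. }
    revert B. unfold Rabs. destruct Rcase_abs; lra. }
  assert (I0 : Im (defect w) = 0).
  { rewrite (E 0). unfold defect.
    replace (Im (J (half_line 0) + ccot (half_line 0) + digamma (half_line 0))) with (Im (J (half_line 0)) + Im (ccot (half_line 0)) + Im (digamma (half_line 0))) by reflexivity.
    rewrite Im_J_half_line. change (Im (digamma (half_line 0))) with (Im (digamma (RtoC (1 / 2)))).
    rewrite Im_digamma_half.
    rewrite ccot_half_line. replace (- (2 * PI * 0)) with 0 by ring. rewrite exp_0.
    unfold Ci, Cmult, RtoC, Im; simpl. field. }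
  destruct (defect w) as [a b]. unfold Re, Im in *; simpl in *. unfold RtoC. f_equal; lra.
Qed.

(** * The complex logarithm *)

(** With x = exp (- t), the factor (1 - x + ln x) / ln x of the integrand of [gen_gamma] is
    [1 - expc t]. *)
Definition expc (t : R) : R := if Req_EM_T t 0 then 1 else (1 - exp (- t)) / t.

Lemma expc_mult (t : R) : t * expc t = 1 - exp (- t).
Proof.
  unfold expc. destruct Req_EM_T as [->|H]; [rewrite Ropp_0, exp_0; ring|field; exact H].
Qed.

Lemma expc_bounds (t : R) : exp (- Rabs t) <= expc t <= exp (Rabs t).
Proof.
  unfold expc. destruct Req_EM_T as [->|H].
  - rewrite Rabs_R0, Ropp_0, exp_0. lra.
  - destruct (MVT_gen (fun t => - exp (- t)) 0 t (fun t => exp (- t))) as [c [Hc Ec]].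
    + intros x _. auto_derive; trivial. ring.
    + intros x _. apply derivable_continuous_pt, ex_derive_Reals_0. now auto_derive.
    + rewrite Ropp_0, exp_0 in Ec. replace ((1 - exp (- t)) / t) with (exp (- c)).
      2: { field_simplify_eq; [lra|exact H]. }
      split; apply exp_le_compat; revert Hc; unfold Rmin, Rmax, Rabs;
      destruct Rle_dec; destruct Rcase_abs; lra.
Qed.

Lemma expc_nonneg (t : R) : 0 <= t -> 0 <= expc t <= 1.
Proof.
  intros Ht. assert (P := expc_bounds t). assert (E := exp_pos (- Rabs t)). split; [lra|].
  unfold expc in *. destruct Req_EM_T as [->|H]; [lra|].
  apply Rle_div_l; [lra|]. assert (X := exp_ineq1_le (- t)). lra.
Qed.

Lemma continuous_expc (t : R) : continuous expc t.
Proof.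
  destruct (Req_EM_T t 0) as [->|H].
  - assert (E : expc 0 = 1) by (unfold expc; destruct Req_EM_T; lra).
    unfold continuous. rewrite E.
    apply (filterlim_le_le (F := locally 0) (fun t => exp (- Rabs t)) expc (fun t => exp (Rabs t)) (Finite 1)).
    + apply filter_forall. apply expc_bounds.
    + assert (X : continuous (fun t => exp (- Rabs t)) 0).
      { apply (continuous_comp (fun t => - Rabs t) exp); [|apply continuous_exp].
        apply (continuous_opp (V := R_NormedModule)), continuous_Rabs. }
      unfold continuous in X. rewrite Rabs_R0, Ropp_0, exp_0 in X. exact X.
    + assert (X : continuous (fun t => exp (Rabs t)) 0).
      { apply (continuous_comp Rabs exp); [apply continuous_Rabs|apply continuous_exp]. }
      unfold continuous in X. rewrite Rabs_R0, exp_0 in X. exact X.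
  - apply (continuous_ext_loc _ (fun t => (1 - exp (- t)) / t)).
    + assert (Hp : 0 < Rabs t) by now apply Rabs_pos_lt.
      exists (mkposreal _ Hp). intros y Hy. unfold expc. destruct Req_EM_T as [->|H1]; [|reflexivity].
      exfalso. apply ball_Rabs in Hy; simpl in Hy.
      rewrite Rminus_0_l, Rabs_Ropp in Hy. lra.
    + apply (ex_derive_continuous (V := R_NormedModule)). auto_derive. exact H.
Qed.

Definition slit (z : C) := 0 < Re z \/ Im z <> 0.

(* The half-angle formula is smooth across the positive real axis, where the case distinction
   in [Carg] is not. *)
Lemma Carg_atan (z : C) : slit z -> Carg z = 2 * atan (Im z / (Cmod z + Re z)).
Proof.
  intros Hz. destruct z as [x y]. unfold slit, Re, Im in Hz; simpl in Hz.
  unfold Carg, Re, Im; simpl fst; simpl snd. set (r := Cmod (x, y)).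
  assert (Hr2 : r ^ 2 = x ^ 2 + y ^ 2) by (unfold r; rewrite Cmod_sq; reflexivity).
  assert (Hr0 : 0 <= r) by apply Cmod_ge_0.
  assert (Hr : 0 < r). { destruct Hz; nra. }
  assert (Hrx : 0 < r + x). { destruct Hz; nra. }
  set (u := y / (r + x)).
  assert (Ec : cos (2 * atan u) = x / r).
  { rewrite cos_2a_cos, cos_atan.
    assert (S : sqrt (1 + u²) * sqrt (1 + u²) = 1 + u²) by (apply sqrt_sqrt; unfold Rsqr; nra).
    assert (S0 : 0 < sqrt (1 + u²)) by (apply sqrt_lt_R0; unfold Rsqr; nra).
    replace (2 * (1 / sqrt (1 + u²)) * (1 / sqrt (1 + u²)) - 1) with (2 / (sqrt (1 + u²) * sqrt (1 + u²)) - 1) by (field; lra).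
    rewrite S. unfold Rsqr, u.
    replace (1 + y / (r + x) * (y / (r + x))) with (((r + x) ^ 2 + y ^ 2) / (r + x) ^ 2) by (field; lra).
    replace ((r + x) ^ 2 + y ^ 2) with (2 * r * (r + x)) by nra.
    field. lra. }
  assert (Bu := atan_bound u).
  destruct Rle_dec as [Hy|Hy].
  - rewrite <- Ec. apply acos_cos.
    assert (0 <= atan u); [|lra]. rewrite <- atan_0.
    assert (Hu : 0 <= u) by (unfold u; now apply Rle_mult_inv_pos).
    destruct Hu as [Hu|Hu]; [left; now apply atan_increasing|right; now f_equal].
  - rewrite <- Ec, <- cos_neg. rewrite acos_cos; [ring|].
    assert (Hu : u < 0) by (unfold u; apply Rlt_div_l; lra).
    assert (atan u < 0) by (rewrite <- atan_0; now apply atan_increasing). lra.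
Qed.

(** The left side is the derivative of the half-angle formula for the argument of X + i Y, in which
    (X X' + Y Y') / r is the derivative of the modulus. The simplification rests on 1 + (Y / (r +
    X))^2 = 2 r / (r + X). *)
Lemma arg_derivative_identity (X Y X' Y' r : R) : r * r = X * X + Y * Y -> 0 < r -> 0 < r + X ->
  2 * (((Y' * (r + X) - Y * ((X * X' + Y * Y') / r + X')) / (r + X) ^ 2) / (1 + (Y / (r + X)) ^ 2))
  = (X * Y' - Y * X') / (r * r).
Proof.
  intros Hr H0 H1.
  assert (E : 1 + (Y / (r + X)) ^ 2 = 2 * r / (r + X)).
  { replace (1 + (Y / (r + X)) ^ 2) with ((r * r + 2 * r * X + X * X + Y * Y) / (r + X) ^ 2) by (field; lra).
    replace (r * r + 2 * r * X + X * X + Y * Y) with (2 * r * (r + X)) by lra. field. lra. }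
  rewrite E.
  replace (Y' * (r + X) - Y * ((X * X' + Y * Y') / r + X')) with ((X * Y' - Y * X') * (r + X) / r).
  - field. lra.
  - apply Rmult_eq_reg_r with r; [|lra].
    replace ((Y' * (r + X) - Y * ((X * X' + Y * Y') / r + X')) * r) with (Y' * (r * r) + Y' * r * X - Y * (X * X') - Y * Y * Y' - Y * r * X') by (field; lra).
    rewrite Hr. field. lra.
Qed.

Lemma is_derive_Clog (f : R -> C) (t : R) (df : C) :
  locally t (fun s => slit (f s)) -> is_derive_RC f t df ->
  is_derive_RC (fun s => Clog (f s)) t (df / f t)%C.
Proof.
  intros Hs Hf. apply is_derive_fst_snd in Hf. destruct Hf as [HX HY].
  set (X := fun s => Re (f s)) in *. set (Y := fun s => Im (f s)) in *.
  set (X' := Re df) in *. set (Y' := Im df) in *.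
  apply (is_derive_ext_loc (V := C_R_NormedModule)
    (fun s => (ln (sqrt (X s ^ 2 + Y s ^ 2)), 2 * atan (Y s / (sqrt (X s ^ 2 + Y s ^ 2) + X s))))).
  { revert Hs. apply filter_imp. intros s Hs. unfold Clog. rewrite Carg_atan by exact Hs. reflexivity. }
  assert (Ht := locally_singleton _ _ Hs). cbv beta in Ht. unfold slit in Ht. fold (X t) (Y t) in Ht.
  assert (P2 : 0 < X t ^ 2 + Y t ^ 2).
  { assert (A := pow2_ge_0 (X t)). assert (B := pow2_ge_0 (Y t)). destruct Ht; nra. }
  set (r := sqrt (X t ^ 2 + Y t ^ 2)).
  assert (Hr0 : 0 < r) by now apply sqrt_lt_R0.
  assert (Hrr : r * r = X t * X t + Y t * Y t).
  { unfold r. rewrite sqrt_sqrt by lra. ring. }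
  assert (HrX : 0 < r + X t). { destruct Ht; nra. }
  assert (DX : ex_derive X t) by now exists X'. assert (DY : ex_derive Y t) by now exists Y'.
  assert (EX : Derive X t = X') by now apply is_derive_unique.
  assert (EY : Derive Y t = Y') by now apply is_derive_unique.
  replace (df / f t)%C with (((X t * X' + Y t * Y') / (r * r), (X t * Y' - Y t * X') / (r * r)) : C).
  2: { rewrite Hrr. unfold X, Y, X', Y', Cdiv, Cinv, Cmult, Re, Im; simpl.
       f_equal; field; unfold X, Y, Re, Im in P2; lra. }
  assert (Dr : is_derive (fun s => sqrt (X s ^ 2 + Y s ^ 2)) t ((X t * X' + Y t * Y') / r)).
  { auto_derive; [repeat split; try assumption|].
    change (Derive (fun x : R => X x) t) with (Derive X t).
    change (Derive (fun x : R => Y x) t) with (Derive Y t).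
    rewrite EX, EY. change (sqrt (X t * (X t * 1) + Y t * (Y t * 1))) with r. field. lra. }
  (* The modulus is first treated as an arbitrary differentiable function [rr], so that its
     derivative enters the formulas as a single quantity. *)
  assert (G : forall (rr : R -> R) (r' : R), is_derive rr t r' -> rr t = r ->
    is_derive (fun s => ln (rr s)) t (r' / r) /\
    is_derive (fun s => 2 * atan (Y s / (rr s + X s))) t
      (2 * (((Y' * (r + X t) - Y t * (r' + X')) / (r + X t) ^ 2) / (1 + (Y t / (r + X t)) ^ 2)))).
  { intros rr r' D E. assert (Er : ex_derive rr t) by now exists r'.
    assert (Er' : Derive rr t = r') by now apply is_derive_unique.
    split.
    - auto_derive; [rewrite E; repeat split; assumption|].
      change (Derive (fun x : R => rr x) t) with (Derive rr t). rewrite Er', E. field. lra.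
    - auto_derive; [rewrite E; repeat split; try assumption; lra|].
      change (Derive (fun x : R => rr x) t) with (Derive rr t).
      change (Derive (fun x : R => X x) t) with (Derive X t).
      change (Derive (fun x : R => Y x) t) with (Derive Y t).
      rewrite Er', EX, EY, E. field. split; [lra|].
      assert (A := pow2_ge_0 (Y t)). assert (B : 0 < (r + X t) ^ 2) by now apply pow_lt. lra. }
  destruct (G _ _ Dr eq_refl) as [G1 G2].
  apply is_derive_C; unfold Re, Im; simpl fst; simpl snd.
  - replace ((X t * X' + Y t * Y') / (r * r)) with ((X t * X' + Y t * Y') / r / r) by (field; lra). exact G1.
  - rewrite <- (arg_derivative_identity _ _ _ _ r Hrr Hr0 HrX). exact G2.
Qed.

(** * The generalized Euler constant function *)

Definition off_ray (z : C) := ~ (Im z = 0 /\ 0 <= Re z).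

Lemma slit_offray (a : C) (s : R) : off_ray a -> 0 <= s -> slit (1 - RtoC s * a).
Proof.
  intros Ha Hs. destruct a as [p q].
  unfold off_ray, slit, Re, Im, Cminus, Cplus, Copp, Cmult, RtoC in *; simpl in *.
  destruct (Req_dec q 0) as [E|E].
  - left. assert (p < 0) by (destruct (Rlt_dec p 0); [assumption|exfalso; apply Ha; split; [exact E|lra]]).
    nra.
  - destruct Hs as [Hs|Hs]; [right|left; subst; lra].
    intro X. apply E. assert (s * q = 0) by lra. apply Rmult_integral in H. lra.
Qed.

Lemma slit_neq_0 (z : C) : slit z -> z <> 0%C.
Proof. intros H E. subst. unfold slit, Re, Im, RtoC in H; simpl in H. lra. Qed.

Lemma exp_minus_neq_0 (a : C) (t : R) : off_ray a -> (RtoC (exp t) - a)%C <> 0%C.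
Proof.
  intros Ha E. apply Ha. assert (X : a = RtoC (exp t)).
  { replace a with (RtoC (exp t) - (RtoC (exp t) - a))%C by ring. rewrite E. ring. }
  rewrite X. simpl. split; [reflexivity|left; apply exp_pos].
Qed.

Lemma continuous_inv_exp_minus (a : C) (t : R) : off_ray a -> continuous (fun t => / (RtoC (exp t) - a))%C t.
Proof.
  intros Ha. apply continuous_Cinv; [|now apply exp_minus_neq_0].
  apply continuous_Cminus; [apply continuous_RtoC, continuous_exp|apply continuous_Cconst].
Qed.

Lemma offray_neq_0 (a : C) : off_ray a -> a <> 0%C.
Proof. intros Ha E. apply Ha. rewrite E. simpl. split; lra. Qed.

(** The integrand is a exp (- t) / (1 - a exp (- t)) divided by a, the logarithmic derivative of 1 -
    a exp (- t). This point never meets the cut, so the principal logarithm is a primitive on the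
    whole range. *)
Lemma is_CRInt_log (a : C) (T : R) : off_ray a -> 0 <= T ->
  is_CRInt (fun t => / (RtoC (exp t) - a))%C 0 T ((Clog (1 - RtoC (exp (- T)) * a) - Clog (1 - a)) / a)%C.
Proof.
  intros Ha HT. assert (A0 := offray_neq_0 a Ha).
  replace ((Clog (1 - RtoC (exp (- T)) * a) - Clog (1 - a)) / a)%C
   with (/ a * Clog (1 - RtoC (exp (- T)) * a) - / a * Clog (1 - RtoC (exp (- 0)) * a))%C.
  2: { rewrite Ropp_0, exp_0, Cmult_1_l. field. exact A0. }
  apply (is_CRInt_derive (fun t => / a * Clog (1 - RtoC (exp (- t)) * a))%C); [exact HT| |].
  - intros t _.
    replace (/ (RtoC (exp t) - a))%C with (/ a * ((RtoC (exp (- t)) * a) / (1 - RtoC (exp (- t)) * a)))%C.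
    + apply is_derive_Cscal. apply (is_derive_Clog (fun t => 1 - RtoC (exp (- t)) * a)%C).
      * apply filter_forall. intro s. apply slit_offray; [exact Ha|left; apply exp_pos].
      * destruct a as [p q]. apply is_derive_C; unfold Re, Im, Cminus, Cplus, Copp, Cmult, RtoC; simpl; auto_derive; trivial; ring.
    + assert (N := exp_minus_neq_0 a t Ha). rewrite exp_Ropp, RtoC_inv by (apply Rgt_not_eq, exp_pos).
      assert (E0 : RtoC (exp t) <> 0%C) by (intro E; apply RtoC_inj in E; generalize (exp_pos t); lra).
      field. repeat split; assumption.
  - intros t _. now apply continuous_inv_exp_minus.
Qed.

Lemma filterlim_exp_opp_p : filterlim (fun t => exp (- t)) (Rbar_locally p_infty) (locally 0).
Proof.
  apply (filterlim_comp _ _ _ Ropp exp _ (Rbar_locally m_infty)).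
  - apply (filterlim_Rbar_opp p_infty).
  - exact is_lim_exp_m.
Qed.

Lemma Clog_1 : Clog 1 = 0%C.
Proof.
  unfold Clog. rewrite Cmod_1, ln_1, Carg_atan by (left; simpl; lra).
  simpl. rewrite Rdiv_0_l, atan_0, Rmult_0_r. reflexivity.
Qed.

Lemma Clim_log_integral (a : C) : off_ray a ->
  Clim (Rbar_locally p_infty) (fun T => CRInt (fun t => / (RtoC (exp t) - a))%C 0 T) (- (Clog (1 - a) / a))%C.
Proof.
  intros Ha. assert (A0 := offray_neq_0 a Ha).
  apply (Clim_ext_loc (F := Rbar_locally p_infty) (fun T => (Clog (1 - RtoC (exp (- T)) * a) - Clog (1 - a)) * / a)%C).
  { exists 0. intros T HT. symmetry. apply CRInt_unique, is_CRInt_log; [exact Ha|lra]. }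
  replace (- (Clog (1 - a) / a))%C with ((Clog (1 - RtoC 0 * a) - Clog (1 - a)) * / a)%C.
  2: { rewrite Cmult_0_l. replace (1 - 0)%C with (RtoC 1) by ring. rewrite Clog_1. field. exact A0. }
  apply Clim_mult; [|apply Clim_const]. apply Clim_minus; [|apply Clim_const].
  apply filterlim_Clim.
  apply (filterlim_comp _ _ _ (fun t => exp (- t)) (fun s => Clog (1 - RtoC s * a)) _ (locally 0)); [exact filterlim_exp_opp_p|].
  apply (ex_derive_continuous (V := C_R_NormedModule) (fun s : R => Clog (1 - RtoC s * a)) 0).
  eexists. apply (is_derive_Clog (fun s => 1 - RtoC s * a)%C).
  (* Continuity at [s = 0] also involves negative [s], to which [slit_offray] does not apply; for
     small [s] of either sign the real part of [1 - s * a] is positive. *)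
  - assert (Hp : 0 < / (Cmod a + 1)) by (apply Rinv_0_lt_compat; generalize (Cmod_ge_0 a); lra).
    exists (mkposreal _ Hp). intros s Hs. apply ball_Rabs in Hs; simpl in Hs. rewrite Rminus_0_r in Hs.
    left. replace (Re (1 - RtoC s * a)) with (1 - Re (RtoC s * a)) by reflexivity.
    assert (X := Re_le_Cmod (RtoC s * a)). rewrite Cmod_mult, Cmod_R in X.
    assert (Y := Cmod_ge_0 a). assert (Z := Rabs_pos s).
    assert (Q : Rabs s * (Cmod a + 1) < 1).
    { apply Rmult_lt_compat_r with (r := Cmod a + 1) in Hs; [|lra]. rewrite Rinv_l in Hs by lra. exact Hs. }
    nra.
  - apply (is_derive_C (fun s => 1 - RtoC s * a)%C 0 (- a)%C); destruct a as [p q];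
    unfold Re, Im, Cminus, Cplus, Copp, Cmult, RtoC; simpl; auto_derive; trivial; ring.
Qed.

Lemma gen_gamma_den_neq_0 (z : C) (x : R) : off_ray z -> 0 <= x -> (1 - RtoC x * z)%C <> 0%C.
Proof. intros Hz Hx. now apply slit_neq_0, slit_offray. Qed.

(** The integrand of [gen_gamma] extended continuously to [0, 1]. At [x = 0] the numerator takes its
    limit 1, since [expc] vanishes at infinity; at [x = 1] the singularity is removed by
    [expc 0 = 1]. *)
Definition gamma_integrand (z : C) (x : R) : C :=
  (RtoC (if Rle_dec x 0 then 1 else 1 - expc (- ln x)) / (1 - RtoC x * z))%C.

Lemma continuous_gamma_integrand (z : C) (x : R) : off_ray z -> 0 <= x -> continuous (gamma_integrand z) x.
Proof.
  intros Hz Hx. unfold gamma_integrand. apply continuous_Cdiv.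
  2: { apply continuous_Cminus; [apply continuous_Cconst|].
       apply continuous_Cmult; [|apply continuous_Cconst].
       apply continuous_RtoC, continuous_id. }
  2: now apply gen_gamma_den_neq_0.
  apply continuous_RtoC. destruct Hx as [Hx|<-].
  - apply (continuous_ext_loc _ (fun x => 1 - expc (- ln x))).
    + exists (mkposreal x Hx). intros y Hy. destruct Rle_dec as [H|H]; [|reflexivity].
      exfalso. apply ball_Rabs in Hy; simpl in Hy.
      apply Rabs_def2 in Hy. lra.
    + apply (continuous_minus (V := R_NormedModule)); [apply continuous_const|].
      apply (continuous_comp (fun x => - ln x) expc); [|apply continuous_expc].
      apply (continuous_opp (V := R_NormedModule)), continuous_ln, Hx.
  - apply filterlim_locally. intros [eps He]. destruct Rle_dec as [_|H]; [|lra].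
    (* For positive [y] below this radius, [- ln y > 1 / eps], and [expc s < 1 / s] for [s > 0]. *)
    exists (mkposreal (exp (- (1 / eps))) (exp_pos _)). intros y Hy.
    unfold ball in *; simpl in *. unfold AbsRing_ball, abs, minus, plus, opp in *; simpl in *.
    apply Rabs_def2 in Hy. destruct Rle_dec as [H|H].
    + rewrite Rplus_opp_r, Rabs_R0. exact He.
    + assert (Hl : ln y < - (1 / eps)). { rewrite <- (ln_exp (- (1 / eps))). apply ln_increasing; lra. }
      assert (Hi : 0 < 1 / eps) by (apply Rdiv_lt_0_compat; lra).
      assert (B := expc_nonneg (- ln y) ltac:(lra)). assert (M := expc_mult (- ln y)).
      assert (P := exp_pos (- - ln y)).
      match goal with |- Rabs ?v < _ => replace v with (- expc (- ln y)) by ring end.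
      rewrite Rabs_Ropp, Rabs_pos_eq by lra.
      assert (X : (1 / eps) * expc (- ln y) <= 1 - exp (- - ln y)) by (rewrite <- M; apply Rmult_le_compat_r; lra).
      replace (expc (- ln y)) with (eps * (1 / eps * expc (- ln y))) by (field; lra). nra.
Qed.

Lemma is_CRInt_gen_gamma (z : C) : off_ray z -> is_CRInt (gamma_integrand z) 0 1 (gen_gamma z).
Proof.
  intros Hz. assert (H : ex_CRInt (gamma_integrand z) 0 1).
  { apply ex_CRInt_continuous; [lra|]. intros x Hx. now apply continuous_gamma_integrand. }
  replace (gen_gamma z) with (CRInt (gamma_integrand z) 0 1); [now apply is_CRInt_CRInt|].
  unfold gen_gamma. apply (RInt_ext (V := C_R_CompleteNormedModule)).
  intros x Hx. rewrite Rmin_left, Rmax_right in Hx by lra.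
  unfold gamma_integrand. destruct Rle_dec; [lra|].
  assert (Hl : ln x < 0) by (rewrite <- ln_1; apply ln_increasing; lra).
  assert (M := expc_mult (- ln x)). rewrite Ropp_involutive, exp_ln in M by lra.
  replace (1 - x + ln x) with (ln x * (1 - expc (- ln x))) by lra.
  rewrite RtoC_mult. assert (N := gen_gamma_den_neq_0 z x Hz ltac:(lra)).
  assert (L0 : RtoC (ln x) <> 0%C) by (apply RtoC_neq_0; lra).
  match goal with |- ?x = ?y => change (@eq C x y) end. field. now split.
Qed.

Definition gamma_integrand_exp (z : C) (t : R) : C := (RtoC (1 - expc t) * / (RtoC (exp t) - z))%C.

Lemma continuous_gamma_integrand_exp (z : C) (t : R) : off_ray z -> continuous (gamma_integrand_exp z) t.
Proof.
  intros Hz. apply continuous_Cmult; [|now apply continuous_inv_exp_minus].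
  apply continuous_RtoC, (continuous_minus (V := R_NormedModule)); [apply continuous_const|apply continuous_expc].
Qed.

Lemma CRInt_gamma_integrand_exp (z : C) (T : R) : off_ray z -> 0 <= T -> CRInt (gamma_integrand_exp z) 0 T = CRInt (gamma_integrand z) (exp (- T)) 1.
Proof.
  intros Hz HT.
  assert (H := is_RInt_comp (V := C_R_CompleteNormedModule) (gamma_integrand z) (fun t => exp (- t)) (fun t => - exp (- t)) 0 T).
  cbv beta in H. rewrite Ropp_0, exp_0 in H.
  assert (H1 : is_CRInt (fun y => scal (- exp (- y)) (gamma_integrand z (exp (- y)) : C_R_NormedModule)) 0 T (CRInt (gamma_integrand z) 1 (exp (- T)))).
  { apply H.
    - intros x _. apply continuous_gamma_integrand; [exact Hz|left; apply exp_pos].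
    - intros x _. split; [auto_derive; trivial; ring|]. apply (ex_derive_continuous (V := R_NormedModule)).
      now auto_derive. }
  apply (is_RInt_opp (V := C_R_NormedModule)) in H1.
  rewrite <- (opp_RInt_swap (V := C_R_CompleteNormedModule)), opp_opp in H1.
  2: { apply ex_CRInt_continuous. { rewrite <- exp_0 at 1. apply exp_le_compat; lra. }
       intros x Hx. apply continuous_gamma_integrand; [exact Hz|]. generalize (exp_pos (- T)); lra. }
  apply CRInt_unique. revert H1. apply is_RInt_ext. intros t Ht.
  unfold gamma_integrand, gamma_integrand_exp. assert (P := exp_pos (- t)). destruct Rle_dec; [lra|].
  rewrite ln_exp, Ropp_involutive.
  assert (N := exp_minus_neq_0 z t Hz). assert (N2 := gen_gamma_den_neq_0 z (exp (- t)) Hz ltac:(lra)).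
  assert (E : (1 - RtoC (exp (- t)) * z)%C = (RtoC (exp (- t)) * (RtoC (exp t) - z))%C).
  { assert (X : (RtoC (exp (- t)) * RtoC (exp t))%C = 1%C) by (rewrite <- RtoC_mult, <- exp_plus, Rplus_opp_l, exp_0; reflexivity).
    rewrite <- X. ring. }
  rewrite E.
  assert (Sc : forall (r : R) (u : C), opp (scal (- r) (u : C_R_NormedModule)) = (RtoC r * u)%C).
  { intros r [u1 u2]. unfold opp, scal; simpl. unfold prod_opp, prod_scal, opp, scal; simpl.
    unfold mult, Cmult, RtoC; simpl. f_equal; ring. }
  rewrite Sc. assert (E0 : RtoC (exp (- t)) <> 0%C) by (apply RtoC_neq_0; lra).
  match goal with |- ?x = ?y => change (@eq C x y) end. field. now split.
Qed.

(** The missing part is the integral over (0, exp (- T)). There the numerator is at most 1, and the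
    choice of [T] makes the modulus of [1 - x * z] at least 1 / 2. *)
Lemma Clim_gen_gamma (z : C) : off_ray z -> Clim (Rbar_locally p_infty) (fun T => CRInt (gamma_integrand_exp z) 0 T) (gen_gamma z).
Proof.
  intros Hz.
  apply (Clim_le (F := Rbar_locally p_infty)) with (fun T => 2 * exp (- T)).
  2: { replace (locally 0) with (locally (2 * 0)) by now rewrite Rmult_0_r.
       apply (filterlim_comp _ _ _ (fun t => exp (- t)) (fun y => 2 * y) _ (locally 0)); [exact filterlim_exp_opp_p|].
       apply (filterlim_scal_r (V := R_NormedModule)). }
  exists (Rmax 0 (ln (2 * (Cmod z + 1)))). intros T HT.
  assert (T0 := Rle_lt_trans _ _ _ (Rmax_l _ _) HT). assert (T1 := Rle_lt_trans _ _ _ (Rmax_r _ _) HT).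
  assert (Mz := Cmod_ge_0 z).
  assert (Ez : exp (- T) * (2 * (Cmod z + 1)) <= 1).
  { rewrite <- (exp_ln (2 * (Cmod z + 1))) by lra. rewrite <- exp_plus.
    apply Rle_trans with (exp 0); [apply exp_le_compat; lra|rewrite exp_0; lra]. }
  assert (Pe := exp_pos (- T)).
  assert (E1 : exp (- T) <= 1) by (rewrite <- exp_0; apply exp_le_compat; lra).
  rewrite CRInt_gamma_integrand_exp by (try exact Hz; lra).
  assert (H := is_CRInt_gen_gamma z Hz). apply CRInt_unique in H.
  assert (Ex1 : ex_CRInt (gamma_integrand z) 0 (exp (- T))). { apply ex_CRInt_continuous; [lra|].
  intros; now apply continuous_gamma_integrand. }
  assert (Ex2 : ex_CRInt (gamma_integrand z) (exp (- T)) 1). { apply ex_CRInt_continuous; [lra|].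
  intros x Hx; apply continuous_gamma_integrand; [exact Hz|lra]. }
  assert (Ch := RInt_Chasles (V := C_R_CompleteNormedModule) (gamma_integrand z) 0 (exp (- T)) 1 Ex1 Ex2).
  rewrite H in Ch. rewrite <- Ch.
  assert (X : forall a b : C, (b - (a + b) = - a)%C) by (intros; ring).
  change (Cmod (CRInt (gamma_integrand z) (exp (- T)) 1 - (CRInt (gamma_integrand z) 0 (exp (- T)) + CRInt (gamma_integrand z) (exp (- T)) 1))%C <= 2 * exp (- T)).
  rewrite X, Cmod_opp.
  assert (Hc := is_RInt_const_R 0 (exp (- T)) 2).
  replace ((exp (- T) - 0) * 2) with (2 * exp (- T)) in Hc by ring.
  refine (Cmod_is_CRInt_le _ _ 0 (exp (- T)) _ _ (Rlt_le _ _ Pe) _ (is_CRInt_CRInt _ _ _ Ex1) Hc).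
  intros x Hx. assert (N := gen_gamma_den_neq_0 z x Hz (proj1 Hx)).
  unfold gamma_integrand. rewrite Cmod_div by exact N.
  assert (A : Cmod (RtoC (if Rle_dec x 0 then 1 else 1 - expc (- ln x))) <= 1).
  { rewrite Cmod_R. destruct Rle_dec; [rewrite Rabs_R1; lra|].
    assert (Hl : ln x <= 0) by (rewrite <- ln_1; apply ln_le; lra).
    assert (B := expc_nonneg (- ln x) ltac:(lra)). rewrite Rabs_pos_eq; lra. }
  assert (B : 1 / 2 <= Cmod (1 - RtoC x * z)).
  { assert (TT := Cmod_triangle (1 - RtoC x * z) (RtoC x * z)).
    replace (1 - RtoC x * z + RtoC x * z)%C with (RtoC 1) in TT by ring.
    rewrite Cmod_1, Cmod_mult, Cmod_R, Rabs_pos_eq in TT by lra.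
    assert (x * Cmod z <= exp (- T) * Cmod z) by (apply Rmult_le_compat_r; lra). nra. }
  apply Rle_div_l; [lra|]. lra.
Qed.

(** * Euler's constant and the main identity *)

Fixpoint harm (n : nat) : R := match n with O => 0 | S k => harm k + / INR (S k) end.

Lemma harmonic_shift_1 (n : nat) : harmonic_shift n 1 = RtoC (harm (S n)).
Proof.
  induction n as [|n IH].
  - simpl. rewrite Rplus_0_l, Rinv_1. field.
  - cbn [harmonic_shift]. rewrite IH. change (harm (S (S n))) with (harm (S n) + / INR (S (S n))).
    rewrite RtoC_plus, RtoC_inv by (apply Rgt_not_eq, lt_0_INR; lia). f_equal. f_equal.
    rewrite (RtoC_INR_S (S n)). ring.
Qed.

Lemma ln_succ_lim : is_lim_seq (fun n => ln (INR (S n)) - ln (INR n)) 0.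
Proof.
  apply (is_lim_seq_le_le_loc (fun _ => 0) _ (fun n => 1 / INR n)); [|apply is_lim_seq_const|apply is_lim_seq_div_n].
  exists 1%nat. intros n Hn. assert (HN : 1 <= INR n) by (apply (le_INR 1); lia).
  rewrite S_INR, <- ln_div by lra.
  assert (E : (INR n + 1) / INR n = 1 + 1 / INR n) by (field; lra). rewrite E.
  assert (P : 0 < 1 / INR n) by (apply Rdiv_lt_0_compat; lra).
  split; [rewrite <- ln_1 at 1; apply ln_le; lra|].
  assert (X := exp_ineq1_le (ln (1 + 1 / INR n))). rewrite exp_ln in X by lra. lra.
Qed.

(** That the limit exists comes from [digamma_lim] at 1, so psi(1) = - gamma is obtained implicitly.
    The partial sums of the series defining [euler_gamma] telescope to H_n - ln (n + 1), which
    identifies the limit. *)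
Lemma harm_lim : is_lim_seq (fun n => harm n - ln (INR n)) euler_gamma.
Proof.
  assert (H := Clim_Re (F := eventually) _ _ (digamma_lim 1 ltac:(simpl; lra))).
  set (g := Re (digamma 1)) in *.
  assert (H1 : is_lim_seq (fun n => harm (S n) - ln (INR n)) (- g)).
  { apply (is_lim_seq_ext (fun n => - Re (RtoC (ln (INR n)) - harmonic_shift n 1))).
    - intro n. rewrite harmonic_shift_1. unfold Re, Cminus, Cplus, Copp, RtoC; simpl. ring.
    - apply (is_lim_seq_opp _ (Finite g)). exact H. }
  assert (H2 : is_lim_seq (fun n => harm (S n) - ln (INR (S n))) (- g)).
  { replace (Finite (- g)) with (Finite (- g - 0)) by (f_equal; ring).
    apply (is_lim_seq_ext (fun n => (harm (S n) - ln (INR n)) - (ln (INR (S n)) - ln (INR n)))); [intro; ring|].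
    apply is_lim_seq_minus'; [exact H1|exact ln_succ_lim]. }
  assert (H3 : is_lim_seq (fun n => harm n - ln (INR n)) (- g)) by (apply is_lim_seq_incr_1; exact H2).
  assert (S0 : is_series (fun n : nat => / INR (S n) - ln (INR (S (S n)) / INR (S n))) (- g)).
  { change (is_lim_seq (sum_n (fun n : nat => / INR (S n) - ln (INR (S (S n)) / INR (S n)))) (- g)).
    apply (is_lim_seq_ext (fun n => (harm (S n) - ln (INR (S n))) - (ln (INR (S (S n))) - ln (INR (S n))))).
    - intro n. induction n as [|n IH].
      + rewrite sum_O. simpl harm. simpl INR. rewrite ln_1, Rdiv_1_r. lra.
      + rewrite sum_Sn, <- IH. unfold plus; simpl plus.
        change (harm (S (S n))) with (harm (S n) + / INR (S (S n))).
        rewrite (ln_div (INR (S (S (S n)))) (INR (S (S n)))) by (apply lt_0_INR; lia). simpl; ring.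
    - replace (Finite (- g)) with (Finite (- g - 0)) by (f_equal; ring).
      apply is_lim_seq_minus'; [exact H2|]. apply (is_lim_seq_incr_1 (fun n => ln (INR (S n)) - ln (INR n))).
      exact ln_succ_lim. }
  unfold euler_gamma. rewrite (is_series_unique _ _ S0). exact H3.
Qed.

Lemma is_RInt_geom (n : nat) (k : nat) : (0 < n)%nat ->
  is_RInt (fun t => / INR n * (1 - t / INR n) ^ k) 0 (INR n) (/ INR (S k)).
Proof.
  intros Hn. assert (HN : 0 < INR n) by now apply lt_0_INR.
  assert (HK : 0 < INR (S k)) by (apply lt_0_INR; lia).
  replace (/ INR (S k)) with (minus (- / INR (S k) * (1 - INR n / INR n) ^ S k) (- / INR (S k) * (1 - 0 / INR n) ^ S k)).
  2: { unfold minus, plus, opp; simpl plus. rewrite Rdiv_diag by lra. rewrite Rdiv_0_l, Rminus_0_r, pow1.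
       rewrite Rminus_diag, pow_i by lia. simpl; ring. }
  apply (is_RInt_derive (V := R_CompleteNormedModule) (fun t => - / INR (S k) * (1 - t / INR n) ^ S k)).
  - intros x _. auto_derive; trivial.
    change (match k with 0%nat => 1 | S _ => INR k + 1 end) with (INR (S k)).
    change (1 + - (x * / INR n)) with (1 - x / INR n). set (y := (1 - x / INR n) ^ k).
    set (K := INR (S k)) in *. field. split; lra.
  - intros x _. apply (ex_derive_continuous (V := R_NormedModule)). now auto_derive.
Qed.

(** A geometric sum equal to (1 - (1 - t / n)^m) / t for t <> 0, written without division by t;
    integrated term by term over (0, n) it gives the harmonic number H_m. *)
Fixpoint geom (n m : nat) (t : R) : R :=
  match m with O => 0 | S k => geom n k t + / INR n * (1 - t / INR n) ^ k end.

Lemma geom_mult (n m : nat) (t : R) : (0 < n)%nat -> t * geom n m t = 1 - (1 - t / INR n) ^ m.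
Proof.
  intros Hn. assert (HN : 0 < INR n) by now apply lt_0_INR.
  induction m as [|m IH]; [simpl; ring|]. simpl. rewrite Rmult_plus_distr_l, IH. field. lra.
Qed.

Lemma is_RInt_geom_sum (n m : nat) : (0 < n)%nat -> is_RInt (geom n m) 0 (INR n) (harm m).
Proof.
  intros Hn. induction m as [|m IH].
  - simpl. assert (H := is_RInt_const_R 0 (INR n) 0). rewrite Rmult_0_r in H. exact H.
  - apply (is_RInt_plus (V := R_NormedModule)); [exact IH|now apply is_RInt_geom].
Qed.

(** The integrands differ by ((1 - t / n)^n - exp (- t)) / t, which [trunc_exp] bounds by t exp (-
    t) / n; the integral of t exp (- t) over (0, oo) is 1. *)
Lemma expc_integral_harm (n : nat) : (0 < n)%nat -> Rabs (RInt expc 0 (INR n) - harm n) <= 1 / INR n.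
Proof.
  intros Hn. assert (HN : 0 < INR n) by now apply lt_0_INR.
  assert (Ee : is_RInt expc 0 (INR n) (RInt expc 0 (INR n))).
  { apply (RInt_correct (V := R_CompleteNormedModule)), (ex_RInt_continuous (V := R_CompleteNormedModule)).
    intros; apply continuous_expc. }
  assert (H := is_RInt_minus (V := R_NormedModule) _ _ _ _ _ _ Ee (is_RInt_geom_sum n n Hn)).
  assert (Hb : is_RInt (fun t => / INR n * (t * exp (- t))) 0 (INR n) (/ INR n * (minus (- (INR n + 1) * exp (- INR n)) (- (0 + 1) * exp (- 0))))).
  { apply (is_RInt_scal (V := R_NormedModule)).
    apply (is_RInt_derive (V := R_CompleteNormedModule) (fun t => - (t + 1) * exp (- t))).
    - intros x _. auto_derive; trivial. ring.
    - intros x _. apply (ex_derive_continuous (V := R_NormedModule)). now auto_derive. }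
  apply Rle_trans with (/ INR n * (minus (- (INR n + 1) * exp (- INR n)) (- (0 + 1) * exp (- 0)))).
  - refine (norm_RInt_le (V := R_NormedModule) _ _ 0 (INR n) _ _ (Rlt_le _ _ HN) _ H Hb).
    intros t [Ht0 Ht]. unfold norm, minus, plus, opp; simpl. unfold abs; simpl.
    destruct (Req_dec t 0) as [->|Ht1].
    + unfold expc. destruct Req_EM_T; [|lra].
      replace (geom n n 0) with 1.
      * rewrite Rplus_opp_r, Rabs_R0. lra.
      * assert (X : forall m, geom n m 0 = INR m * / INR n).
        { induction m as [|m IH]; [simpl; ring|]. rewrite S_INR. simpl geom.
          rewrite IH, Rdiv_0_l, Rminus_0_r, pow1. ring. }
        rewrite X. field. lra.
    + assert (Htp : 0 < t) by lra.
      apply Rmult_le_reg_l with t; [exact Htp|].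
      rewrite <- (Rabs_pos_eq t) at 1 by lra. rewrite <- Rabs_mult, Rmult_plus_distr_l, expc_mult.
      replace (t * - geom n n t) with (- (t * geom n n t)) by ring. rewrite geom_mult by exact Hn.
      destruct (trunc_exp n t Hn Ht0) as [T1 T2]. unfold trunc in T1, T2.
      (* At the endpoint [t = n] the cut-off value 0 agrees with [0 ^ n], as [n > 0]. *)
      assert (Et : (if Rlt_dec t (INR n) then (1 - t / INR n) ^ n else 0) = (1 - t / INR n) ^ n).
      { destruct Rlt_dec; [reflexivity|]. replace t with (INR n) by lra. rewrite Rdiv_diag by lra.
        rewrite Rminus_diag, pow_i by lia. reflexivity. }
      rewrite Et in T1, T2.
      replace (t * (/ INR n * (t * exp (- t)))) with (t ^ 2 * exp (- t) / INR n) by (field; lra).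
      apply Rabs_le. lra.
  - unfold minus, plus, opp; simpl. rewrite Ropp_0, exp_0. unfold Rdiv. rewrite (Rmult_comm 1).
    apply Rmult_le_compat_l; [left; now apply Rinv_0_lt_compat|]. assert (P := exp_pos (- INR n)). nra.
Qed.

Lemma expc_integral_lim : is_lim_seq (fun n => RInt expc 0 (INR n) - ln (INR n)) euler_gamma.
Proof.
  apply (is_lim_seq_ext (fun n => (harm n - ln (INR n)) + (RInt expc 0 (INR n) - harm n))); [intro; ring|].
  replace (Finite euler_gamma) with (Finite (euler_gamma + 0)) by (f_equal; ring).
  apply is_lim_seq_plus'; [exact harm_lim|].
  apply (is_lim_seq_le_le_loc (fun n => - (1 / INR n)) _ (fun n => 1 / INR n)).
  - exists 1%nat. intros n Hn. apply Rabs_le_between, expc_integral_harm. lia.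
  - replace (Finite 0) with (Rbar_opp (Finite 0)) by (simpl; f_equal; ring).
    apply (is_lim_seq_opp (fun n => 1 / INR n) (Finite 0)), is_lim_seq_div_n.
  - apply is_lim_seq_div_n.
Qed.

(** * From z to a point of the strip, and the comparison of integrands *)

Lemma Cexp_Clog (z : C) : z <> 0%C -> 0 <= Im z -> Cexp (Clog z) = z.
Proof.
  intros Hz Hi. assert (Hr := proj1 (Cmod_gt_0 z) Hz). set (r := Cmod z) in *.
  unfold Cexp, Clog, Carg. simpl Re. simpl Im. fold r. destruct Rle_dec as [_|H]; [|lra].
  assert (Hr2 : r ^ 2 = Re z ^ 2 + Im z ^ 2) by apply Cmod_sq.
  assert (Hb : -1 <= Re z / r <= 1).
  { split; [apply Rle_div_r|apply Rle_div_l]; try exact Hr; nra. }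
  rewrite exp_ln, cos_acos, sin_acos by assumption.
  replace (1 - (Re z / r)²) with ((Im z / r)²).
  - rewrite sqrt_Rsqr by now apply Rle_mult_inv_pos.
    destruct z as [x y]. unfold Re, Im; simpl. f_equal; field; lra.
  - unfold Rsqr. replace (Im z / r * (Im z / r)) with (Im z ^ 2 / r ^ 2) by (field; lra).
    replace (Im z ^ 2) with (r ^ 2 - Re z ^ 2) by lra. field. lra.
Qed.

Lemma offray_inv (z : C) : off_ray z -> off_ray (/ z).
Proof.
  intros Hz. assert (Z0 := offray_neq_0 z Hz). destruct z as [x y].
  unfold off_ray, Re, Im, Cinv in *; simpl in *.
  intros [A B]. apply Hz.
  assert (D : 0 < x * (x * 1) + y * (y * 1)).
  { assert (x <> 0 \/ y <> 0) as [E|E].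
    - destruct (Req_dec x 0); [right|left; assumption]. intro. subst. now apply Z0.
    - nra.
    - nra. }
  set (d := x * (x * 1) + y * (y * 1)) in *. assert (Di := Rinv_0_lt_compat d D).
  unfold Rdiv in *. split; nra.
Qed.

(** Re w = Arg z / (2 pi), and Arg z lies in (0, pi] because Im z >= 0 and z is off the ray [0,
    oo). *)
Lemma log_strip (z : C) : off_ray z -> 0 <= Im z ->
  let w := (Clog z / (RtoC 2 * RtoC PI * Ci))%C in 0 < Re w <= 1 / 2 /\ cexp2pi w = z.
Proof.
  intros Hz Hi w. assert (Z0 := offray_neq_0 z Hz). assert (PP := PI_RGT_0).
  assert (P0 : RtoC PI <> 0%C) by (apply RtoC_neq_0; lra).
  assert (I0 : Ci <> 0%C) by (intro E; injection E; lra).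
  split.
  - replace (Re w) with (Carg z / (2 * PI)).
    2: { unfold w, Clog, Cdiv, Cinv, Cmult, Ci, RtoC, Re; simpl. field. lra. }
    unfold Carg. destruct Rle_dec as [_|H]; [|lra].
    assert (B := acos_bound (Re z / Cmod z)).
    assert (Hne : acos (Re z / Cmod z) <> 0).
    { intro E. assert (Hr := proj1 (Cmod_gt_0 z) Z0). assert (Hr2 := Cmod_sq z).
      assert (Hb : -1 <= Re z / Cmod z <= 1).
      { split; [apply Rle_div_r|apply Rle_div_l]; try exact Hr; nra. }
      assert (X := cos_acos _ Hb). rewrite E, cos_0 in X.
      assert (Y : Re z = Cmod z). { apply Rmult_eq_reg_r with (/ Cmod z); [|apply Rinv_neq_0_compat; lra].
      rewrite Rinv_r by lra. symmetry; exact X. }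
      apply Hz. rewrite Y in *. split; nra. }
    split; [apply Rdiv_lt_0_compat; lra|]. apply Rle_div_l; lra.
  - unfold cexp2pi. transitivity (Cexp (Clog z)); [|now apply Cexp_Clog]. f_equal. unfold w.
    rewrite RtoC_mult. field. split; assumption.
Qed.

(** With E = exp t and A = 1 / (E - 1 / z) - z^3 / (E - z), the power z^3 makes A + z (1 - z) factor
    as z^2 (1 - z) E (E + 1) / ((E - z) (E z - 1)). Since cosh t - cos (2 pi w) = (E - z) (E z - 1)
    / (2 E z), multiplication by [expc t] turns this into z (1 - z) times the kernel. *)
Lemma gen_gamma_integrand (z w : C) (t : R) : off_ray z -> strip w -> cexp2pi w = z -> t <> 0 ->
  (gamma_integrand_exp (/ z) t - z ^ 3 * gamma_integrand_exp z t =
   (/ (RtoC (exp t) - / z) - z ^ 3 * / (RtoC (exp t) - z)) + z * (1 - z) * (RtoC (expc t) - kernel w t))%C.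
Proof.
  intros Hz Hw Htp Ht. assert (Z0 := offray_neq_0 z Hz).
  assert (N1 := exp_minus_neq_0 z t Hz). assert (N2 := exp_minus_neq_0 _ t (offray_inv z Hz)).
  assert (N3 := kernel_den_neq_0 t w Hw).
  assert (T0 : RtoC t <> 0%C) by (intro E; apply RtoC_inj in E; contradiction).
  assert (Pe := exp_pos t). assert (E0 : RtoC (exp t) <> 0%C) by (apply RtoC_neq_0; lra).
  assert (Ee : RtoC (expc t) = ((1 - / RtoC (exp t)) / RtoC t)%C).
  { unfold expc. destruct Req_EM_T; [contradiction|].
    rewrite RtoC_div, RtoC_minus, exp_Ropp, RtoC_inv by lra. reflexivity. }
  assert (Es : RtoC (sinhc t) = ((RtoC (exp t) - / RtoC (exp t)) / 2 / RtoC t)%C).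
  { unfold sinhc. destruct Req_EM_T; [contradiction|]. unfold sinh.
    rewrite !RtoC_div, RtoC_minus, exp_Ropp, RtoC_inv by lra. reflexivity. }
  assert (Ec : RtoC (cosh t) = ((RtoC (exp t) + / RtoC (exp t)) / 2)%C).
  { unfold cosh. rewrite RtoC_div, RtoC_plus, exp_Ropp, RtoC_inv by lra. reflexivity. }
  unfold gamma_integrand_exp, kernel.
  unfold ccos2pi in *. rewrite Htp in *. rewrite RtoC_minus, Ee, Es, Ec in *.
  set (E := RtoC (exp t)) in *.
  assert (N4 : (E * z - 1)%C <> 0%C).
  { intro X. apply N2. replace (E - / z)%C with ((E * z - 1) / z)%C by (field; exact Z0). rewrite X. field.
    exact Z0. }
  assert (Ed : ((E + / E) / 2 - (z + / z) / 2)%C = ((E - z) * (E * z - 1) / (2 * E * z))%C) by (field; now split).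
  rewrite Ed.
  replace (E - / z)%C with ((E * z - 1) / z)%C by (field; exact Z0).
  field. repeat split; assumption.
Qed.

Theorem theorem12 (z : C) :
  ~ (Im z = 0 /\ 0 <= Re z)%R -> (0 <= Im z)%R ->
  gen_gamma (/ z)%C =
  (z ^ 3 * gen_gamma z - RtoC PI * Ci * z
   + z ^ 2 * Clog (RtoC 1 - z) - z * Clog ((z - RtoC 1) / z)
   + z * (RtoC 1 - z) *
     (RtoC euler_gamma + RtoC (ln (2 * PI)) + RtoC PI * Ci / RtoC 2
      + digamma (Clog z / (RtoC 2 * RtoC PI * Ci))))%C.
Proof.
  intros Hz Hi. fold (off_ray z) in Hz.
  destruct (log_strip z Hz Hi) as [Hw Htp]. set (w := (Clog z / (RtoC 2 * RtoC PI * Ci))%C) in *.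
  assert (Z0 := offray_neq_0 z Hz). assert (Hz' := offray_inv z Hz).
  assert (Sw : strip w) by (unfold strip; lra).
  assert (HD := defect_value w ltac:(lra)). unfold defect in HD.
  assert (L1 := Clim_minus (F := Rbar_locally p_infty) _ _ _ _ (Clim_gen_gamma _ Hz') (Clim_scal (z ^ 3)%C _ _ (Clim_gen_gamma z Hz))).
  assert (L2 := Clim_minus (F := Rbar_locally p_infty) _ _ _ _ (Clim_log_integral _ Hz') (Clim_scal (z ^ 3)%C _ _ (Clim_log_integral z Hz))).
  (* [expc_integral_lim] is a limit over the integers, so every limit is restricted to T = n; the
     terms [ln n] subtracted in [L3] and [L4] then cancel. *)
  apply (Clim_comp eventually _ INR _ _ is_lim_seq_INR) in L1.
  apply (Clim_comp eventually _ INR _ _ is_lim_seq_INR) in L2.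
  assert (L3 := Clim_comp eventually _ INR _ _ is_lim_seq_INR (J_lim w Sw)).
  assert (L4 := Clim_RtoC (F := eventually) _ _ expc_integral_lim).
  assert (L5 := Clim_plus (F := eventually) _ _ _ _ L2 (Clim_scal (z * (1 - z))%C _ _ (Clim_minus _ _ _ _ L4 L3))).
  assert (Key : (gen_gamma (/ z) - z ^ 3 * gen_gamma z =
     - (Clog (1 - / z) / / z) - z ^ 3 * - (Clog (1 - z) / z) + z * (1 - z) * (RtoC euler_gamma - J w))%C).
  { refine (Clim_unique (F := eventually) _ _ _ L1 _). revert L5. apply Clim_ext. intro n.
    assert (HN := pos_INR n). set (T := INR n) in *.
    assert (Ig : forall a, off_ray a -> is_CRInt (gamma_integrand_exp a) 0 T (CRInt (gamma_integrand_exp a) 0 T)).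
    { intros a Ha. apply is_CRInt_CRInt, ex_CRInt_continuous; [exact HN|].
      intros; now apply continuous_gamma_integrand_exp. }
    assert (Il : forall a, off_ray a -> is_CRInt (fun t => / (RtoC (exp t) - a))%C 0 T (CRInt (fun t => / (RtoC (exp t) - a))%C 0 T)).
    { intros a Ha. apply is_CRInt_CRInt, ex_CRInt_continuous; [exact HN|].
      intros; now apply continuous_inv_exp_minus. }
    assert (Ie : is_RInt expc 0 T (RInt expc 0 T)).
    { apply (RInt_correct (V := R_CompleteNormedModule)), (ex_RInt_continuous (V := R_CompleteNormedModule)).
      intros; apply continuous_expc. }
    assert (R1 := is_CRInt_minus _ _ _ _ _ _ (Ig _ Hz') (is_CRInt_mult (z ^ 3) _ _ _ _ (Ig z Hz))).
    assert (R2 := is_CRInt_plus _ _ _ _ _ _ (is_CRInt_minus _ _ _ _ _ _ (Il _ Hz') (is_CRInt_mult (z ^ 3) _ _ _ _ (Il z Hz)))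
      (is_CRInt_mult (z * (1 - z)) _ _ _ _ (is_CRInt_minus _ _ _ _ _ _ (is_CRInt_RtoC _ _ _ _ Ie) (is_CRInt_CRInt _ _ _ (ex_CRInt_kernel w 0 T Sw))))).
    apply CRInt_unique in R1.
    apply (is_RInt_ext (V := C_R_NormedModule) _ (fun t => gamma_integrand_exp (/ z) t - z ^ 3 * gamma_integrand_exp z t)%C) in R2.
    2: { intros t Ht. rewrite Rmin_left in Ht by exact HN. symmetry.
         apply (gen_gamma_integrand z w t Hz Sw Htp). lra. }
    apply CRInt_unique in R2. rewrite <- R1, R2. unfold kernel_int. rewrite RtoC_minus. ring. }
  assert (EJ : J w = (- RtoC (ln (2 * PI)) - ccot w - digamma w)%C).
  { rewrite <- RtoC_opp, <- HD. ring. }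
  assert (N1 : (z - 1)%C <> 0%C).
  { intro X. apply Hz. replace z with (z - 1 + 1)%C by ring. rewrite X. unfold Re, Im, Cplus, RtoC; simpl.
    split; lra. }
  replace (gen_gamma (/ z)) with (gen_gamma (/ z) - z ^ 3 * gen_gamma z + z ^ 3 * gen_gamma z)%C by ring.
  rewrite Key, EJ. unfold ccot. rewrite Htp.
  replace ((z - RtoC 1) / z)%C with (1 - / z)%C by (field; exact Z0).
  field. split; assumption.
Qed.
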